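(* Let $\mathcal A^\infty_\hbar$ be the quantum Heisenberg manifold algebra with parameters $c$ (a positive integer) and $\hbar,\mu,\nu\in\mathbb R$, $\mu^2+\nu^2\neq0$, such that $\{1,\hbar\mu,\hbar\nu\}$ is linearly independent over $\mathbb Q$, with its spectral triple $(\mathcal A^\infty_\hbar,\mathcal H_\hbar,D_\hbar)$ made even with grading operator $\gamma$. Let $\mathcal A=\mathcal A^\infty_\hbar\otimes\mathcal A^\infty_\hbar$ and $D=D_\hbar\otimes1+\gamma\otimes D_\hbar$. Then $$\Omega_D^2(\mathcal A)\cong\Omega_{D_\hbar}^2(\mathcal A^\infty_\hbar)\otimes\mathcal A^\infty_\hbar\,\bigoplus\,\mathcal A^\infty_\hbar\otimes\Omega_{D_\hbar}^2(\mathcal A^\infty_\hbar)\,\bigoplus\,\Omega_{D_\hbar}^1(\mathcal A^\infty_\hbar)\otimes\Omega_{D_\hbar}^1(\mathcal A^\infty_\hbar)$$ as $\mathcal A$-bimodules.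
   Context: Write $e(x)=e^{2\pi ix}$. $S^c$ is the space of smooth functions $\Phi:\mathbb R\times\mathbb T\times\mathbb Z\to\mathbb C$ such that (1) $\Phi(x+k,y,p)=e(ckpy)\Phi(x,y,p)$ for all $k\in\mathbb Z$; (2) for every polynomial $P$ on $\mathbb Z$ and every $\widetilde X=\frac{\partial^{m+n}}{\partial x^m\partial y^n}$, the function $P(p)(\widetilde X\Phi)(x,y,p)$ is bounded on $K\times\mathbb Z$ for every compact $K\subset\mathbb R\times\mathbb T$. $\mathcal A^\infty_\hbar$ is $S^c$ with $(\Phi\star\Psi)(x,y,p)=\sum_q\Phi(x-\hbar(q-p)\mu,y-\hbar(q-p)\nu,q)\Psi(x-\hbar q\mu,y-\hbar q\nu,p-q)$ and $\Phi^*(x,y,p)=\overline{\Phi}(x,y,-p)$. The trace is $\tau(\phi)=\int_0^1\int_{\mathbb T}\phi(x,y,0)\,dx\,dy$, and $L^2(\mathcal A^\infty_\hbar,\tau)\cong L^2([0,1]\times[0,1]\times\mathbb Z)$ is its GNS space. Fix a real $\alpha>1$ and put $\delta_1(f)=-\frac{\partial f}{\partial x}$, $\delta_2(f)=2\pi icpx f(x,y,p)-\frac{\partial f}{\partial y}$, $\delta_3(f)=2\pi ipc\alpha f(x,y,p)$, and $\sigma_1=\begin{pmatrix}1&0\\0&-1\end{pmatrix}$, $\sigma_2=\begin{pmatrix}0&-1\\-1&0\end{pmatrix}$, $\sigma_3=\begin{pmatrix}0&i\\-i&0\end{pmatrix}$. Then $D_\hbar=\sum_{j=1}^3i\delta_j\otimes\sigma_j$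 on $\mathcal H_\hbar=L^2(\mathcal A^\infty_\hbar,\tau)\otimes\mathbb C^2$ gives an (odd) spectral triple. An odd spectral triple $(\mathcal A,\mathcal H,D)$ is made even by replacing it with $(\mathcal A,\mathcal H\otimes\mathbb C^2,D\otimes\sigma,\gamma=1\otimes\sigma')$ with $\sigma,\sigma'$ two distinct $2\times2$ Pauli matrices (notation $D$ kept). For a spectral triple $(\mathcal A,\mathcal H,D)$ (with $\mathcal A$ identified with its image in $\mathcal B(\mathcal H)$): $\Omega_D^1(\mathcal A)=\{\sum a_j[D,b_j]\}$, $\pi(\Omega^2(\mathcal A))=\{\sum a_j[D,b_j][D,c_j]\}$, $\pi(dJ_0^1(\mathcal A))=\{\sum[D,b_j][D,c_j]:\sum b_j[D,c_j]=0\}$ (subspaces of $\mathcal B(\mathcal H)$), and $\Omega_D^2(\mathcal A)=\pi(\Omega^2(\mathcal A))/\pi(dJ_0^1(\mathcal A))$; all are $\mathcal A$-bimodules. *)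

(* Defs.v *)
From HB Require Import structures.
From mathcomp Require Import all_boot all_order all_algebra.
From mathcomp Require Import sesquilinear complex finmap.
From mathcomp Require Import ring.
From mathcomp Require Import all_classical all_reals all_analysis.

Set Implicit Arguments.
Unset Strict Implicit.
Unset Printing Implicit Defensive.

Import Order.TTheory GRing.Theory Num.Theory numFieldNormedType.Exports.

Local Open Scope classical_set_scope.
Local Open Scope ring_scope.

Record subspace (K : fieldType) (V : lmodType K) := Subspace {
  in_subspace :> V -> Prop;
  subspace0 : in_subspace 0;
  subspaceP : forall (k : K) (u v : V),
    in_subspace u -> in_subspace v -> in_subspace (k *: u + v) }.

Section SubspaceTheory.
Variables (K : fieldType) (V : lmodType K) (U : subspace V).
Implicit Types u v : V.

Lemma subspaceD u v : U u -> U v -> U (u + v).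
Proof. by move=> Uu Uv; rewrite -[u]scale1r; apply: subspaceP. Qed.

Lemma subspaceZ (k : K) u : U u -> U (k *: u).
Proof.
by move=> Uu; rewrite -[k *: u]addr0; apply: subspaceP => //; apply: subspace0.
Qed.

Lemma subspaceN u : U u -> U (- u).
Proof. by move=> Uu; rewrite -scaleN1r; apply: subspaceZ. Qed.

Lemma subspaceB u v : U u -> U v -> U (u - v).
Proof. by move=> Uu Uv; apply: subspaceD => //; apply: subspaceN. Qed.

End SubspaceTheory.

Definition linspan (K : fieldType) (V : lmodType K) (S : set V) : set V :=
  [set v | exists s : seq (K * V),
    (forall p, p \in s -> S p.2) /\ v = \sum_(p <- s) p.1 *: p.2].

Section Span.
Variables (K : fieldType) (V : lmodType K) (S : set V).

Lemma linspan0 : linspan S 0.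
Proof. by exists [::]; split=> //; rewrite big_nil. Qed.

Lemma linspanP (k : K) (u v : V) :
  linspan S u -> linspan S v -> linspan S (k *: u + v).
Proof.
move=> [s [hs ->]] [t [ht ->]].
exists ([seq (k * p.1, p.2) | p <- s] ++ t); split.
  move=> p; rewrite mem_cat => /orP[/mapP[q qs ->]|]; last exact: ht.
  exact: (hs q).
rewrite big_cat big_map /= scaler_sumr; congr (_ + _).
by apply: eq_bigr => p _; rewrite scalerA.
Qed.

Definition span_subspace := Subspace linspan0 linspanP.

Lemma mem_linspan v : S v -> linspan S v.
Proof.
move=> Sv; exists [:: (1, v)]; split; last by rewrite big_seq1 scale1r.
by move=> p; rewrite inE => /eqP ->.
Qed.

Lemma linspan_min (U : subspace V) : S `<=` (U : set V) -> linspan S `<=` (U : set V).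
Proof.
move=> SU v [s [hs ->]]; elim: s hs => [_|p s IH hs].
  by rewrite big_nil; apply: subspace0.
rewrite big_cons; apply: subspaceP; first by apply/SU/hs; rewrite mem_head.
by apply: IH => q qs; apply: hs; rewrite in_cons qs orbT.
Qed.

End Span.

Definition subsp (K : fieldType) (V : lmodType K) (U : subspace V) :=
  {v : V | U v}.

Section SubspLmod.
Variables (K : fieldType) (V : lmodType K) (U : subspace V).

HB.instance Definition _ := gen_eqMixin (subsp U).
HB.instance Definition _ := gen_choiceMixin (subsp U).

Lemma subsp_inj (x y : subsp U) : sval x = sval y -> x = y.
Proof. by case: x y => [x Ux] [y Uy] /= e; apply: eq_exist. Qed.

Let zero : subsp U := exist _ 0 (subspace0 U).
Let opp (x : subsp U) : subsp U := exist _ _ (subspaceN (svalP x)).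
Let add (x y : subsp U) : subsp U :=
  exist _ _ (subspaceD (svalP x) (svalP y)).
Let scale (k : K) (x : subsp U) : subsp U :=
  exist _ _ (subspaceZ k (svalP x)).

Let addA : associative add.
Proof. by move=> x y z; apply: subsp_inj; rewrite /= addrA. Qed.
Let addC : commutative add.
Proof. by move=> x y; apply: subsp_inj; rewrite /= addrC. Qed.
Let add0 : left_id zero add.
Proof. by move=> x; apply: subsp_inj; rewrite /= add0r. Qed.
Let addN : left_inverse zero opp add.
Proof. by move=> x; apply: subsp_inj; rewrite /= addNr. Qed.
HB.instance Definition _ := GRing.isZmodule.Build (subsp U) addA addC add0 addN.

Let scaleA a b x : scale a (scale b x) = scale (a * b) x.
Proof. by apply: subsp_inj; rewrite /= scalerA. Qed.
Let scale1 : left_id 1 scale.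
Proof. by move=> x; apply: subsp_inj; rewrite /= scale1r. Qed.
Let scaleDr : right_distributive scale +%R.
Proof. by move=> a x y; apply: subsp_inj; rewrite /= scalerDr. Qed.
Let scaleDl x : {morph scale^~ x : a b / a + b}.
Proof. by move=> a b; apply: subsp_inj; rewrite /= scalerDl. Qed.
HB.instance Definition _ := GRing.Zmodule_isLmodule.Build K (subsp U)
  scaleA scale1 scaleDr scaleDl.

Lemma sval_linear : linear (fun x : subsp U => sval x).
Proof. by []. Qed.

End SubspLmod.

Definition coset_sp (K : fieldType) (V : lmodType K) (U : subspace V) (v : V) :
  set V := [set w | U (w - v)].

Definition quotsp (K : fieldType) (V : lmodType K) (U : subspace V) :=
  {X : set V | exists v, X = coset_sp U v}.

Section QuotLmod.
Variables (K : fieldType) (V : lmodType K) (U : subspace V).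

HB.instance Definition _ := gen_eqMixin (quotsp U).
HB.instance Definition _ := gen_choiceMixin (quotsp U).

Definition qclass (v : V) : quotsp U :=
  exist _ (coset_sp U v) (ex_intro _ v erefl).
Definition qrepr (X : quotsp U) : V := xget 0 (sval X).

Lemma qclassP v w : qclass v = qclass w <-> U (v - w).
Proof.
split=> [e|Uvw].
  have : coset_sp U v v by rewrite /coset_sp /= subrr; apply: subspace0.
  have -> : coset_sp U v = coset_sp U w by exact: (congr1 sval e).
  by [].
have e : coset_sp U v = coset_sp U w.
  apply/seteqP; split=> x /= Ux; rewrite /coset_sp /=.
    by rewrite -[x](subrK v) -addrA; apply: subspaceD.
  rewrite -[x](subrK w) -addrA; apply: subspaceD => //.
  by rewrite -opprB; apply: subspaceN.
by apply: eq_exist.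
Qed.

Lemma qreprK : cancel qrepr qclass.
Proof.
move=> [X [v eX]].
have Xv : coset_sp U v v by rewrite /coset_sp /= subrr; apply: subspace0.
have h : coset_sp U v (xget 0 X).
  by rewrite eX; exact: (xgetPex 0 (ex_intro _ v Xv)).
transitivity (qclass v); first exact/qclassP.
by apply: eq_exist.
Qed.

Lemma qclassK v : U (qrepr (qclass v) - v).
Proof. by apply/qclassP; rewrite qreprK. Qed.

Let zero : quotsp U := qclass 0.
Let opp (x : quotsp U) : quotsp U := qclass (- qrepr x).
Let add (x y : quotsp U) : quotsp U := qclass (qrepr x + qrepr y).
Let scale (k : K) (x : quotsp U) : quotsp U := qclass (k *: qrepr x).

Let oppE v : opp (qclass v) = qclass (- v).
Proof.
by apply/qclassP; rewrite -opprD; apply: subspaceN; exact: qclassK.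
Qed.
Let addE v w : add (qclass v) (qclass w) = qclass (v + w).
Proof.
by apply/qclassP; rewrite opprD addrACA; apply: subspaceD; exact: qclassK.
Qed.
Let scaleE k v : scale k (qclass v) = qclass (k *: v).
Proof.
by apply/qclassP; rewrite -scalerBr; apply: subspaceZ; exact: qclassK.
Qed.

Let addA : associative add.
Proof.
move=> x y z; rewrite -[x]qreprK -[y]qreprK -[z]qreprK.
by rewrite !addE addrA.
Qed.
Let addC : commutative add.
Proof. by move=> x y; rewrite /add addrC. Qed.
Let add0 : left_id zero add.
Proof. by move=> x; rewrite -[x]qreprK addE add0r. Qed.
Let addN : left_inverse zero opp add.
Proof. by move=> x; rewrite -[x]qreprK oppE addE addNr. Qed.
HB.instance Definition _ :=
  GRing.isZmodule.Build (quotsp U) addA addC add0 addN.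

Let scaleA a b x : scale a (scale b x) = scale (a * b) x.
Proof. by rewrite -[x]qreprK !scaleE scalerA. Qed.
Let scale1 : left_id 1 scale.
Proof. by move=> x; rewrite -[x]qreprK scaleE scale1r. Qed.
Let scaleDr : right_distributive scale +%R.
Proof.
move=> a x y; rewrite -[x]qreprK -[y]qreprK.
by rewrite [qclass _ + _]addE !scaleE [RHS]addE scalerDr.
Qed.
Let scaleDl x : {morph scale^~ x : a b / a + b}.
Proof.
by move=> a b; rewrite -[x]qreprK !scaleE [RHS]addE scalerDl.
Qed.
HB.instance Definition _ := GRing.Zmodule_isLmodule.Build K (quotsp U)
  scaleA scale1 scaleDr scaleDl.

Lemma qclass_linear : linear qclass.
Proof. by move=> k u v; rewrite -[LHS]addE -scaleE. Qed.

End QuotLmod.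

Arguments qclass {K V} U v.

Section FreeModule.
Variables (K : fieldType) (X : choiceType).

Let fin0 : finite_set [set x : X | (0 : X -> K^o) x != 0].
Proof. by rewrite (_ : [set x | _] = set0) //; apply/seteqP; split=> x //= /eqP. Qed.

Let finP (k : K) (f g : X -> K^o) :
  finite_set [set x | f x != 0] -> finite_set [set x | g x != 0] ->
  finite_set [set x | (k *: f + g) x != 0].
Proof.
move=> hf hg; apply: (@sub_finite_set _ _ ([set x | f x != 0] `|` [set x | g x != 0])).
  move=> x /=; rewrite !fctE => h.
  have [fx|] := eqVneq (f x) 0; last by left.
  by right; apply: contra h => /eqP ->; rewrite fx scaler0 addr0.
by rewrite finite_setU.
Qed.

Definition finsupp := @Subspace K (X -> K^o) [set f | finite_set [set x | f x != 0]]
  fin0 finP.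

Definition free_module := subsp finsupp.
HB.instance Definition _ := GRing.Lmodule.on free_module.


Lemma delta_fin (x : X) : finsupp (fun y => (y == x)%:R).
Proof.
apply: (@sub_finite_set _ _ [set x]) => // y /=.
by have [->|] := eqVneq y x; rewrite ?eqxx.
Qed.

Definition delta (x : X) : free_module := exist _ _ (delta_fin x).

Variable Z : lmodType K.

Definition free_lift (b : X -> Z) (f : free_module) : Z :=
  \sum_(x \in [set: X]) sval f x *: b x.

Lemma free_liftE b (F : set X) (f : free_module) : finite_set F ->
  [set x | sval f x != 0] `<=` F ->
  free_lift b f = \sum_(x <- fset_set F) sval f x *: b x.
Proof.
move=> finF fF; rewrite -(fsbig_finite _ _ finF).
rewrite /free_lift; apply/esym/fsbig_widen => // x [_ /= nF].
have [->|fx] := eqVneq (sval f x) 0; first by rewrite scale0r.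
by case: nF; apply: fF.
Qed.

Lemma free_lift_delta b x : free_lift b (delta x) = b x.
Proof.
rewrite (@free_liftE _ [set x]) // ?fset_set1.
  by rewrite big_seq_fset1 /= eqxx scale1r.
by move=> y /=; have [->//|] := eqVneq y x; rewrite eqxx.
Qed.

Lemma free_lift_linear b : linear (free_lift b).
Proof.
move=> k f g.
pose F := [set x | sval f x != 0] `|` [set x | sval g x != 0]
  `|` [set x | sval (k *: f + g) x != 0].
have finF : finite_set F.
  by rewrite !finite_setU; exact: (conj (conj (svalP f) (svalP g)) (svalP (k *: f + g))).
have Ff : [set x | sval f x != 0] `<=` F by move=> x h; left; left.
have Fg : [set x | sval g x != 0] `<=` F by move=> x h; left; right.
have Fh : [set x | sval (k *: f + g) x != 0] `<=` F by move=> x h; right.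
rewrite (free_liftE _ finF Ff) (free_liftE _ finF Fg) (free_liftE _ finF Fh).
rewrite scaler_sumr -big_split; apply: eq_bigr => x _ /=.
by rewrite !fctE scalerDl scalerA.
Qed.

Lemma free_spanned (f : free_module) :
  linspan [set g | exists x, g = delta x] f.
Proof.
pose F := fset_set [set x | sval f x != 0].
exists [seq (sval f x, delta x) | x <- F]; split.
  by move=> p /mapP[x _ ->] /=; exists x.
rewrite big_map /=; apply: subsp_inj; apply/funext => y.
have evD : {morph (fun h : free_module => sval h y) : u v / u + v} by [].
have ev0 : sval (0 : free_module) y = 0 by [].
rewrite [RHS](big_morph _ evD ev0).
have [yF|yF] := boolP (y \in F).
  rewrite (big_fsetD1 y) //= !fctE eqxx big1_fset ?addr0; first exact/esym/mulr1.
  move=> x /fsetD1P[xy _] _; rewrite /= !fctE.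
  by rewrite (negbTE (_ : y != x)) ?scaler0 // eq_sym.
rewrite big1_fset.
  apply/eqP; apply: contraNT yF => h.
  by rewrite /F in_fset_set ?inE //; exact: (svalP f).
move=> x xF _; rewrite /= !fctE (_ : y == x = false) ?scaler0 //.
by apply/eqP => e; move: yF; rewrite e xF.
Qed.

End FreeModule.

Definition bilin (K : fieldType) (V W Z : lmodType K) (b : V -> W -> Z) :=
  (forall w, linear (b^~ w)) /\ (forall v, linear (b v)).

Definition tensor_relator (K : fieldType) (V W : lmodType K) :
    set (free_module K (V * W)%type) :=
  [set r | (exists k v v' w, r = delta K (k *: v + v', w)
                                 - (k *: delta K (v, w) + delta K (v', w)))
        \/ (exists k v w w', r = delta K (v, k *: w + w')
                                 - (k *: delta K (v, w) + delta K (v, w')))].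

Definition tensor (K : fieldType) (V W : lmodType K) :=
  quotsp (span_subspace (@tensor_relator K V W)).

HB.instance Definition _ (K : fieldType) (V W : lmodType K) :=
  GRing.Lmodule.on (tensor V W).

Definition tens (K : fieldType) (V W : lmodType K) (v : V) (w : W) :
  tensor V W := qclass _ (delta K (v, w)).

Section LinearExt.
Variables (K : fieldType) (V Z : lmodType K).

Lemma linear_at0 (f : V -> Z) : linear f -> f 0 = 0.
Proof.
move=> lf; have := lf (-1) 0 0.
by rewrite scaler0 addr0 scaleN1r addNr.
Qed.

Definition eq_subspace (f g : V -> Z) (lf : linear f) (lg : linear g) :
  subspace V.
Proof.
refine (@Subspace K V (fun v => f v = g v) _ _).
  by rewrite !linear_at0.
by move=> k u v eu ev; rewrite lf lg eu ev.
Defined.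

End LinearExt.

Section TensorTheory.
Variables (K : fieldType) (V W : lmodType K).

Lemma tens_bilin : bilin (@tens K V W).
Proof.
split=> [w k v v'|v k w w'].
  rewrite -[RHS]qclass_linear; apply/qclassP; apply: mem_linspan.
  by left; exists k, v, v', w.
rewrite -[RHS]qclass_linear; apply/qclassP; apply: mem_linspan.
by right; exists k, v, w, w'.
Qed.

Lemma tens_spanned (t : tensor V W) :
  linspan [set u | exists v w, u = tens v w] t.
Proof.
rewrite -[t]qreprK; have [s [hs ->]] := free_spanned (qrepr t).
exists [seq (p.1, qclass _ p.2) | p <- s]; split.
  move=> p /mapP[q qs ->] /=; have [[v w] ->] := hs q qs.
  by exists v, w.
rewrite big_map /=.
pose q : free_module K (V * W)%type -> tensor V W := qclass _.
have ql : linear q := @qclass_linear _ _ _.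
have qD : {morph q : u v / u + v}.
  by move=> u v; have := ql 1 u v; rewrite !scale1r.
have q0 : q 0 = 0 by apply: linear_at0.
rewrite -/(q _) (big_morph _ qD q0); apply: eq_bigr => p _.
by rewrite -[p.1 *: p.2]addr0 ql q0 addr0.
Qed.

Lemma tensor_ext (Z : lmodType K) (f g : tensor V W -> Z) :
  linear f -> linear g -> (forall v w, f (tens v w) = g (tens v w)) -> f =1 g.
Proof.
move=> lf lg fg t.
suff h : [set u | exists v w, u = tens v w] `<=` (eq_subspace lf lg : set _).
  exact: (linspan_min h (tens_spanned t)).
by move=> u [v [w ->]]; exact: fg.
Qed.

Variables (Z : lmodType K) (b : V -> W -> Z).

Definition tlift (t : tensor V W) : Z :=
  free_lift (fun p => b p.1 p.2) (qrepr t).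

Hypothesis bb : bilin b.

Let fl := free_lift (fun p => b p.1 p.2).
Let fl_lin : linear fl := free_lift_linear _.

Let fl_rel r : linspan (@tensor_relator K V W) r -> fl r = 0.
Proof.
have lz : linear (fun _ : free_module K (V * W)%type => 0 : Z).
  by move=> k u v; rewrite scaler0 addr0.
move=> hr; suff h : @tensor_relator K V W `<=` (eq_subspace fl_lin lz : set _).
  exact: (linspan_min h hr).
have flB u v : fl (u - v) = fl u - fl v.
  by rewrite addrC -[- v]scaleN1r fl_lin scaleN1r addrC.
by move=> u [[k [v [v' [w ->]]]]|[k [v [w [w' ->]]]]] /=;
  rewrite flB fl_lin /fl !free_lift_delta /= ?(bb.1 w) ?(bb.2 v) subrr.
Qed.

Lemma tlift_class f : tlift (qclass _ f) = fl f.
Proof.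
have := fl_rel (qclassK (span_subspace (@tensor_relator K V W)) f).
rewrite addrC -[- f]scaleN1r fl_lin scaleN1r addrC.
by move/eqP; rewrite subr_eq0 => /eqP.
Qed.

Lemma tlift_tens v w : tlift (tens v w) = b v w.
Proof. by rewrite /tens tlift_class /fl free_lift_delta. Qed.

Lemma tlift_linear : linear tlift.
Proof.
move=> k x y; rewrite -[x]qreprK -[y]qreprK -qclass_linear !tlift_class.
exact: fl_lin.
Qed.

End TensorTheory.

(* Unital associative K-algebras. Unlike algType, the zero algebra is allowed:
   1 != 0 would otherwise have to be proved for tensor products. *)
Record algebra (K : fieldType) := Algebra {
  acar :> lmodType K;
  amul : acar -> acar -> acar;
  aone : acar;
  amul_bilin : bilin amul;
  amulA : associative amul;
  amul1 : left_id aone amul;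
  amulr1 : right_id aone amul }.

Notation "x ** y" := (amul x y) (at level 40, left associativity) : ring_scope.

Section AlgebraTheory.
Variables (K : fieldType) (A : algebra K).
Implicit Types x y : A.

Lemma amulDl x y z : (x + y) ** z = x ** z + y ** z.
Proof. by have := (amul_bilin A).1 z 1 x y; rewrite !scale1r. Qed.
Lemma amulDr x y z : x ** (y + z) = x ** y + x ** z.
Proof. by have := (amul_bilin A).2 x 1 y z; rewrite !scale1r. Qed.
Lemma amul0 x : 0 ** x = 0.
Proof. exact: (linear_at0 ((amul_bilin A).1 x)). Qed.
Lemma amulr0 x : x ** 0 = 0.
Proof. exact: (linear_at0 ((amul_bilin A).2 x)). Qed.
Lemma amulZl k x y : (k *: x) ** y = k *: (x ** y).
Proof. by have := (amul_bilin A).1 y k x 0; rewrite amul0 !addr0. Qed.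
Lemma amulZr k x y : x ** (k *: y) = k *: (x ** y).
Proof. by have := (amul_bilin A).2 x k y 0; rewrite amulr0 !addr0. Qed.
Lemma amulNl x y : (- x) ** y = - (x ** y).
Proof. by rewrite -scaleN1r amulZl scaleN1r. Qed.
Lemma amulNr x y : x ** (- y) = - (x ** y).
Proof. by rewrite -[- y]scaleN1r amulZr scaleN1r. Qed.
Lemma amulBl x y z : (x - y) ** z = x ** z - y ** z.
Proof. by rewrite amulDl amulNl. Qed.
Lemma amulBr x y z : x ** (y - z) = x ** y - x ** z.
Proof. by rewrite amulDr amulNr. Qed.
Lemma amul_sumr (I : Type) (r : seq I) (F : I -> A) x :
  x ** (\sum_(i <- r) F i) = \sum_(i <- r) x ** F i.
Proof. exact: (big_morph _ (amulDr x) (amulr0 x)). Qed.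
Lemma amul_suml (I : Type) (r : seq I) (F : I -> A) x :
  (\sum_(i <- r) F i) ** x = \sum_(i <- r) F i ** x.
Proof. exact: (big_morph (fun y => y ** x) (fun y z => amulDl y z x) (amul0 x)). Qed.

End AlgebraTheory.

Section TensorMap.
Variables (K : fieldType) (V W V' W' : lmodType K).
Variables (f : V -> V') (g : W -> W').

Definition tmap : tensor V W -> tensor V' W' :=
  tlift (fun v w => tens (f v) (g w)).

Hypotheses (lf : linear f) (lg : linear g).

Lemma tmap_bilin : bilin (fun v w => tens (f v) (g w)).
Proof.
split=> [w k v v'|v k w w'] /=.
  by rewrite lf (tens_bilin V' W').1.
by rewrite lg (tens_bilin V' W').2.
Qed.

Lemma tmap_tens v w : tmap (tens v w) = tens (f v) (g w).
Proof. exact: (tlift_tens tmap_bilin). Qed.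

Lemma tmap_linear : linear tmap.
Proof. exact: (tlift_linear tmap_bilin). Qed.

End TensorMap.

Section LinearFun.
Variables (K : fieldType).

Lemma linear_compo (U V W : lmodType K) (f : V -> W) (g : U -> V) :
  linear f -> linear g -> linear (f \o g).
Proof. by move=> lf lg k u v; rewrite /= lg lf. Qed.

Lemma linear_comb (U V : lmodType K) (k : K) (f g : U -> V) :
  linear f -> linear g -> linear (fun x => k *: f x + g x).
Proof.
move=> lf lg l u v; rewrite lf lg !scalerDr !scalerA [k * l]mulrC.
by rewrite addrACA.
Qed.

End LinearFun.

Section TensorAct.
Variables (K : fieldType) (V1 V2 V3 W1 W2 W3 : lmodType K).
Variables (a : V1 -> V2 -> V3) (b : W1 -> W2 -> W3).

Definition tact (s : tensor V1 W1) (t : tensor V2 W2) : tensor V3 W3 :=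
  tlift (fun v w => tmap (a v) (b w) t) s.

Hypotheses (ba : bilin a) (bb : bilin b).

Let tact_bilin t : bilin (fun v w => tmap (a v) (b w) t).
Proof.
split=> [w k v v'|v k w w'].
  apply: (@tensor_ext _ _ _ _ (tmap (a (k *: v + v')) (b w))
    (fun t => k *: tmap (a v) (b w) t + tmap (a v') (b w) t)).
  - by apply: tmap_linear; [exact: ba.2|exact: bb.2].
  - by apply: linear_comb; apply: tmap_linear; (exact: ba.2 || exact: bb.2).
  move=> x y; rewrite !tmap_tens; try (exact: ba.2 || exact: bb.2).
  by rewrite (ba.1 x) (tens_bilin V3 W3).1.
apply: (@tensor_ext _ _ _ _ (tmap (a v) (b (k *: w + w')))
  (fun t => k *: tmap (a v) (b w) t + tmap (a v) (b w') t)).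
- by apply: tmap_linear; [exact: ba.2|exact: bb.2].
- by apply: linear_comb; apply: tmap_linear; (exact: ba.2 || exact: bb.2).
move=> x y; rewrite !tmap_tens; try (exact: ba.2 || exact: bb.2).
by rewrite (bb.1 y) (tens_bilin V3 W3).2.
Qed.

Lemma tact_tens v w v' w' :
  tact (tens v w) (tens v' w') = tens (a v v') (b w w').
Proof.
by rewrite /tact (tlift_tens (tact_bilin _)) tmap_tens //; (exact: ba.2 || exact: bb.2).
Qed.

Lemma bilin_tact : bilin tact.
Proof.
split=> [t|s]; first exact: (tlift_linear (tact_bilin t)).
move=> k t t'; apply: (@tensor_ext _ _ _ _ (tact ^~ (k *: t + t'))
  (fun s => k *: tact s t + tact s t')).
- exact: (tlift_linear (tact_bilin _)).
- by apply: linear_comb; exact: (tlift_linear (tact_bilin _)).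
move=> v w; rewrite /tact !(tlift_tens (tact_bilin _)).
by apply: tmap_linear; [exact: ba.2|exact: bb.2].
Qed.

End TensorAct.

Section TensorAlgebra.
Variables (K : fieldType) (A B : algebra K).
Local Notation T := (tensor A B).

Let tmul : T -> T -> T := tact (@amul K A) (@amul K B).
Let tmulE a b a' b' : tmul (tens a b) (tens a' b') = tens (a ** a') (b ** b').
Proof. by rewrite /tmul tact_tens //; exact: amul_bilin. Qed.
Let tmul_bilin : bilin tmul.
Proof. by apply: bilin_tact; exact: amul_bilin. Qed.

Let tone : T := tens (aone A) (aone B).

Let tmulA : associative tmul.
Proof.
move=> x y z; move: x.
apply: tensor_ext => [||a b].
- exact: (tmul_bilin.1 _).
- by apply: (@linear_compo _ _ _ _ (tmul ^~ z) (tmul ^~ y)); exact: (tmul_bilin.1 _).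
move: y; apply: tensor_ext => [||a' b'].
- by apply: (@linear_compo _ _ _ _ (tmul (tens a b)) (tmul ^~ z)); [exact: (tmul_bilin.2 _)|exact: (tmul_bilin.1 _)].
- by apply: (@linear_compo _ _ _ _ (tmul ^~ z) (tmul (tens a b))); [exact: (tmul_bilin.1 _)|exact: (tmul_bilin.2 _)].
move: z; apply: tensor_ext => [||a'' b''].
- by apply: (@linear_compo _ _ _ _ (tmul _) (tmul _)); exact: (tmul_bilin.2 _).
- exact: (tmul_bilin.2 _).
by rewrite !tmulE !amulA.
Qed.

Let tmul1 : left_id tone tmul.
Proof.
apply: tensor_ext => [||a b]; [exact: (tmul_bilin.2 _)|by []|].
by rewrite tmulE !amul1.
Qed.
Let tmulr1 : right_id tone tmul.
Proof.
apply: tensor_ext => [||a b]; [exact: (tmul_bilin.1 _)|by []|].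
by rewrite tmulE !amulr1.
Qed.

Definition tensor_algebra :=
  @Algebra K T tmul tone tmul_bilin tmulA tmul1 tmulr1.

Lemma tensM a b a' b' :
  (tens a b : tensor_algebra) ** tens a' b' = tens (a ** a') (b ** b').
Proof. exact: tmulE. Qed.

End TensorAlgebra.

Record bimodule (K : fieldType) (A : algebra K) := Bimodule {
  bcar :> lmodType K;
  lact : A -> bcar -> bcar;
  ract : bcar -> A -> bcar;
  lact_bilin : bilin lact;
  ract_bilin : bilin ract;
  lact1 : forall m, lact (aone A) m = m;
  lactM : forall a b m, lact (a ** b) m = lact a (lact b m);
  ract1 : forall m, ract m (aone A) = m;
  ractM : forall a b m, ract m (a ** b) = ract (ract m a) b;
  lractA : forall a m b, ract (lact a m) b = lact a (ract m b) }.

Definition bimodule_iso (K : fieldType) (A : algebra K) (M N : bimodule A) :=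
  exists f : M -> N,
    [/\ linear f, bijective f,
        forall a m, f (lact a m) = lact a (f m) &
        forall m a, f (ract m a) = ract (f m) a].

Definition regular_bimodule (K : fieldType) (A : algebra K) : bimodule A.
Proof.
refine (@Bimodule K A A (@amul K A) (@amul K A) (amul_bilin A) (amul_bilin A)
  (@amul1 K A) _ (@amulr1 K A) _ _).
- by move=> a b m; rewrite amulA.
- by move=> a b m; rewrite amulA.
- by move=> a m b; rewrite amulA.
Defined.

Section DirectSum.
Variables (K : fieldType) (A : algebra K) (M N : bimodule A).

Let sl (a : A) (m : M * N) : M * N := (lact a m.1, lact a m.2).
Let sr (m : M * N) (a : A) : M * N := (ract m.1 a, ract m.2 a).

Definition dsum_bimodule : bimodule A.
Proof.
refine (@Bimodule K A (M * N)%type sl sr _ _ _ _ _ _ _).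
- split=> [[m n] k a b|a k [m n] [m' n']]; rewrite /sl /=.
    by rewrite (lact_bilin M).1 (lact_bilin N).1.
  by rewrite (lact_bilin M).2 (lact_bilin N).2.
- split=> [a k [m n] [m' n']|[m n] k a b]; rewrite /sr /=.
    by rewrite (ract_bilin M).1 (ract_bilin N).1.
  by rewrite (ract_bilin M).2 (ract_bilin N).2.
- by move=> [m n]; rewrite /sl /= !lact1.
- by move=> a b [m n]; rewrite /sl /= !lactM.
- by move=> [m n]; rewrite /sr /= !ract1.
- by move=> a b [m n]; rewrite /sr /= !ractM.
- by move=> a [m n] b; rewrite /sr /sl /= !lractA.
Defined.

End DirectSum.

(* (a (x) b) . (m (x) n) = am (x) bn, and likewise on the right. *)
Section ExternalTensor.
Variables (K : fieldType) (A B : algebra K) (M : bimodule A) (N : bimodule B).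
Local Notation T := (tensor M N).

Let tl : tensor_algebra A B -> T -> T := tact (@lact K A M) (@lact K B N).
Let tr : T -> tensor_algebra A B -> T := tact (@ract K A M) (@ract K B N).

Let tlE a b m n : tl (tens a b) (tens m n) = tens (lact a m) (lact b n).
Proof. by rewrite /tl tact_tens //; exact: lact_bilin. Qed.
Let trE a b m n : tr (tens m n) (tens a b) = tens (ract m a) (ract n b).
Proof. by rewrite /tr tact_tens //; exact: ract_bilin. Qed.
Let tlb : bilin tl.
Proof. by apply: bilin_tact; exact: lact_bilin. Qed.
Let trb : bilin tr.
Proof. by apply: bilin_tact; exact: ract_bilin. Qed.
Let mb := amul_bilin (tensor_algebra A B).

Let tl1 t : tl (aone _) t = t.
Proof.
move: t; apply: tensor_ext => [||m n]; [exact: (tlb.2 _)|by []|].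
by rewrite tlE !lact1.
Qed.

Let tlM a b t : tl (a ** b) t = tl a (tl b t).
Proof.
move: t; apply: tensor_ext => [||m n]; first exact: (tlb.2 _).
  exact: (linear_compo (tlb.2 _) (tlb.2 _)).
move: a; apply: tensor_ext => [||a1 a2].
- exact: (linear_compo (tlb.1 _) (mb.1 _)).
- exact: (tlb.1 _).
move: b; apply: tensor_ext => [||b1 b2].
- exact: (linear_compo (tlb.1 _) (mb.2 _)).
- exact: (linear_compo (tlb.2 _) (tlb.1 _)).
by rewrite tensM !tlE !lactM.
Qed.

Let tr1 t : tr t (aone _) = t.
Proof.
move: t; apply: tensor_ext => [||m n]; [exact: (trb.1 _)|by []|].
by rewrite trE !ract1.
Qed.

Let trM a b t : tr t (a ** b) = tr (tr t a) b.
Proof.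
move: t; apply: tensor_ext => [||m n]; first exact: (trb.1 _).
  exact: (linear_compo (trb.1 _) (trb.1 _)).
move: a; apply: tensor_ext => [||a1 a2].
- exact: (linear_compo (trb.2 _) (mb.1 _)).
- exact: (linear_compo (trb.1 _) (trb.2 _)).
move: b; apply: tensor_ext => [||b1 b2].
- exact: (linear_compo (trb.2 _) (mb.2 _)).
- exact: (trb.2 _).
by rewrite tensM !trE !ractM.
Qed.

Let tlrA a t b : tr (tl a t) b = tl a (tr t b).
Proof.
move: t; apply: tensor_ext => [||m n].
- exact: (linear_compo (trb.1 _) (tlb.2 _)).
- exact: (linear_compo (tlb.2 _) (trb.1 _)).
move: a; apply: tensor_ext => [||a1 a2].
- exact: (linear_compo (trb.1 _) (tlb.1 _)).
- exact: (tlb.1 _).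
move: b; apply: tensor_ext => [||b1 b2].
- exact: (trb.2 _).
- exact: (linear_compo (tlb.2 _) (trb.2 _)).
by rewrite tlE !trE tlE !lractA.
Qed.

Definition tensor_bimodule : bimodule (tensor_algebra A B) :=
  @Bimodule K (tensor_algebra A B) T tl tr tlb trb tl1 tlM tr1 trM tlrA.

End ExternalTensor.

Section QuotientBimodule.
Variables (K : fieldType) (A : algebra K) (M : bimodule A) (U : subspace M).
Hypothesis Ul : forall a m, U m -> U (lact a m).
Hypothesis Ur : forall a m, U m -> U (ract m a).

Let ql (a : A) (x : quotsp U) : quotsp U := qclass U (lact a (qrepr x)).
Let qr (x : quotsp U) (a : A) : quotsp U := qclass U (ract (qrepr x) a).

Let lB a : {morph @lact K A M a : u v / u - v}.
Proof.
move=> u v; rewrite addrC -scaleN1r ((lact_bilin M).2 a (-1)).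
by rewrite scaleN1r addrC.
Qed.
Let rB a : {morph (@ract K A M)^~ a : u v / u - v}.
Proof.
move=> u v; rewrite addrC -scaleN1r ((ract_bilin M).1 a (-1)).
by rewrite scaleN1r addrC.
Qed.

Let qlE a m : ql a (qclass U m) = qclass U (lact a m).
Proof. by apply/qclassP; rewrite -lB; apply: Ul; exact: qclassK. Qed.
Let qrE a m : qr (qclass U m) a = qclass U (ract m a).
Proof. by apply/qclassP; rewrite -rB; apply: Ur; exact: qclassK. Qed.

Definition quot_bimodule : bimodule A.
Proof.
refine (@Bimodule K A (quotsp U) ql qr _ _ _ _ _ _ _).
- split=> [x k a b|a k x y]; rewrite -[x]qreprK.
    by rewrite !qlE (lact_bilin M).1 qclass_linear.
  by rewrite -[y]qreprK -qclass_linear !qlE (lact_bilin M).2 qclass_linear.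
- split=> [a k x y|x k a b]; rewrite -[x]qreprK.
    by rewrite -[y]qreprK -qclass_linear !qrE (ract_bilin M).1 qclass_linear.
  by rewrite !qrE (ract_bilin M).2 qclass_linear.
- by move=> x; rewrite -[x]qreprK qlE lact1.
- by move=> a b x; rewrite -[x]qreprK !qlE lactM.
- by move=> x; rewrite -[x]qreprK qrE ract1.
- by move=> a b x; rewrite -[x]qreprK !qrE ractM.
- by move=> a x b; rewrite -[x]qreprK qlE !qrE qlE lractA.
Defined.

End QuotientBimodule.

Section Forms.
(* rho is the representation of A in B and d a is the commutator [D, rho a]. *)
Variables (K : fieldType) (A B : algebra K) (rho d : A -> B).

Definition oneform_set : set B := [set w | exists s : seq (A * A),
  w = \sum_(p <- s) rho p.1 ** d p.2].

Definition twoform_set : set B := [set w | exists s : seq (A * A * A),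
  w = \sum_(p <- s) rho p.1.1 ** d p.1.2 ** d p.2].

Definition junk_set : set B := [set w | exists s : seq (A * A),
  \sum_(p <- s) rho p.1 ** d p.2 = 0 /\ w = \sum_(p <- s) d p.1 ** d p.2].

Hypotheses (rhoL : linear rho) (rho1 : rho (aone A) = aone B).
Hypothesis rhoM : forall a b, rho (a ** b) = rho a ** rho b.
Hypothesis dL : linear d.
Hypothesis dM : forall a b, d (a ** b) = d a ** rho b + rho a ** d b.

Let lin_scale (f : A -> B) : linear f -> forall k x, f (k *: x) = k *: f x.
Proof. by move=> lf k x; rewrite -[k *: x]addr0 lf (linear_at0 lf) addr0. Qed.
Let lin_opp (f : A -> B) : linear f -> forall x, f (- x) = - f x.
Proof. by move=> lf x; rewrite -scaleN1r lin_scale // scaleN1r. Qed.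

Let one0 : oneform_set 0.
Proof. by exists [::]; rewrite big_nil. Qed.
Let oneP k u v : oneform_set u -> oneform_set v -> oneform_set (k *: u + v).
Proof.
move=> [s ->] [t ->]; exists ([seq (k *: p.1, p.2) | p <- s] ++ t).
rewrite big_cat big_map /= scaler_sumr; congr (_ + _); apply: eq_bigr => p _.
by rewrite (lin_scale rhoL) amulZl.
Qed.
Definition oneforms := Subspace one0 oneP.

Let two0 : twoform_set 0.
Proof. by exists [::]; rewrite big_nil. Qed.
Let twoP k u v : twoform_set u -> twoform_set v -> twoform_set (k *: u + v).
Proof.
move=> [s ->] [t ->]; exists ([seq (k *: p.1.1, p.1.2, p.2) | p <- s] ++ t).
rewrite big_cat big_map /= scaler_sumr; congr (_ + _); apply: eq_bigr => p _.
by rewrite (lin_scale rhoL) !amulZl.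
Qed.
Definition twoforms := Subspace two0 twoP.

Let junk0 : junk_set 0.
Proof. by exists [::]; rewrite !big_nil. Qed.
Let junkP k u v : junk_set u -> junk_set v -> junk_set (k *: u + v).
Proof.
move=> [s [es ->]] [t [et ->]]; exists ([seq (k *: p.1, p.2) | p <- s] ++ t).
rewrite !big_cat !big_map /=; split.
  rewrite et addr0; under eq_bigr => p _ do rewrite (lin_scale rhoL) amulZl.
  by rewrite -scaler_sumr es scaler0.
rewrite scaler_sumr; congr (_ + _); apply: eq_bigr => p _.
by rewrite (lin_scale dL) amulZl.
Qed.

Let one_l a w : oneform_set w -> oneform_set (rho a ** w).
Proof.
move=> [s ->]; exists [seq (a ** p.1, p.2) | p <- s].
by rewrite amul_sumr big_map; apply: eq_bigr => p _; rewrite rhoM amulA.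
Qed.

Let dr a b : d b ** rho a = d (b ** a) - rho b ** d a.
Proof. by rewrite dM addrK. Qed.

Let one_r a w : oneform_set w -> oneform_set (w ** rho a).
Proof.
move=> [s ->]; exists ([seq (p.1, p.2 ** a) | p <- s] ++
                       [seq (- (p.1 ** p.2), a) | p <- s]).
rewrite amul_suml big_cat !big_map /= -big_split; apply: eq_bigr => p _ /=.
by rewrite -amulA dr amulBr (lin_opp rhoL) rhoM amulNl amulA.
Qed.

Let two_l a w : twoform_set w -> twoform_set (rho a ** w).
Proof.
move=> [s ->]; exists [seq (a ** p.1.1, p.1.2, p.2) | p <- s].
by rewrite amul_sumr big_map; apply: eq_bigr => p _; rewrite rhoM !amulA.
Qed.

Let two_r a w : twoform_set w -> twoform_set (w ** rho a).
Proof.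
move=> [s ->]; exists ([seq (p.1.1, p.1.2, p.2 ** a) | p <- s] ++
  ([seq (- p.1.1, p.1.2 ** p.2, a) | p <- s] ++
   [seq (p.1.1 ** p.1.2, p.2, a) | p <- s])).
rewrite amul_suml !big_cat !big_map /= -!big_split; apply: eq_bigr => -[[x b] c] _ /=.
rewrite -amulA dr amulBr; congr (_ + _).
by rewrite rhoM (lin_opp rhoL) !amulNl dM amulDr amulDl opprD !amulA subrK.
Qed.

Lemma junk_sub_two : junk_set `<=` twoform_set.
Proof.
move=> _ [s [_ ->]]; exists [seq (aone A, p.1, p.2) | p <- s].
by rewrite big_map; apply: eq_bigr => p _; rewrite rho1 amul1.
Qed.

Let junk_l a w : junk_set w -> junk_set (rho a ** w).
Proof.
move=> [s [es ->]]; exists [seq (a ** p.1, p.2) | p <- s].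
rewrite !big_map /=; split.
  under eq_bigr => p _ do rewrite rhoM -amulA.
  by rewrite -amul_sumr es amulr0.
under [RHS]eq_bigr => p _ do rewrite dM amulDl -!amulA.
by rewrite big_split /= -!amul_sumr es amulr0 add0r.
Qed.

Let junk_r a w : junk_set w -> junk_set (w ** rho a).
Proof.
move=> [s [es ->]]; exists ([seq (p.1, p.2 ** a) | p <- s] ++
  [seq (- (p.1 ** p.2), a) | p <- s]).
rewrite !big_cat !big_map /= -!big_split /=; split.
  under eq_bigr => p _.
    rewrite dM amulDr (lin_opp rhoL) rhoM amulNl !amulA addrK; over.
  by rewrite -amul_suml es amul0.
rewrite amul_suml.
transitivity (\sum_(p <- s) (d p.1 ** d (p.2 ** a) - d (p.1 ** p.2) ** d a)
   + \sum_(p <- s) rho p.1 ** d p.2 ** d a); last first.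
  rewrite -[X in _ + X]amul_suml es amul0 addr0; apply: eq_bigr => p _.
  by rewrite (lin_opp dL) amulNl.
rewrite -big_split; apply: eq_bigr => p _ /=.
by rewrite -amulA dr amulBr (dM p.1 p.2) amulDl opprD !amulA addrA subrK.
Qed.

Section SubBimodule.
Variable U : subspace B.
Hypothesis Ul : forall a w, U w -> U (rho a ** w).
Hypothesis Ur : forall a w, U w -> U (w ** rho a).

Let sl (a : A) (x : subsp U) : subsp U := exist _ _ (Ul a (svalP x)).
Let sr (x : subsp U) (a : A) : subsp U := exist _ _ (Ur a (svalP x)).

Definition sub_bimodule : bimodule A.
Proof.
refine (@Bimodule K A (subsp U) sl sr _ _ _ _ _ _ _).
- split=> [x k a b|a k x y]; apply: subsp_inj => /=.
    by rewrite rhoL amulDl amulZl.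
  by rewrite amulDr amulZr.
- split=> [a k x y|x k a b]; apply: subsp_inj => /=.
    by rewrite amulDl amulZl.
  by rewrite rhoL amulDr amulZr.
- by move=> x; apply: subsp_inj; rewrite /= rho1 amul1.
- by move=> a b x; apply: subsp_inj; rewrite /= rhoM amulA.
- by move=> x; apply: subsp_inj; rewrite /= rho1 amulr1.
- by move=> a b x; apply: subsp_inj; rewrite /= rhoM amulA.
- by move=> a x b; apply: subsp_inj; rewrite /= amulA.
Defined.
End SubBimodule.

Definition oneform_bimodule : bimodule A :=
  @sub_bimodule oneforms one_l one_r.

Let twoform_bimodule : bimodule A :=
  @sub_bimodule twoforms two_l two_r.

Definition junk_in_two : set twoform_bimodule :=
  [set x : subsp twoforms | junk_set (sval x)].

Definition junk : subspace twoform_bimodule :=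
  @Subspace _ twoform_bimodule junk_in_two junk0 (fun k u v => @junkP k _ _).

Definition twoform_quot_bimodule : bimodule A :=
  @quot_bimodule K A twoform_bimodule junk
    (fun a x => @junk_l a _) (fun a x => @junk_r a _).

End Forms.

(* The inner product {dot _ for _} is linear on the left and
   conjugate-linear on the right. *)
Record hilbert (C : numClosedFieldType) := Hilbert {
  hcar :> lmodType C;
  ip : {dot hcar for Num.conj};
  hilbert_complete : forall u : nat -> hcar,
    (forall e : C, 0 < e -> exists N, forall m n, (N <= m)%N -> (N <= n)%N ->
       ip (u m - u n) (u m - u n) < e) ->
    exists l, forall e : C, 0 < e -> exists N, forall n, (N <= n)%N ->
       ip (u n - l) (u n - l) < e }.

Arguments ip {C} h.

Definition hdense (C : numClosedFieldType) (H : hilbert C) (S : set H) :=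
  forall (x : H) (e : C), 0 < e -> exists2 y, S y & ip H (x - y) (x - y) < e.

Section BoundedOperators.
Variable C : numClosedFieldType.
Implicit Types H : hilbert C.

Lemma ip_ge0 H (x : H) : 0 <= ip H x x.
Proof.
have [->|x0] := eqVneq x 0; first by rewrite linear0l.
exact/ltW/neq0_dnorm_gt0.
Qed.

Lemma ip_eq0 H (x : H) : ip H x x = 0 -> x = 0.
Proof.
by move=> h; apply/eqP; apply: contraTT isT => /(neq0_dnorm_gt0 (s := ip H)); rewrite h ltxx.
Qed.

Lemma ipZ H (k : C) (x : H) : ip H (k *: x) (k *: x) = `|k| ^+ 2 * ip H x x.
Proof. by rewrite linearZl_LR linearZr_LR /= mulrA normCK. Qed.

Lemma ip_add_le H (x y : H) : ip H (x + y) (x + y) <= 2 * ip H x x + 2 * ip H y y.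
Proof.
rewrite -subr_ge0.
have -> : 2 * ip H x x + 2 * ip H y y - ip H (x + y) (x + y) = ip H (x - y) (x - y).
  rewrite !(linearDl, linearDr, linearNl, linearNr) /=.
  set a := ip H x x; set b := ip H y y; set c := ip H x y; set d := ip H y x.
  ring.
exact: ip_ge0.
Qed.

Definition bounded_map (H1 H2 : hilbert C) (T : H1 -> H2) :=
  linear T /\
  exists2 M : C, 0 <= M & forall x, ip H2 (T x) (T x) <= M * ip H1 x x.

Section Maps.
Variables (H1 H2 H3 : hilbert C).

Lemma bounded0 : bounded_map (0 : H1 -> H2).
Proof.
split.
  move=> k x y; rewrite -[LHS]/(0 : H2) -[RHS]/(k *: 0 + 0 : H2).
  by rewrite scaler0 addr0.
by exists 0 => // x; rewrite mul0r -[X in ip H2 X _]/(0 : H2) linear0l.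
Qed.

Lemma boundedP (k : C) (S T : H1 -> H2) :
  bounded_map S -> bounded_map T -> bounded_map (k *: S + T).
Proof.
move=> [lS [M M0 hM]] [lT [N N0 hN]]; split.
  move=> l x y; rewrite !fctE lS lT !scalerDr !scalerA [k * l]mulrC.
  by rewrite addrACA.
exists (2 * (`|k| ^+ 2 * M) + 2 * N).
  by rewrite addr_ge0 // !mulr_ge0 // exprn_ge0.
move=> x; rewrite !fctE; apply: (le_trans (ip_add_le _ _)).
rewrite [leRHS]mulrDl; apply: lerD; rewrite -mulrA; apply: ler_wpM2l => //.
by rewrite ipZ -[leRHS]mulrA; apply: ler_wpM2l => //; rewrite exprn_ge0.
Qed.

Lemma bounded_comp (S : H2 -> H3) (T : H1 -> H2) :
  bounded_map S -> bounded_map T -> bounded_map (S \o T).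
Proof.
move=> [lS [M M0 hM]] [lT [N N0 hN]]; split; first exact: linear_compo.
exists (M * N); first exact: mulr_ge0.
by move=> x; apply: (le_trans (hM _)); rewrite -mulrA ler_wpM2l.
Qed.

End Maps.

Lemma bounded_id H : bounded_map (@idfun H).
Proof. by split=> //; exists 1 => // x; rewrite mul1r. Qed.

Definition bounded_ops H : subspace (H -> H) :=
  Subspace (@bounded0 H H) (@boundedP H H).

Definition bounded_mul H (S T : subsp (bounded_ops H)) :
  subsp (bounded_ops H) := exist _ _ (bounded_comp (svalP S) (svalP T)).

Definition bounded_one H : subsp (bounded_ops H) := exist _ _ (bounded_id H).

Lemma bounded_mul_bilin H : bilin (@bounded_mul H).
Proof.
split=> [T k S S'|S k T T']; apply: subsp_inj; apply/funext => x //=.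
by rewrite !fctE (svalP S).1.
Qed.

Definition BH H : algebra C.
Proof.
refine (@Algebra C (subsp (bounded_ops H)) (@bounded_mul H) (bounded_one H)
  (@bounded_mul_bilin H) _ _ _).
- by move=> x y z; apply: subsp_inj.
- by move=> x; apply: subsp_inj.
- by move=> x; apply: subsp_inj.
Defined.

Definition app H (T : BH H) : H -> H := sval (T : subsp (bounded_ops H)).

Lemma BH_ext H (S T : BH H) : (forall x, app S x = app T x) -> S = T.
Proof. by move=> h; apply: subsp_inj; apply/funext. Qed.

Lemma app_linear H (T : BH H) : linear (app T).
Proof. exact: (svalP (T : subsp (bounded_ops H))).1. Qed.

Lemma appB H (T : BH H) : {morph app T : x y / x - y}.
Proof.
by move=> x y; rewrite addrC -scaleN1r app_linear scaleN1r addrC.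
Qed.

Lemma BH_dense H (S T : BH H) (V : set H) : hdense V ->
  (forall x, V x -> app S x = app T x) -> S = T.
Proof.
move=> dV ST; apply/eqP; rewrite -subr_eq0; apply/eqP; apply: BH_ext => x.
have [lD [M M0 hM]] := svalP (S - T : subsp (bounded_ops H)).
apply: ip_eq0; apply/eqP; rewrite eq_le ip_ge0 andbT.
have M1 : 0 < M + 1 by rewrite ltr_wpDl.
apply/ler_addgt0Pl => e e0; rewrite addr0.
have [y Vy xy] := dV x (e / (M + 1)) (divr_gt0 e0 M1).
have -> : app (S - T) x = app (S - T) (x - y).
  rewrite appB (_ : app (S - T) y = 0) ?subr0 //.
  by rewrite /app /= !fctE; apply/eqP; rewrite subr_eq0; apply/eqP; exact: ST.
apply: (le_trans (hM _)).
apply: (@le_trans _ _ ((M + 1) * ip H (x - y) (x - y))).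
  by rewrite ler_wpM2r ?ip_ge0 // lerDl.
by rewrite mulrC -ler_pdivlMr // ltW.
Qed.

End BoundedOperators.

(* The part of a spectral triple (A, H, D) that the forms depend on: D is
   given on a dense A-invariant core dirac_dom (outside of which the values of
   dirac are irrelevant), and every [D, a] extends from there to a bounded
   operator, which is unique by density. *)
Record dirac_triple (C : numClosedFieldType) (A : algebra C) (H : hilbert C) :=
  DiracTriple {
  rep : A -> BH H;
  rep_linear : linear rep;
  rep1 : rep (aone A) = aone (BH H);
  repM : forall a b, rep (a ** b) = rep a ** rep b;
  dirac_dom : subspace H;
  dirac : H -> H;
  dirac_dense : hdense dirac_dom;
  dirac_linear : forall (k : C) (x y : H), dirac_dom x -> dirac_dom y ->
    dirac (k *: x + y) = k *: dirac x + dirac y;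
  rep_dom : forall a x, dirac_dom x -> dirac_dom (app (rep a) x);
  comm_bounded : forall a, exists T : BH H, forall x, dirac_dom x ->
    app T x = dirac (app (rep a) x) - app (rep a) (dirac x) }.

Section DiracForms.
Variables (C : numClosedFieldType) (A : algebra C) (H : hilbert C).
Variable T : dirac_triple A H.

(* The commutator [D, a] as an element of B(H). *)
Definition dcomm (a : A) : BH H :=
  xget 0 [set S : BH H | forall x, dirac_dom T x ->
    app S x = dirac T (app (rep T a) x) - app (rep T a) (dirac T x)].

Lemma dcommP a x : dirac_dom T x ->
  app (dcomm a) x = dirac T (app (rep T a) x) - app (rep T a) (dirac T x).
Proof. by move: x; exact: (xgetPex 0 (comm_bounded T a)). Qed.

Lemma dcomm_linear : linear dcomm.
Proof.
move=> k a b; apply: (BH_dense (dirac_dense T)) => x dx.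
rewrite dcommP // (rep_linear T).
have appD (r s : BH H) y : app (k *: r + s) y = k *: app r y + app s y by [].
rewrite !appD !dcommP // dirac_linear; try exact: rep_dom.
by rewrite scalerBr opprD addrACA.
Qed.

Lemma dcommM a b :
  dcomm (a ** b) = dcomm a ** rep T b + rep T a ** dcomm b.
Proof.
apply: (BH_dense (dirac_dense T)) => x dx.
have appM (r s : BH H) y : app (r ** s) y = app r (app s y) by [].
have appD (r s : BH H) y : app (r + s) y = app r y + app s y by [].
rewrite appD !appM !dcommP //; last exact: rep_dom.
by rewrite repM !appM appB addrA subrK.
Qed.

Definition Omega1 : bimodule A :=
  oneform_bimodule (rep_linear T) (rep1 T) (repM T) dcommM.

Definition Omega2 : bimodule A :=
  twoform_quot_bimodule (rep_linear T) (rep1 T) (repM T) dcomm_linear dcommM.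

End DiracForms.

Section Amplification.
Variables (C : numClosedFieldType) (H : hilbert C) (n : nat).

Definition amp_ip (x y : 'I_n -> H) : C := \sum_(i < n) ip H (x i) (y i).

Lemma amp_ip_bilinear : bilinear_for *%R (Num.conj \; *%R) amp_ip.
Proof.
split=> [y k x x'|x k y y']; rewrite /amp_ip /= mulr_sumr -big_split;
  apply: eq_bigr => i _ /=.
  by rewrite !fctE linearPl.
by rewrite !fctE linearPr.
Qed.
HB.instance Definition _ := bilinear_isBilinear.Build C ('I_n -> H) ('I_n -> H)
  C _ _ amp_ip amp_ip_bilinear.

Lemma amp_ip_hermitian x y :
  amp_ip x y = (-1) ^+ false * Num.conj (amp_ip y x).
Proof.
rewrite expr0 mul1r /amp_ip rmorph_sum; apply: eq_bigr => i _.
by rewrite [LHS]hermC expr0 mul1r.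
Qed.
HB.instance Definition _ := isHermitianSesquilinear.Build C ('I_n -> H)
  false Num.conj amp_ip amp_ip_hermitian.

Lemma amp_ip_pos x : x != 0 -> 0 < amp_ip x x.
Proof.
move=> x0; have [i xi] : exists i, x i != 0.
  apply: contrapT => h; case/eqP: x0; apply/funext => i.
  by apply/eqP; apply: contrapT => /negP xi; apply: h; exists i.
rewrite /amp_ip (bigD1 i) //= ltr_pwDl ?neq0_dnorm_gt0 //.
by apply: sumr_ge0 => j _; exact: ip_ge0.
Qed.
HB.instance Definition _ := isDotProduct.Build C ('I_n -> H) amp_ip amp_ip_pos.

Lemma amp_complete (u : nat -> 'I_n -> H) :
  (forall e : C, 0 < e -> exists N, forall m p, (N <= m)%N -> (N <= p)%N ->
     amp_ip (u m - u p) (u m - u p) < e) ->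
  exists l, forall e : C, 0 < e -> exists N, forall p, (N <= p)%N ->
     amp_ip (u p - l) (u p - l) < e.
Proof.
move=> hu.
have /choice [l hl] : forall i, exists l : H, forall e : C, 0 < e ->
    exists N, forall p, (N <= p)%N -> ip H (u p i - l) (u p i - l) < e.
  move=> i; apply: hilbert_complete => e e0; have [N hN] := hu e e0.
  exists N => m p Nm Np; apply: le_lt_trans (hN m p Nm Np).
  rewrite /amp_ip (bigD1 i) //= lerDl.
  by apply: sumr_ge0 => j _; exact: ip_ge0.
exists l => e e0.
have e1 : 0 < e / n.+1%:R by rewrite divr_gt0 // ltr0n.
have /choice [N hN] := fun i => hl i _ e1.
exists (\max_(i < n) N i)%N => p Np.
apply: (@le_lt_trans _ _ (\sum_(i < n) e / n.+1%:R)).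
  apply: ler_sum => i _; apply/ltW/hN; apply: leq_trans Np.
  exact: leq_bigmax.
rewrite sumr_const card_ord -[ltLHS]mulr_natr -mulrA gtr_pMr // mulrC.
by rewrite ltr_pdivrMr ?ltr0n // mul1r ltr_nat.
Qed.

(* H tensor C^n, identified with H^n *)
Definition amp : hilbert C := @Hilbert C ('I_n -> H) amp_ip amp_complete.

(* f tensor M: (x_k)_k |-> (sum_l M_kl f(x_l))_k *)
Definition amp_map (M : 'M[C]_n) (f : H -> H) : amp -> amp :=
  fun x k => \sum_(l < n) M k l *: f (x l).

Lemma amp_coord_bounded (i : 'I_n) : bounded_map (fun x : amp => x i).
Proof.
split=> //; exists 1 => // x; rewrite mul1r.
rewrite [leRHS]/(amp_ip x x) /amp_ip (bigD1 i) //= lerDl.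
by apply: sumr_ge0 => j _; exact: ip_ge0.
Qed.

Lemma amp_tuple_bounded (H' : hilbert C) (f : 'I_n -> H' -> H) :
  (forall i, bounded_map (f i)) -> bounded_map (fun x => (f^~ x) : amp).
Proof.
move=> bf; split.
  by move=> k x y; apply/funext => i; rewrite !fctE (bf i).1.
have /choice [M hM] : forall i, exists M : C, 0 <= M /\
    forall x, ip H (f i x) (f i x) <= M * ip H' x x.
  by move=> i; have [_ [M M0 hM]] := bf i; exists M.
exists (\sum_(i < n) M i); first by apply: sumr_ge0 => i _; exact: (hM i).1.
move=> x; rewrite [leLHS]/(amp_ip _ _) mulr_suml; apply: ler_sum => i _.
exact: (hM i).2.
Qed.

Lemma amp_map_bounded (M : 'M[C]_n) (f : H -> H) :
  bounded_map f -> bounded_map (amp_map M f).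
Proof.
move=> bf; apply: amp_tuple_bounded => k.
rewrite (_ : (fun x : amp => _) =
  \sum_(l < n) (M k l *: ((f \o (fun x : amp => x l)) : amp -> H) )); last first.
  by apply/funext => x; rewrite fct_sumE.
apply: (big_ind (fun g : amp -> H => bounded_map g)).
- exact: bounded0.
- by move=> g h bg bh; rewrite -[g]scale1r; apply: boundedP.
move=> l _; rewrite -[_ *: _]addr0; apply: boundedP; last exact: bounded0.
exact: bounded_comp bf (amp_coord_bounded l).
Qed.

Definition amp_op (M : 'M[C]_n) (S : BH H) : BH amp :=
  exist _ _ (amp_map_bounded M (svalP (S : subsp (bounded_ops H)))).

End Amplification.

Section Even.
Variables (C : numClosedFieldType) (A : algebra C) (H : hilbert C).
Variables (T : dirac_triple A H) (s : 'M[C]_2).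

Let H2 := amp H 2.
Let erep (a : A) : BH H2 := amp_op 1%:M (rep T a).

Let erepE a (x : H2) : app (erep a) x = (fun k => app (rep T a) (x k)) :> H2.
Proof.
apply/funext => k; rewrite /app /= /amp_map (bigD1 k) //= mxE eqxx scale1r.
by rewrite big1 ?addr0 // => l lk; rewrite mxE eq_sym (negbTE lk) scale0r.
Qed.

Let edom_set : set H2 := [set x | forall k, dirac_dom T (x k)].
Let edom0 : edom_set 0.
Proof. by move=> k; apply: subspace0. Qed.
Let edomP k u v : edom_set u -> edom_set v -> edom_set (k *: u + v).
Proof. by move=> hu hv i; apply: subspaceP. Qed.
Let edom : subspace H2 := Subspace edom0 edomP.

Let edense : hdense edom.
Proof.
move=> x e e0; have e2 : 0 < e / 2 by rewrite divr_gt0.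
have /choice [y hy] : forall i, exists y, dirac_dom T y /\
    ip H (x i - y) (x i - y) < e / 2.
  by move=> i; have [y ? ?] := dirac_dense T (x i) e2; exists y.
exists y; first by move=> i; exact: (hy i).1.
rewrite [ltLHS]/(amp_ip _ _) /amp_ip big_ord_recl big_ord1 [ltRHS]splitr.
by apply: ltrD; apply: (hy _).2.
Qed.

(* (A, H tensor C^2, D tensor s) *)
Definition even_triple : dirac_triple A (amp H 2).
Proof.
refine (@DiracTriple C A (amp H 2) erep _ _ _ edom (amp_map s (dirac T))
  edense _ _ _).
- move=> k a b; apply: BH_ext => x; rewrite erepE (rep_linear T).
  have appD (r t : BH H2) y : app (k *: r + t) y = k *: app r y + app t y by [].
  by rewrite appD !erepE.
- by apply: BH_ext => x; rewrite erepE rep1.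
- move=> a b; apply: BH_ext => x; rewrite erepE repM.
  have appM (r t : BH H2) y : app (r ** t) y = app r (app t y) by [].
  by rewrite appM !erepE.
- move=> k x y dx dy; apply/funext => i; rewrite !fctE /amp_map.
  rewrite scaler_sumr -big_split; apply: eq_bigr => l _ /=.
  by rewrite [X in dirac T X]/(k *: x l + y l) dirac_linear // scalerDr !scalerA [k * _]mulrC.
- by move=> a x dx k; rewrite erepE; apply: rep_dom.
- move=> a; exists (amp_op s (dcomm T a)) => x dx; rewrite !erepE.
  apply/funext => k; rewrite !fctE /app /= /amp_map.
  rewrite -[sval _ (\sum_(l < 2) _)]/(app (rep T a) _).
  have l0 := linear_at0 (app_linear (rep T a)).
  have lD : {morph app (rep T a) : u v / u + v}.
    by move=> u v; have := app_linear (rep T a) 1 u v; rewrite !scale1r.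
  rewrite (big_morph _ lD l0) -sumrB; apply: eq_bigr => l _.
  rewrite -[sval _ (x l)]/(app (dcomm T a) (x l)) dcommP //.
  by rewrite -[s k l *: dirac T (x l)]addr0 app_linear l0 addr0 scalerBr.
Defined.

End Even.

(* The completed tensor product, which is determined up to unitary
   equivalence by the inner products of pure tensors and their totality. *)
Record hilbert_tensor (C : numClosedFieldType) (H1 H2 : hilbert C) :=
  HilbertTensor {
  hten :> hilbert C;
  hpure : H1 -> H2 -> hten;
  hpure_bilin : bilin hpure;
  hpure_ip : forall x y x' y', ip hten (hpure x y) (hpure x' y') =
    ip H1 x x' * ip H2 y y';
  hpure_total : hdense (linspan [set z | exists x y, z = hpure x y]) }.

(* P is (A (x) B, H1 (x) H2, D1 (x) 1 + g (x) D2). *)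
Definition is_product_triple (C : numClosedFieldType) (A B : algebra C)
    (H1 H2 : hilbert C) (T1 : dirac_triple A H1) (g : H1 -> H1)
    (T2 : dirac_triple B H2) (H12 : hilbert_tensor H1 H2)
    (P : dirac_triple (tensor_algebra A B) H12) : Prop :=
  [/\ forall a b x y, app (rep P (tens a b)) (hpure H12 x y)
        = hpure H12 (app (rep T1 a) x) (app (rep T2 b) y),
      (dirac_dom P : set H12) = linspan [set z | exists x y,
        [/\ dirac_dom T1 x, dirac_dom T2 y & z = hpure H12 x y]] &
      forall x y, dirac_dom T1 x -> dirac_dom T2 y ->
        dirac P (hpure H12 x y)
        = hpure H12 (dirac T1 x) y + hpure H12 (g x) (dirac T2 y)].

Section QuantumHeisenberg.
Variable R : realType.
Local Notation C := (R[i]).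
Local Open Scope complex_scope.

(* Functions on R x T x Z are functions on R x R x Z of period 1 in y. *)
Definition qfunction := R -> R -> int -> C.

Definition expi (x : R) : C := (cos (2 * pi * x)) +i* (sin (2 * pi * x)).

Definition dX (f : qfunction) : qfunction := fun x y p =>
  derive1 (fun t => complex.Re (f t y p)) x +i* derive1 (fun t => complex.Im (f t y p)) x.

Definition dY (f : qfunction) : qfunction := fun x y p =>
  derive1 (fun t => complex.Re (f x t p)) y +i* derive1 (fun t => complex.Im (f x t p)) y.

Definition smooth_fun (f : qfunction) := forall w : seq bool,
  let g := foldr (fun b : bool => if b then dX else dY) f w in
  forall x y p,
    [/\ derivable (fun t => complex.Re (g t y p)) x 1,
        derivable (fun t => complex.Im (g t y p)) x 1,
        derivable (fun t => complex.Re (g x t p)) y 1 &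
        derivable (fun t => complex.Im (g x t p)) y 1] /\
    ({for (x, y), continuous (fun z : R * R => complex.Re (g z.1 z.2 p))} /\
     {for (x, y), continuous (fun z : R * R => complex.Im (g z.1 z.2 p))}).

(* By periodicity in y, boundedness over the compact subsets of
   R x T is boundedness over those of R x R. *)
Definition Sc (c : nat) : set qfunction := [set f |
  [/\ forall x y p, f x (y + 1) p = f x y p,
      smooth_fun f,
      forall (k : int) x y p,
        f (x + k%:~R) y p = expi (c%:R * k%:~R * p%:~R * y) * f x y p &
      forall (P : {poly C}) (m n : nat) (K : set (R * R)), compact K ->
        exists M : R, forall z p, K z ->
          `|P.[p%:~R] * iter m dX (iter n dY f) z.1 z.2 p| <= M%:C]].

(* The sum over Z, as the limit of the sums over [-n, n]. *)
Definition sumZ (a : int -> C) : C :=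
  limn (fun n : nat => \sum_(0 <= j < n.*2.+1) complex.Re (a (j%:Z - n%:Z))) +i*
  limn (fun n : nat => \sum_(0 <= j < n.*2.+1) complex.Im (a (j%:Z - n%:Z))).

Definition qstar (hbar mu nu : R) (f g : qfunction) : qfunction := fun x y p =>
  sumZ (fun q =>
    f (x - hbar * (q - p)%:~R * mu) (y - hbar * (q - p)%:~R * nu) q *
    g (x - hbar * q%:~R * mu) (y - hbar * q%:~R * nu) (p - q)).

Definition qadj (f : qfunction) : qfunction :=
  fun x y p => Num.conj (f x y (- p)).

Definition qtau (f : qfunction) : C :=
  (\int[lebesgue_measure]_(x in `[0, 1])
     \int[lebesgue_measure]_(y in `[0, 1]) complex.Re (f x y 0)) +i*
  (\int[lebesgue_measure]_(x in `[0, 1])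
     \int[lebesgue_measure]_(y in `[0, 1]) complex.Im (f x y 0)).

Definition qdelta (c : nat) (alpha : R) (j : 'I_3) (f : qfunction) :
    qfunction := fun x y p =>
  match val j with
  | 0 => - dX f x y p
  | 1 => 2 * pi%:C * 'i * c%:R * p%:~R * x%:C * f x y p - dY f x y p
  | _ => 2 * pi%:C * 'i * p%:~R * c%:R * alpha%:C * f x y p
  end.

Definition mx2 (a b c d : C) : 'M[C]_2 := \matrix_(k, l)
  if k == 0 then (if l == 0 then a else b) else (if l == 0 then c else d).

Definition sigma (j : 'I_3) : 'M[C]_2 :=
  match val j with
  | 0 => mx2 1 0 0 (-1)
  | 1 => mx2 0 (-1) (-1) 0
  | _ => mx2 0 'i (- 'i) 0
  end.

End QuantumHeisenberg.

(* The *-algebra S^c with the product qstar and the involution qadj, presented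
   through a bijection qfun onto S^c. *)
Record qhm_algebra (R : realType) (c : nat) (hbar mu nu : R) := QhmAlgebra {
  qalg :> algebra (R[i] : fieldType);
  qfun : qalg -> qfunction R;
  qfun_linear : linear qfun;
  qfun_inj : injective qfun;
  qfun_range : range qfun = Sc c;
  qfunM : forall a b, qfun (a ** b) = qstar hbar mu nu (qfun a) (qfun b);
  qconj : qalg -> qalg;
  qfun_conj : forall a, qfun (qconj a) = qadj (qfun a) }.

Definition qtrace (R : realType) (c : nat) (hbar mu nu : R)
  (A : qhm_algebra c hbar mu nu) (a : A) : R[i] := qtau (qfun a).

(* The GNS representation of a positive functional tau on the *-algebra
   (A, star): gns_vec a is the class of a, and <gns_vec a, gns_vec b> is
   tau (b^* a) for an inner product that is linear on the left. *)
Record gns (C : numClosedFieldType) (A : algebra C) (star : A -> A)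
    (tau : A -> C) := Gns {
  gns_space :> hilbert C;
  gns_vec : A -> gns_space;
  gns_linear : linear gns_vec;
  gns_ip : forall a b,
    ip gns_space (gns_vec a) (gns_vec b) = tau (star b ** a);
  gns_dense : hdense (range gns_vec);
  gns_rep : A -> BH gns_space;
  gns_repE : forall a b, app (gns_rep a) (gns_vec b) = gns_vec (a ** b) }.

Section QhmTriple.
Variables (R : realType) (c : nat) (hbar mu nu alpha : R).
Variable A : qhm_algebra c hbar mu nu.

Definition qder (j : 'I_3) (a : A) : A :=
  xget 0 [set b : A | qfun b = qdelta c alpha j (qfun a)].

Variable L : gns (@qconj R c hbar mu nu A) (@qtrace R c hbar mu nu A).

(* T is (A, L^2(A, tau) (x) C^2, sum_j i delta_j (x) sigma_j). *)
Definition is_qhm_triple (T : dirac_triple A (amp L 2)) : Prop :=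
  [/\ forall a (x : amp L 2) k,
        app (rep T a) x k = app (gns_rep L a) (x k),
      (dirac_dom T : set (amp L 2))
        = [set x | exists v : 'I_2 -> A, x = (fun k => gns_vec L (v k))] &
      forall v : 'I_2 -> A,
        dirac T (fun k => gns_vec L (v k)) = (fun k =>
          \sum_(j < 3) \sum_(l < 2)
            ('i%C * sigma R j k l) *: gns_vec L (qder j (v l)))].

End QhmTriple.

Definition rat_independent3 (R : realType) (u v w : R) := forall q r s : rat,
  ratr q * u + ratr r * v + ratr s * w = 0 -> [/\ q = 0, r = 0 & s = 0].

(* Main.v *)
Require Import Defs.
From HB Require Import structures.
From mathcomp Require Import all_boot all_order all_algebra.
From mathcomp Require Import complex ring lra zify.
From mathcomp Require Import all_classical all_reals all_analysis.

Set Implicit Arguments.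
Unset Strict Implicit.
Unset Printing Implicit Defensive.

Import Defs Order.TTheory GRing.Theory Num.Theory numFieldNormedType.Exports.
Local Open Scope classical_set_scope.
Local Open Scope ring_scope.

(** The isomorphism holds for the product of any two triples, over A1 and A2, and for
    any involution g of the first Hilbert space that commutes with A1 and
    anticommutes with the commutators of A1 with the Dirac operator, as soon as both
    representations are faithful and the identity operator is junk, that is, lies in
    pi(dJ_0^1), for both triples.

    Write d1 and d2 for the commutators with the two Dirac operators, J1 and J2 for
    the junk, D1 = d1 (x) id and D2 = id (x) d2 on A1 (x) A2, and G = g (x) 1. The
    commutator with the Dirac operator of the product is d(x) = D1 x + G D2 x. As G
    anticommutes with the values of D1 and commutes with those of D2, a product
    x d(y) d(z) is equal to
      x D1y D1z + x D2y D2z + G (x D2y D1z - x D1y D2z),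
    so that the second order forms of the product are the sum of pi(Omega^2) (x) A2,
    of A1 (x) pi(Omega^2) and of G (Omega^1 (x) Omega^1), the last of which is told
    from the others by its parity with respect to G.
      The junk has no mixed part. Indeed, when sum x d(y) vanishes, so do
    sum x D1y and sum x D2y, by parity. Applying id (x) d2 to the first sum and
    d1 (x) id to the second one makes the same term sum x (d1 (x) d2) y appear, so
    that sum (D2x D1y - D1x D2y) is zero ([mixedl], [mixedr]). The exactness of
    the tensor product over a field shows that the other two parts of the junk lie
    in J1 (x) A2 and A1 (x) J2 ([junkl], [junkr]), and these are attained. Finally,
    pi(Omega^2) (x) A2 and A1 (x) pi(Omega^2) overlap, but the overlap is junk:
    since the identity is junk, A1 lies in J1 and A2 lies in J2, so that passing to
    the quotient by J1 in the first factor kills everything but Omega^2 (x) A2, and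
    likewise for the second factor ([product_forms_iso]).

    Bounded operators on the completed tensor product are compared with elements
    of the algebraic tensor product of the operator algebras through their values
    on elementary vectors; the algebraic tensor product acts faithfully on these
    ([tens_app_eq0]), and the formula for the commutators extends by density from
    the core of the Dirac operator to all elementary vectors ([dcomm_tens]).

    For the quantum Heisenberg manifold, the representation is faithful because
    the trace of w^* a, for w the component of a in degree p, is the integral of
    |a(x, y, p)|^2 over a translate of the unit square ([gns_vec_eq0]). The identity
    is junk because the function e(y), placed in degree 0, is a unit u with
    [D, u] = 2 pi u (x) sigma_2: then u [D, u^-1] + u^-1 [D, u] vanishes, while
    [D, u] [D, u^-1] + [D, u^-1] [D, u] is the scalar - 8 pi^2
    ([junk_one_of_unit]). *)

(** * Linear maps, subspaces and separating functionals *)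

Section LinearMaps.
Variables (K : fieldType) (V W : lmodType K) (f : V -> W).
Hypothesis lf : linear f.

Lemma linfunD : {morph f : u v / u + v}.
Proof. by move=> u v; have := lf 1 u v; rewrite !scale1r. Qed.

Lemma linfunZ k : {morph f : u / k *: u}.
Proof. by move=> u; rewrite -[k *: u]addr0 lf (linear_at0 lf) addr0. Qed.

Lemma linfunN : {morph f : u / - u}.
Proof. by move=> u; rewrite -scaleN1r linfunZ scaleN1r. Qed.

Lemma linfunB : {morph f : u v / u - v}.
Proof. by move=> u v; rewrite linfunD linfunN. Qed.

Lemma linfun_sum (I : Type) (r : seq I) (P : pred I) (F : I -> V) :
  f (\sum_(i <- r | P i) F i) = \sum_(i <- r | P i) f (F i).
Proof. exact: (big_morph f linfunD (linear_at0 lf)). Qed.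

Lemma linfun_inj : (forall v, f v = 0 -> v = 0) -> injective f.
Proof.
move=> f0 u v uv; apply/eqP; rewrite -subr_eq0; apply/eqP/f0.
by rewrite linfunB uv subrr.
Qed.

Lemma preim_subspaceP (U : subspace W) k u v :
  U (f u) -> U (f v) -> U (f (k *: u + v)).
Proof. by rewrite lf; exact: subspaceP. Qed.

Lemma preim_subspace0 (U : subspace W) : U (f 0).
Proof. by rewrite (linear_at0 lf); exact: subspace0. Qed.

Definition preim_subspace (U : subspace W) : subspace V :=
  @Subspace K V (fun v => U (f v)) (preim_subspace0 U)
    (@preim_subspaceP U).

Definition image_subspace : subspace W.
Proof.
refine (@Subspace K W (range f) _ _).
  by exists 0 => //; exact: linear_at0.
by move=> k _ _ [u _ <-] [v _ <-]; exists (k *: u + v); rewrite ?lf.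
Defined.

End LinearMaps.

Definition zero_subspace (K : fieldType) (V : lmodType K) : subspace V.
Proof.
refine (@Subspace K V (fun v => v = 0) _ _) => // k u v -> ->.
by rewrite scaler0 addr0.
Defined.

Lemma subspace_sum (K : fieldType) (V : lmodType K) (U : subspace V)
    (I : Type) (r : seq I) (F : I -> V) :
  (forall i, U (F i)) -> U (\sum_(i <- r) F i).
Proof.
move=> UF; apply: (big_ind (fun v => U v)) => // [|u v].
  exact: subspace0.
exact: subspaceD.
Qed.

Section Separation.
Variables (K : fieldType) (V : lmodType K).

(** A subspace that is maximal among those that contain [U] but not [v] is a
    hyperplane, and [f] is the coordinate along [v]. *)
Lemma separating_functional (U : subspace V) (v : V) : ~ U v ->
  exists f : V -> K^o, [/\ linear f, forall u, U u -> f u = 0 & f v = 1].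
Proof.
move=> Uv.
(* Asking for [U `|` X] to be a subspace, instead of [X], admits the union of the
   empty chain. *)
pose P (X : set V) := (forall k x y, (U `|` X) x -> (U `|` X) y ->
  (U `|` X) (k *: x + y)) /\ ~ (U `|` X) v.
have [X [[XP Xv] Xmax]] : exists X, P X /\ forall Y, X `<` Y -> ~ P Y.
  apply: Zorn_bigcup => F FP Ftot; split.
    move=> k x y [Ux|[X FX Xx]] [Uy|[Y FY Yy]].
    - by left; apply: subspaceP.
    - have [h|h] := (FP _ FY).1 k x y (or_introl Ux) (or_intror Yy).
        by left.
      by right; exists Y.
    - have [h|h] := (FP _ FX).1 k x y (or_intror Xx) (or_introl Uy).
        by left.
      by right; exists X.
    have [XY|YX] := Ftot _ _ FX FY.
      have [h|h] := (FP _ FY).1 k x y (or_intror (XY _ Xx)) (or_intror Yy).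
        by left.
      by right; exists Y.
    have [h|h] := (FP _ FX).1 k x y (or_intror Xx) (or_intror (YX _ Yy)).
      by left.
    by right; exists X.
  move=> [//|[Y FY Yv]]; case: (FP _ FY) => _; apply; by right.
pose M : subspace V := Subspace (or_introl (subspace0 U)) XP.
have Mv : ~ M v := Xv.
have ex w : exists k : K, M (w - k *: v).
  have [Mw|Mw] := pselect (M w); first by exists 0; rewrite scale0r subr0.
  pose Y : set V := [set x | exists k : K, M (x - k *: w)].
  have UY : U `<=` Y by move=> x Ux; exists 0; rewrite scale0r subr0; left.
  have XY : X `<` Y.
    split; last by move=> /(_ w) h; apply: Mw; right; apply: h;
      exists 1; rewrite scale1r subrr; exact: subspace0.
    by move=> x Xx; exists 0; rewrite scale0r subr0; right.
  have YP k x y : (U `|` Y) x -> (U `|` Y) y -> (U `|` Y) (k *: x + y).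
    rewrite (setUidr UY) => -[a ha] [b hb]; exists (k * a + b).
    have -> : k *: x + y - (k * a + b) *: w
        = k *: (x - a *: w) + (y - b *: w).
      by rewrite scalerDl scalerBr scalerA opprD addrACA.
    exact: subspaceP.
  have : (U `|` Y) v by apply: contrapT => Yv; exact: (Xmax Y XY (conj YP Yv)).
  rewrite (setUidr UY) => -[k hk].
  have k0 : k != 0 by apply/eqP => k0; apply: Mv; move: hk; rewrite k0 scale0r subr0.
  exists k^-1; rewrite -[w in w - _]scale1r -(mulVf k0) -scalerA -scalerBr.
  by rewrite -opprB; apply: subspaceZ; apply: subspaceN.
have uniqk w k l : M (w - k *: v) -> M (w - l *: v) -> k = l.
  move=> hk hl; apply/eqP; apply: contrapT => /negP kl; apply: Mv.
  have lk : l - k != 0 by rewrite subr_eq0 eq_sym.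
  rewrite -[v]scale1r -(mulVf lk) -scalerA; apply: subspaceZ.
  have := subspaceB hk hl.
  by rewrite opprB addrC addrA subrK scalerBl.
pose f w : K^o := xget 0 [set k : K | M (w - k *: v)].
have fP w : M (w - f w *: v) by exact: (xgetPex 0 (ex w)).
exists f; split.
- move=> k x y; apply: (uniqk (k *: x + y)) => //.
  have -> : k *: x + y - (k *: f x + f y) *: v
      = k *: (x - f x *: v) + (y - f y *: v).
    by rewrite scalerDl scalerBr !scalerA opprD addrACA.
  exact: subspaceP.
- by move=> u Uu; apply: (uniqk u) => //; rewrite scale0r subr0; left.
- by apply: (uniqk v) => //; rewrite scale1r subrr; exact: subspace0.
Qed.

End Separation.

(** * Tensor products over a field *)

Definition free_family (K : fieldType) (V : lmodType K) (n : nat)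
    (v : 'I_n -> V) :=
  forall c : 'I_n -> K, \sum_i c i *: v i = 0 -> forall i, c i = 0.

Section Tensors.
Variables (K : fieldType).
Implicit Types V W : lmodType K.

Lemma tensDl V W (v v' : V) (w : W) :
  tens (v + v') w = tens v w + tens v' w.
Proof. exact: (linfunD ((tens_bilin V W).1 w)). Qed.
Lemma tensDr V W (v : V) (w w' : W) :
  tens v (w + w') = tens v w + tens v w'.
Proof. exact: (linfunD ((tens_bilin V W).2 v)). Qed.
Lemma tensZl V W k (v : V) (w : W) : tens (k *: v) w = k *: tens v w.
Proof. exact: (linfunZ ((tens_bilin V W).1 w)). Qed.
Lemma tensZr V W k (v : V) (w : W) : tens v (k *: w) = k *: tens v w.
Proof. exact: (linfunZ ((tens_bilin V W).2 v)). Qed.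
Lemma tens0l V W (w : W) : tens (0 : V) w = 0.
Proof. exact: (linear_at0 ((tens_bilin V W).1 w)). Qed.
Lemma tens0r V W (v : V) : tens v (0 : W) = 0.
Proof. exact: (linear_at0 ((tens_bilin V W).2 v)). Qed.
Lemma tens_suml V W (I : Type) (r : seq I) (P : pred I) (F : I -> V) (w : W) :
  tens (\sum_(i <- r | P i) F i) w = \sum_(i <- r | P i) tens (F i) w.
Proof. exact: (linfun_sum ((tens_bilin V W).1 w)). Qed.
Lemma tens_sumr V W (I : Type) (r : seq I) (P : pred I) (F : I -> W) (v : V) :
  tens v (\sum_(i <- r | P i) F i) = \sum_(i <- r | P i) tens v (F i).
Proof. exact: (linfun_sum ((tens_bilin V W).2 v)). Qed.

Lemma tensor_ind V W (U : subspace (tensor V W)) :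
  (forall v w, U (tens v w)) -> forall t, U t.
Proof.
move=> h t; apply: (linspan_min _ (tens_spanned t)).
by move=> _ [v [w ->]]; exact: h.
Qed.

Lemma tensor_ord V W (t : tensor V W) :
  exists n (v : 'I_n -> V) (w : 'I_n -> W), t = \sum_i tens (v i) (w i).
Proof.
have [s [hs ->]] := tens_spanned t.
have /choice [g hg] : forall i : 'I_(size s), exists p : V * W,
    (tnth (in_tuple s) i).2 = tens p.1 p.2.
  move=> i; have [v [w e]] := hs _ (mem_tnth i (in_tuple s)).
  by exists (v, w).
exists (size s), (fun i => (tnth (in_tuple s) i).1 *: (g i).1),
  (fun i => (g i).2).
rewrite (big_tnth _ _ s); apply: eq_bigr => i _.
by rewrite tensZl -hg.
Qed.

Lemma tensor_seq V W (t : tensor V W) :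
  exists s : seq (V * W), t = \sum_(p <- s) tens p.1 p.2.
Proof.
have [n [v [w ->]]] := tensor_ord t.
exists [seq (v i, w i) | i <- enum 'I_n].
by rewrite big_map big_enum.
Qed.

(** A linear relation among the right-hand factors expresses one of them by the
    others, which shortens the sum. *)
Lemma tensor_free V W (t : tensor V W) :
  exists n (v : 'I_n -> V) (w : 'I_n -> W),
    free_family w /\ t = \sum_i tens (v i) (w i).
Proof.
have [n [v [w ->]]] := tensor_ord t.
elim: n v w => [|n IH] v w.
  by exists 0%N, v, w; split=> // c _ [].
have [fw|] := pselect (free_family w); first by exists n.+1, v, w.
move=> /existsNP[a /not_implyP[a0 /existsNP[i /eqP ai]]].
have wi : w i = \sum_(l < n) (- (a i)^-1 * a (lift i l)) *: w (lift i l).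
  move: a0; rewrite (bigD1_ord i) //= => /eqP; rewrite addr_eq0 => /eqP e.
  rewrite -[w i]scale1r -(mulVf ai) -scalerA e -sumrN scaler_sumr.
  by apply: eq_bigr => l _; rewrite scalerN scalerA mulNr scaleNr.
have [m [v' [w' [fw' e]]]] := IH
  (fun l => v (lift i l) + (- (a i)^-1 * a (lift i l)) *: v i)
  (fun l => w (lift i l)).
exists m, v', w'; split=> //; rewrite -e (bigD1_ord i) //=.
rewrite {1}wi tens_sumr -big_split; apply: eq_bigr => l _ /=.
by rewrite tensDl addrC tensZl tensZr.
Qed.

(** Slicing by a functional that is 1 on [w i] and 0 on the other members of the
    family isolates [v i]. *)
Lemma tens_free_eq0 V W n (v : 'I_n -> V) (w : 'I_n -> W) :
  free_family w -> \sum_i tens (v i) (w i) = 0 -> forall i, v i = 0.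
Proof.
move=> fw e i.
pose L (a : 'I_n -> K) := \sum_l a l *: w l.
have U0 : exists2 a : 'I_n -> K, a i = 0 & 0 = L a.
  by exists (fun=> 0) => //; rewrite /L big1 // => l _; rewrite scale0r.
have UP k x y : (exists2 a : 'I_n -> K, a i = 0 & x = L a) ->
    (exists2 a : 'I_n -> K, a i = 0 & y = L a) ->
    exists2 a : 'I_n -> K, a i = 0 & k *: x + y = L a.
  move=> [a ai ->] [b bi ->]; exists (fun l => k * a l + b l).
    by rewrite ai bi mulr0 addr0.
  rewrite /L scaler_sumr -big_split; apply: eq_bigr => l _ /=.
  by rewrite scalerDl scalerA.
have Uwi : ~ Subspace U0 UP (w i).
  move=> [a ai wi].
  have h : \sum_l ((l == i)%:R - a l) *: w l = 0.
    under eq_bigr do rewrite scalerBl.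
    rewrite sumrB -[X in _ - X]wi (bigD1 i) //= eqxx scale1r big1 ?addr0 ?subrr //.
    by move=> l /negbTE ->; rewrite scale0r.
  by have /eqP := fw _ h i; rewrite eqxx ai subr0 oner_eq0.
have [f [lf f0 f1]] := separating_functional Uwi.
have bb : bilin (fun (x : V) (y : W) => (f y : K) *: x).
  split=> [y k x x'|x k y y'].
    by rewrite scalerDr !scalerA mulrC.
  by rewrite lf scalerDl scalerA.
have := congr1 (tlift (fun (x : V) (y : W) => (f y : K) *: x)) e.
have lt := tlift_linear bb.
rewrite (linfun_sum lt) (linear_at0 lt) (bigD1 i) //= (tlift_tens bb) f1 scale1r.
rewrite big1 ?addr0 // => l li; rewrite (tlift_tens bb) f0 ?scale0r //.
exists (fun m => (m == l)%:R); first by rewrite eq_sym (negbTE li).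
rewrite /L (bigD1 l) //= eqxx scale1r big1 ?addr0 // => m /negbTE ->.
by rewrite scale0r.
Qed.

Definition tswap V W : tensor V W -> tensor W V :=
  tlift (fun v w => tens w v).

Lemma tswap_bilin V W : bilin (fun (v : V) (w : W) => tens w v).
Proof. by split; [exact: (tens_bilin W V).2|exact: (tens_bilin W V).1]. Qed.

Lemma tswap_linear V W : linear (@tswap V W).
Proof. exact: (tlift_linear (tswap_bilin V W)). Qed.

Lemma tswap_tens V W (v : V) (w : W) : tswap (tens v w) = tens w v.
Proof. exact: (tlift_tens (tswap_bilin V W)). Qed.

Lemma tswapK V W : cancel (@tswap V W) (@tswap W V).
Proof.
move=> t; apply: (@tensor_ext _ _ _ _ (@tswap W V \o @tswap V W) id) => //.
  exact: (linear_compo (@tswap_linear W V) (@tswap_linear V W)).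
by move=> v w; rewrite /= !tswap_tens.
Qed.

Lemma free_family_inj V W (r : V -> W) n (v : 'I_n -> V) :
  linear r -> injective r -> free_family v -> free_family (r \o v).
Proof.
move=> lr ir fv c e; apply: fv; apply: ir.
rewrite (linfun_sum lr) (linear_at0 lr) -[RHS]e; apply: eq_bigr => i _ /=.
exact: linfunZ.
Qed.

(** The kernel of [m (x) r] is [ker m (x) W], by the exactness of the tensor product:
    in a sum whose right-hand factors are free, they remain so after [r]. *)
Lemma ker_tmapl V W V' W' (m : V -> V') (r : W -> W') (t : tensor V W) :
  linear m -> linear r -> injective r -> tmap m r t = 0 ->
  exists n (v : 'I_n -> V) (w : 'I_n -> W),
    (forall i, m (v i) = 0) /\ t = \sum_i tens (v i) (w i).
Proof.
move=> lm lr ir; have [n [v [w [fw ->]]]] := tensor_free t.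
rewrite (linfun_sum (tmap_linear lm lr)) => e.
exists n, v, w; split=> //.
apply: (@tens_free_eq0 _ _ n (m \o v) (r \o w)).
  exact: free_family_inj.
by rewrite -[RHS]e; apply: eq_bigr => i _; rewrite /= tmap_tens.
Qed.

Lemma ker_tmapr V W V' W' (r : V -> V') (m : W -> W') (t : tensor V W) :
  linear r -> linear m -> injective r -> tmap r m t = 0 ->
  exists n (v : 'I_n -> V) (w : 'I_n -> W),
    (forall i, m (w i) = 0) /\ t = \sum_i tens (v i) (w i).
Proof.
move=> lr lm ir e.
have swapE x : tmap m r (tswap x) = tswap (tmap r m x).
  move: x; apply: tensor_ext => [||v w].
  - exact: (linear_compo (tmap_linear lm lr) (@tswap_linear V W)).
  - exact: (linear_compo (@tswap_linear V' W') (tmap_linear lr lm)).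
  by rewrite tswap_tens !tmap_tens // tswap_tens.
have [|n [w [v [hw hs]]]] := @ker_tmapl _ _ _ _ m r (tswap t) lm lr ir.
  by rewrite swapE e; exact/linear_at0/tswap_linear.
exists n, v, w; split=> //.
rewrite -[t]tswapK hs (linfun_sum (@tswap_linear W V)).
by apply: eq_bigr => i _; rewrite tswap_tens.
Qed.

Lemma tmap_inj V W V' W' (l : V -> V') (r : W -> W') :
  linear l -> linear r -> injective l -> injective r ->
  injective (tmap l r : tensor V W -> tensor V' W').
Proof.
move=> ll lr il ir; apply: linfun_inj; first exact: tmap_linear.
move=> t /(ker_tmapl ll lr ir) [n [v [w [hv ->]]]].
rewrite big1 // => i _; rewrite (_ : v i = 0) ?tens0l //.
by apply: il; rewrite hv linear_at0.
Qed.

End Tensors.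

(** * Bilinear maps and actions on tensor products *)

Section BilinearMaps.
Variable K : fieldType.

Lemma linear_fun_comp (U V W : lmodType K) (f : V -> W) (g : U -> V) :
  linear f -> linear g -> linear (fun x => f (g x)).
Proof. exact: linear_compo. Qed.

Lemma linear_add (U V : lmodType K) (f g : U -> V) :
  linear f -> linear g -> linear (fun x => f x + g x).
Proof.
by move=> lf lg k x y; rewrite lf lg scalerDr addrACA.
Qed.

Lemma bilin_comp (U V U' V' W : lmodType K) (b : U' -> V' -> W)
    (f : U -> U') (g : V -> V') :
  bilin b -> linear f -> linear g -> bilin (fun x y => b (f x) (g y)).
Proof.
move=> bb lf lg; split=> [y k x x'|x k y y'].
  by rewrite lf (bb.1 _).
by rewrite lg (bb.2 _).
Qed.

Lemma bilin_linear (U V W W' : lmodType K) (f : W -> W') (b : U -> V -> W) :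
  linear f -> bilin b -> bilin (fun x y => f (b x y)).
Proof.
by move=> lf bb; split=> [y|x] k v v'; rewrite ?(bb.1 _) ?(bb.2 _) lf.
Qed.

Lemma bilin_add (U V W : lmodType K) (b c : U -> V -> W) :
  bilin b -> bilin c -> bilin (fun x y => b x y + c x y).
Proof.
move=> bb bc; split=> [y|x]; first exact: linear_add (bb.1 y) (bc.1 y).
exact: linear_add (bb.2 x) (bc.2 x).
Qed.

Lemma tensor_ext2 (V W V' W' Z : lmodType K)
    (f g : tensor V W -> tensor V' W' -> Z) : bilin f -> bilin g ->
  (forall v w v' w', f (tens v w) (tens v' w') = g (tens v w) (tens v' w')) ->
  forall s t, f s t = g s t.
Proof.
move=> bf bg fg s t; move: s.
apply: (tensor_ext (bf.1 t) (bg.1 t)) => v w; move: t.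
exact: (tensor_ext (bf.2 _) (bg.2 _)).
Qed.

Lemma tmap_comp (V W V' W' V'' W'' : lmodType K) (f : V' -> V'')
    (f' : W' -> W'') (g : V -> V') (g' : W -> W') (t : tensor V W) :
  linear f -> linear f' -> linear g -> linear g' ->
  tmap f f' (tmap g g' t) = tmap (fun v => f (g v)) (fun w => f' (g' w)) t.
Proof.
move=> lf lf' lg lg'.
have lfg := linear_fun_comp lf lg; have lfg' := linear_fun_comp lf' lg'.
move: t; apply: tensor_ext => [||v w]; last by rewrite !tmap_tens.
  exact: (linear_fun_comp (tmap_linear lf lf') (tmap_linear lg lg')).
exact: tmap_linear.
Qed.

Lemma eq_tmap (V W V' W' : lmodType K) (f g : V -> V') (f' g' : W -> W') :
  f =1 g -> f' =1 g' -> tmap f f' =1 tmap g g'.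
Proof. by move=> /funext-> /funext->. Qed.

Lemma tens_amul (A B : algebra K) (a : A) (b : B) (t : tensor_algebra A B) :
  (tens a b : tensor_algebra A B) ** t = tmap (amul a) (amul b) t.
Proof.
have la := (amul_bilin A).2 a; have lb := (amul_bilin B).2 b.
move: t; apply: tensor_ext => [||v w].
- exact: ((amul_bilin (tensor_algebra A B)).2 _).
- exact: tmap_linear.
by rewrite tensM tmap_tens.
Qed.

Lemma amul_tens (A B : algebra K) (a : A) (b : B) (t : tensor_algebra A B) :
  t ** (tens a b : tensor_algebra A B) = tmap (fun x => x ** a) (fun y => y ** b) t.
Proof.
have la := (amul_bilin A).1 a; have lb := (amul_bilin B).1 b.
move: t; apply: tensor_ext => [||v w].
- exact: ((amul_bilin (tensor_algebra A B)).1 _).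
- exact: (tmap_linear la lb).
by rewrite tensM (tmap_tens la lb).
Qed.

Lemma lact_tens (A B : algebra K) (M : bimodule A) (N : bimodule B)
    (a : A) (b : B) (t : tensor_bimodule M N) :
  lact (tens a b : tensor_algebra A B) t = tmap (lact a) (lact b) t.
Proof.
have la := (lact_bilin M).2 a; have lb := (lact_bilin N).2 b.
move: t; apply: tensor_ext => [||v w].
- exact: ((lact_bilin (tensor_bimodule M N)).2 _).
- exact: tmap_linear.
by rewrite tmap_tens //; apply: tact_tens; exact: lact_bilin.
Qed.

Lemma ract_tens (A B : algebra K) (M : bimodule A) (N : bimodule B)
    (a : A) (b : B) (t : tensor_bimodule M N) :
  ract t (tens a b : tensor_algebra A B) = tmap (fun x => ract x a) (fun y => ract y b) t.
Proof.
have la := (ract_bilin M).1 a; have lb := (ract_bilin N).1 b.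
move: t; apply: tensor_ext => [||v w].
- exact: ((ract_bilin (tensor_bimodule M N)).1 _).
- exact: (tmap_linear la lb).
by rewrite (tmap_tens la lb) //; apply: tact_tens; exact: ract_bilin.
Qed.

(** A linear relation which is total, onto and one-to-one both ways is the
    graph of an isomorphism; elementary tensors suffice to test that it
    respects the actions. *)
Lemma bimodule_iso_of_relation (A B : algebra K)
    (M N : bimodule (tensor_algebra A B)) (rel : M -> N -> Prop) :
  (forall k m m' n n', rel m n -> rel m' n' -> rel (k *: m + m') (k *: n + n')) ->
  (forall m, exists n, rel m n) -> (forall n, exists m, rel m n) ->
  (forall n, rel 0 n -> n = 0) -> (forall m, rel m 0 -> m = 0) ->
  (forall a b m n, rel m n -> rel (lact (tens a b : tensor_algebra A B) m)
      (lact (tens a b : tensor_algebra A B) n)) ->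
  (forall a b m n, rel m n -> rel (ract m (tens a b : tensor_algebra A B))
      (ract n (tens a b : tensor_algebra A B))) ->
  bimodule_iso M N.
Proof.
move=> rl /choice[f fP] /choice[h hP] r0 r0' rlact rract.
have rB m m' n n' : rel m n -> rel m' n' -> rel (m - m') (n - n').
  move=> mn mn'; rewrite -!scaleN1r addrC [n + _]addrC; exact: rl.
have fun_rel m n n' : rel m n -> rel m n' -> n = n'.
  move=> mn mn'; apply/eqP; rewrite -subr_eq0; apply/eqP/r0.
  by rewrite -(subrr m); exact: rB.
have inj_rel m m' n : rel m n -> rel m' n -> m = m'.
  move=> mn mn'; apply/eqP; rewrite -subr_eq0; apply/eqP/r0'.
  by rewrite -(subrr n); exact: rB.
have lf : linear f by move=> k m m'; apply: fun_rel (fP _) _; exact: rl.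
have bM := lact_bilin M; have bN := lact_bilin N.
have cM := ract_bilin M; have cN := ract_bilin N.
exists f; split=> //.
- exists h => [m|n]; first exact: inj_rel (hP _) (fP _).
  exact: fun_rel (fP _) (hP _).
- move=> t m; suff E : (fun t : tensor A B => f (lact (t : tensor_algebra A B) m))
      =1 (fun t : tensor A B => lact (t : tensor_algebra A B) (f m)) by exact: E.
  apply: tensor_ext => [||a b]; [|exact: (bN.1 _)|].
    exact: linear_fun_comp lf (bM.1 m).
  by apply: fun_rel (fP _) _; exact: rlact.
- move=> m t; suff E : (fun t : tensor A B => f (ract m (t : tensor_algebra A B)))
      =1 (fun t : tensor A B => ract (f m) (t : tensor_algebra A B)) by exact: E.
  apply: tensor_ext => [||a b]; [|exact: (cN.2 _)|].
    exact: linear_fun_comp lf (cM.2 m).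
  by apply: fun_rel (fP _) _; exact: rract.
Qed.

End BilinearMaps.

(** * One-forms, junk and classes of two-forms *)

Section JunkTensor.
Variables (K : fieldType) (A B : algebra K) (r d : A -> B).
Hypotheses (rL : linear r) (dL : linear d).

Lemma amul2_bilin (f h : A -> B) : linear f -> linear h ->
  bilin (fun a b => f a ** h b).
Proof. exact: (bilin_comp (amul_bilin B)). Qed.

(** The junk is the image under [b (x) c |-> db dc] of the kernel of
    [b (x) c |-> b dc]; stated on [A (x) A], these maps are linear and the exactness
    of the tensor product applies to them. *)
Definition form_of : tensor A A -> B := tlift (fun a b => r a ** d b).
Definition dform_of : tensor A A -> B := tlift (fun a b => d a ** d b).

Lemma form_of_linear : linear form_of.
Proof. exact/tlift_linear/amul2_bilin. Qed.

Lemma dform_of_linear : linear dform_of.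
Proof. exact/tlift_linear/amul2_bilin. Qed.

Lemma junk_setP x :
  junk_set r d x <-> exists2 u, form_of u = 0 & x = dform_of u.
Proof.
have fE := tlift_tens (amul2_bilin rL dL).
have gE := tlift_tens (amul2_bilin dL dL).
split=> [[s [s0 ->]]|[u + ->]].
  exists (\sum_(p <- s) tens p.1 p.2).
    by rewrite (linfun_sum form_of_linear) -[RHS]s0; apply: eq_bigr => p _.
  by rewrite (linfun_sum dform_of_linear); apply: eq_bigr => p _; rewrite /dform_of gE.
have [s ->] := tensor_seq u.
rewrite (linfun_sum form_of_linear) (linfun_sum dform_of_linear) => s0.
exists s; split; first by rewrite -[RHS]s0; apply: eq_bigr => p _; rewrite /form_of fE.
by apply: eq_bigr => p _; rewrite /dform_of gE.
Qed.

Definition junk_subspace : subspace B.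
Proof.
refine (@Subspace K B (junk_set r d) _ _).
  by exists [::]; rewrite !big_nil.
move=> k x y /junk_setP[u u0 ->] /junk_setP[v v0 ->]; apply/junk_setP.
exists (k *: u + v); last by rewrite dform_of_linear.
by rewrite form_of_linear u0 v0 scaler0 addr0.
Defined.

Hypothesis rM : forall a b, r (a ** b) = r a ** r b.
Hypothesis dM : forall a b, d (a ** b) = d a ** r b + r a ** d b.

Lemma junk_mull a x : junk_set r d x -> junk_set r d (r a ** x).
Proof.
move=> [s [s0 ->]]; exists [seq (a ** p.1, p.2) | p <- s].
rewrite !big_map; split=> /=.
  under eq_bigr do rewrite rM -amulA.
  by rewrite -amul_sumr s0 amulr0.
under [RHS]eq_bigr do rewrite dM amulDl -!amulA.
by rewrite big_split /= -!amul_sumr s0 amulr0 add0r.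
Qed.

Lemma junk_mulr a x : junk_set r d x -> junk_set r d (x ** r a).
Proof.
move=> [s [s0 ->]]; exists ([seq (p.1, p.2 ** a) | p <- s] ++
  [seq (- (p.1 ** p.2), a) | p <- s]).
rewrite !big_cat !big_map /= -!big_split /=; split.
  under eq_bigr do rewrite dM amulDr (linfunN rL) rM amulNl !amulA addrK.
  by rewrite -amul_suml s0 amul0.
have {}s0 : \sum_(p <- s) r p.1 ** d p.2 ** d a = 0 by rewrite -amul_suml s0 amul0.
rewrite amul_suml -[LHS]subr0 -[X in _ - X = _]s0 -sumrB; apply: eq_bigr => p _ /=.
by rewrite (linfunN dL) amulNl !dM amulDl amulDr opprD addrA !amulA addrK.
Qed.

End JunkTensor.

Section FormClasses.
Variables (K : fieldType) (A B : algebra K) (r d : A -> B).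
Hypotheses (rL : linear r) (r1 : r (aone A) = aone B).
Hypothesis rM : forall a b, r (a ** b) = r a ** r b.
Hypothesis dL : linear d.
Hypothesis dM : forall a b, d (a ** b) = d a ** r b + r a ** d b.

(** The bimodule of two-forms is anonymous in the construction of its quotient by
    the junk; it is read off from the type of the junk. *)
Definition twoform_bimodule : bimodule A :=
  ltac:(match type of (junk rL r1 rM dL dM) with
        | subspace (bcar ?M) => exact M end).

Definition form_class (x : twoform_bimodule) :
    twoform_quot_bimodule rL r1 rM dL dM :=
  qclass (junk rL r1 rM dL dM) x.

Lemma form_class_linear : linear form_class.
Proof. exact: qclass_linear. Qed.

Lemma form_class_eq (x y : subsp (twoforms d rL)) :
  form_class x = form_class y <-> junk_set r d (sval x - sval y).
Proof. exact: qclassP. Qed.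

Lemma form_class_eq0 (x : subsp (twoforms d rL)) :
  form_class x = 0 <-> junk_set r d (sval x).
Proof.
have -> : (0 : twoform_quot_bimodule rL r1 rM dL dM) = form_class 0 by [].
by split; rewrite form_class_eq subr0.
Qed.

Lemma form_class_surj y : exists x, y = form_class x.
Proof. by exists (qrepr y); rewrite [RHS]qreprK. Qed.

Lemma form_class_lact a (x : twoform_bimodule) :
  form_class (lact a x) = lact a (form_class x).
Proof.
apply/esym/form_class_eq => /=; rewrite -amulBr.
by apply: junk_mull => //; exact: (qclassK (junk rL r1 rM dL dM) x).
Qed.

Lemma form_class_ract a (x : twoform_bimodule) :
  form_class (ract x a) = ract (form_class x) a.
Proof.
apply/esym/form_class_eq => /=; rewrite -amulBl.
by apply: junk_mulr => //; exact: (qclassK (junk rL r1 rM dL dM) x).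
Qed.

End FormClasses.

(** * Auxiliary identities *)

Lemma addrACA3 (V : zmodType) (a a' b b' c c' : V) :
  (a + a') + (b + b') + (c + c') = (a + b + c) + (a' + b' + c').
Proof. by rewrite (addrACA a a') (addrACA (a + b)). Qed.

Lemma sum_diff_eq0 (V : zmodType) (I : Type) (l : seq I) (F H E : I -> V) :
  \sum_(i <- l) (F i + E i) = 0 -> \sum_(i <- l) (H i + E i) = 0 ->
  \sum_(i <- l) (F i - H i) = 0.
Proof.
move=> FE HE.
transitivity (\sum_(i <- l) (F i + E i) - \sum_(i <- l) (H i + E i)).
  by rewrite -sumrB; apply: eq_bigr => i _; rewrite opprD addrACA subrr addr0.
by rewrite FE HE subrr.
Qed.

Lemma linear_id (K : fieldType) (V : lmodType K) : linear (@id V).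
Proof. by []. Qed.

Lemma qclass_eq0 (K : fieldType) (V : lmodType K) (J : subspace V) v :
  qclass J v = 0 <-> J v.
Proof.
have -> : (0 : quotsp J) = qclass J 0 by [].
by split=> [/qclassP|Jv]; [|apply/qclassP]; rewrite subr0.
Qed.

(** What lies in [J (x) W] disappears in the quotient by [J]. *)
Lemma tmap_qclassl (K : fieldType) (V W : lmodType K) (J : subspace V) v (w : W) :
  J v -> tmap (qclass J) id (tens v w) = 0.
Proof.
move=> Jv; rewrite (tmap_tens (qclass_linear J) (@linear_id _ W)).
by rewrite (_ : qclass J v = 0) ?tens0l //; apply/qclass_eq0.
Qed.

Lemma tmap_qclassr (K : fieldType) (V W : lmodType K) (J : subspace W) (v : V) w :
  J w -> tmap id (qclass J) (tens v w) = 0.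
Proof.
move=> Jw; rewrite (tmap_tens (@linear_id _ V) (qclass_linear J)).
by rewrite (_ : qclass J w = 0) ?tens0r //; apply/qclass_eq0.
Qed.

Lemma comm_amul (K : fieldType) (B : algebra K) (g x y : B) :
  g ** x = x ** g -> g ** y = y ** g -> g ** (x ** y) = x ** y ** g.
Proof. by move=> gx gy; rewrite amulA gx -amulA gy amulA. Qed.

Lemma anti_amul (K : fieldType) (B : algebra K) (g x y : B) :
  g ** x = x ** g -> g ** y = - (y ** g) -> g ** (x ** y) = - (x ** y ** g).
Proof. by move=> gx gy; rewrite amulA gx -amulA gy amulNr amulA. Qed.

Lemma anti_amul2 (K : fieldType) (B : algebra K) (g x y : B) :
  g ** x = - (x ** g) -> g ** y = - (y ** g) -> g ** (x ** y) = x ** y ** g.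
Proof. by move=> gx gy; rewrite amulA gx amulNl -amulA gy amulNr opprK amulA. Qed.

(** Conjugation by [g] fixes [x] and negates [y]. *)
Lemma parity_split (K : fieldType) (B : algebra K) (g x y : B) :
  2%:R != 0 :> K -> g ** g = aone B ->
  g ** x = x ** g -> g ** y = - (y ** g) -> x + y = 0 -> x = 0 /\ y = 0.
Proof.
move=> K2 g2 gx gy xy.
have xE : x = - y by apply/eqP; rewrite -addr_eq0; apply/eqP.
have gyE : g ** y = y ** g.
  by move: gx; rewrite xE amulNr amulNl => /oppr_inj.
suff y0 : y = 0 by rewrite xE y0 oppr0.
have : 2%:R *: (g ** y) = 0 by rewrite scaler_nat mulr2n {1}gy gyE addNr.
move/eqP; rewrite scaler_eq0 (negbTE K2) /= => /eqP gy0.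
by rewrite -[y]amul1 -g2 -amulA gy0 amulr0.
Qed.

(** For [y] odd and [y'] even, the sign of the mixed term comes from moving [g] to
    the left past [y]. *)
Lemma prod_expand (K : fieldType) (B : algebra K) (g x y y' z z' : B) :
  g ** g = aone B ->
  g ** x = x ** g -> g ** y = - (y ** g) -> g ** y' = y' ** g ->
  x ** (y + g ** y') ** (z + g ** z')
    = x ** y ** z + x ** y' ** z' + g ** (x ** y' ** z - x ** y ** z').
Proof.
move=> g2 gx gy gy'.
have e1 : x ** y ** (g ** z') = - (g ** (x ** y ** z')).
  have -> : x ** y ** (g ** z') = x ** (y ** g) ** z' by rewrite !amulA.
  by rewrite -[y ** g]opprK -gy amulNr amulNl !amulA gx.
have e2 : x ** (g ** y') ** z = g ** (x ** y' ** z) by rewrite !amulA gx.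
have e3 : x ** (g ** y') ** (g ** z') = x ** y' ** z'.
  have -> : x ** (g ** y') ** (g ** z') = x ** g ** (y' ** g) ** z' by rewrite !amulA.
  have -> : x ** g ** (y' ** g) ** z' = x ** (g ** g) ** y' ** z'.
    by rewrite -gy' !amulA.
  by rewrite g2 amulr1.
rewrite [x ** (_ + _)]amulDr amulDl !amulDr e1 e2 e3 amulNr.
by rewrite addrACA [RHS]addrACA; congr (_ + _); exact: addrC.
Qed.

Lemma prod_expand1 (K : fieldType) (B : algebra K) (g y y' z z' : B) :
  g ** g = aone B -> g ** y = - (y ** g) -> g ** y' = y' ** g ->
  (y + g ** y') ** (z + g ** z') = y ** z + y' ** z' + g ** (y' ** z - y ** z').
Proof.
move=> g2 gy gy'; have g1 : g ** aone B = aone B ** g by rewrite amul1 amulr1.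
by have := prod_expand z z' g2 g1 gy gy'; rewrite !amul1.
Qed.

Lemma sum_drop3 (K : fieldType) (B : algebra K) (g : B) (I : Type) (l : seq I)
    (F H E : I -> B) : \sum_(i <- l) E i = 0 ->
  \sum_(i <- l) F i + \sum_(i <- l) H i
    = \sum_(i <- l) (F i + H i + g ** E i).
Proof. by move=> E0; rewrite !big_split /= -amul_sumr E0 amulr0 addr0. Qed.

Lemma scale_add3 (K : fieldType) (V : lmodType K) (k : K) (a a' b b' c c' : V) :
  (k *: a + a') + (k *: b + b') + (k *: c + c')
    = k *: (a + b + c) + (a' + b' + c').
Proof. by rewrite addrACA3 !scalerDr. Qed.

Section IntertwiningTmap.
Variables (K : fieldType) (V W : lmodType K) (f' : V -> V) (h' : W -> W).
Hypotheses (f'L : linear f') (h'L : linear h').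

Lemma tmap_mull (A B : algebra K) (f : V -> A) (h : W -> B) a b t :
  linear f -> linear h ->
  (forall v, f (f' v) = a ** f v) -> (forall w, h (h' w) = b ** h w) ->
  tmap f h (tmap f' h' t) = (tens a b : tensor_algebra A B) ** tmap f h t.
Proof.
move=> lf lh fa hb; rewrite tens_amul (tmap_comp _ lf lh f'L h'L).
rewrite (tmap_comp _ ((amul_bilin A).2 a) ((amul_bilin B).2 b) lf lh).
exact: eq_tmap.
Qed.

Lemma tmap_mulr (A B : algebra K) (f : V -> A) (h : W -> B) a b t :
  linear f -> linear h ->
  (forall v, f (f' v) = f v ** a) -> (forall w, h (h' w) = h w ** b) ->
  tmap f h (tmap f' h' t) = (tmap f h t : tensor_algebra A B) ** tens a b.
Proof.
move=> lf lh fa hb; rewrite amul_tens (tmap_comp _ lf lh f'L h'L).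
rewrite (tmap_comp _ ((amul_bilin A).1 a) ((amul_bilin B).1 b) lf lh).
exact: eq_tmap.
Qed.

Lemma tmap_lact (A B : algebra K) (M : bimodule A) (N : bimodule B)
    (f : V -> M) (h : W -> N) a b t :
  linear f -> linear h ->
  (forall v, f (f' v) = lact a (f v)) -> (forall w, h (h' w) = lact b (h w)) ->
  tmap f h (tmap f' h' t)
    = lact (tens a b : tensor_algebra A B) (tmap f h t : tensor_bimodule M N).
Proof.
move=> lf lh fa hb; rewrite lact_tens (tmap_comp _ lf lh f'L h'L).
rewrite (tmap_comp _ ((lact_bilin M).2 a) ((lact_bilin N).2 b) lf lh).
exact: eq_tmap.
Qed.

Lemma tmap_ract (A B : algebra K) (M : bimodule A) (N : bimodule B)
    (f : V -> M) (h : W -> N) a b t :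
  linear f -> linear h ->
  (forall v, f (f' v) = ract (f v) a) -> (forall w, h (h' w) = ract (h w) b) ->
  tmap f h (tmap f' h' t)
    = ract (tmap f h t : tensor_bimodule M N) (tens a b : tensor_algebra A B).
Proof.
move=> lf lh fa hb; rewrite ract_tens (tmap_comp _ lf lh f'L h'L).
rewrite (tmap_comp _ ((ract_bilin M).1 a) ((ract_bilin N).1 b) lf lh).
exact: eq_tmap.
Qed.

End IntertwiningTmap.

Lemma mull_parts (K : fieldType) (B : algebra K) (g x u v w u' v' w' : B) :
  x ** g = g ** x -> u' = x ** u -> v' = x ** v -> w' = x ** w ->
  x ** (u + v + g ** w) = u' + v' + g ** w'.
Proof. by move=> xg -> -> ->; rewrite !amulDr !amulA xg. Qed.

Lemma mulr_parts (K : fieldType) (B : algebra K) (g x u v w u' v' w' : B) :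
  u' = u ** x -> v' = v ** x -> w' = w ** x ->
  (u + v + g ** w) ** x = u' + v' + g ** w'.
Proof. by move=> -> -> ->; rewrite !amulDl !amulA. Qed.

(** * Two-forms of a product, algebraically *)

Section ProductForms.
Variables (K : fieldType) (A1 A2 B1 B2 : algebra K).
Variables (r1 d1 : A1 -> B1) (r2 d2 : A2 -> B2) (g : B1).
Hypothesis K2 : 2%:R != 0 :> K.
Hypotheses (r1L : linear r1) (r11 : r1 (aone A1) = aone B1).
Hypothesis r1M : forall a b, r1 (a ** b) = r1 a ** r1 b.
Hypothesis d1L : linear d1.
Hypothesis d1M : forall a b, d1 (a ** b) = d1 a ** r1 b + r1 a ** d1 b.
Hypotheses (r2L : linear r2) (r21 : r2 (aone A2) = aone B2).
Hypothesis r2M : forall a b, r2 (a ** b) = r2 a ** r2 b.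
Hypothesis d2L : linear d2.
Hypothesis d2M : forall a b, d2 (a ** b) = d2 a ** r2 b + r2 a ** d2 b.
Hypotheses (r1I : injective r1) (r2I : injective r2).
Hypotheses (j1 : junk_set r1 d1 (aone B1)) (j2 : junk_set r2 d2 (aone B2)).
Hypothesis g2 : g ** g = aone B1.
Hypothesis gr : forall a, g ** r1 a = r1 a ** g.
Hypothesis gd : forall a, g ** d1 a = - (d1 a ** g).

Local Notation A12 := (tensor_algebra A1 A2).
Local Notation B12 := (tensor_algebra B1 B2).
Local Notation rho := (tmap r1 r2 : A12 -> B12).
Local Notation D1 := (tmap d1 r2 : A12 -> B12).
Local Notation D2 := (tmap r1 d2 : A12 -> B12).
Local Notation G := (tens g (aone B2) : B12).

Let rhoL : linear rho := tmap_linear r1L r2L.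
Let D1L : linear D1 := tmap_linear d1L r2L.
Let D2L : linear D2 := tmap_linear r1L d2L.

Let G2 : G ** G = aone B12.
Proof. by rewrite tensM g2 amul1. Qed.

Let mulL (x : B12) : linear (amul x) := (amul_bilin B12).2 x.
Let mulR (x : B12) : linear (fun y : B12 => y ** x) := (amul_bilin B12).1 x.

Let even_tmap (f : A1 -> B1) (h : A2 -> B2) (x : A12) :
  linear f -> linear h -> (forall a, g ** f a = f a ** g) ->
  G ** (tmap f h x : B12) = (tmap f h x : B12) ** G.
Proof.
move=> lf lh gf; have lt := tmap_linear lf lh.
move: x; apply: (@tensor_ext _ A1 A2 B12 (fun x => G ** (tmap f h x : B12))
  (fun x => (tmap f h x : B12) ** G)) => [||a b].
- exact: linear_fun_comp (mulL G) lt.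
- exact: linear_fun_comp (mulR G) lt.
by rewrite (tmap_tens lf lh) !tensM gf amul1 amulr1.
Qed.

Let odd_tmap (f : A1 -> B1) (h : A2 -> B2) (x : A12) :
  linear f -> linear h -> (forall a, g ** f a = - (f a ** g)) ->
  G ** (tmap f h x : B12) = - ((tmap f h x : B12) ** G).
Proof.
move=> lf lh gf; have lt := tmap_linear lf lh.
move: x; apply: (@tensor_ext _ A1 A2 B12 (fun x => G ** (tmap f h x : B12))
  (fun x => - ((tmap f h x : B12) ** G))) => [||a b].
- exact: linear_fun_comp (mulL G) lt.
- by move=> k x y; rewrite lt amulDl amulZl opprD scalerN.
by rewrite (tmap_tens lf lh) !tensM gf amul1 amulr1 -scaleN1r tensZl scaleN1r.
Qed.

Let G_rho x : G ** rho x = rho x ** G.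
Proof. exact: even_tmap. Qed.
Let G_D2 x : G ** D2 x = D2 x ** G.
Proof. exact: even_tmap. Qed.
Let G_D1 x : G ** D1 x = - (D1 x ** G).
Proof. exact: odd_tmap. Qed.

(** Keeping the two factors in [A1] apart, and multiplying those in [A2] only, makes
    [f _ ** h _] a linear map on the first factor of a tensor product. *)
Let pairl (f h : A1 -> B1) (x y : A12) : linear f -> linear h ->
  tmap (tlift (fun a b => f a ** h b)) r2 (tact (@tens K A1 A1) (@amul K A2) x y)
    = (tmap f r2 x : B12) ** (tmap h r2 y : B12).
Proof.
move=> lf lh; have bU := bilin_tact (tens_bilin A1 A1) (amul_bilin A2).
have bb := amul2_bilin lf lh; set F := tmap _ _.
have lF : linear F by exact: (tmap_linear (tlift_linear bb) r2L).
have bF : bilin (fun x y => F (tact (@tens K A1 A1) (@amul K A2) x y)).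
  exact: (bilin_linear lF bU).
have bH : bilin (fun x y : tensor A1 A2 => (tmap f r2 x : B12) ** (tmap h r2 y : B12)).
  exact: (bilin_comp (amul_bilin B12) (tmap_linear lf r2L) (tmap_linear lh r2L)).
apply: (tensor_ext2 bF bH) => a b a' b'.
rewrite (tact_tens (tens_bilin A1 A1) (amul_bilin A2)).
rewrite /F (tmap_tens (tlift_linear bb) r2L) (tmap_tens lf r2L) (tmap_tens lh r2L).
by rewrite tensM (tlift_tens bb) r2M.
Qed.

Let pairr (f h : A2 -> B2) (x y : A12) : linear f -> linear h ->
  tmap r1 (tlift (fun a b => f a ** h b)) (tact (@amul K A1) (@tens K A2 A2) x y)
    = (tmap r1 f x : B12) ** (tmap r1 h y : B12).
Proof.
move=> lf lh; have bU := bilin_tact (amul_bilin A1) (tens_bilin A2 A2).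
have bb := amul2_bilin lf lh; set F := tmap _ _.
have lF : linear F by exact: (tmap_linear r1L (tlift_linear bb)).
have bF : bilin (fun x y => F (tact (@amul K A1) (@tens K A2 A2) x y)).
  exact: (bilin_linear lF bU).
have bH : bilin (fun x y : tensor A1 A2 => (tmap r1 f x : B12) ** (tmap r1 h y : B12)).
  exact: (bilin_comp (amul_bilin B12) (tmap_linear r1L lf) (tmap_linear r1L lh)).
apply: (tensor_ext2 bF bH) => a b a' b'.
rewrite (tact_tens (amul_bilin A1) (tens_bilin A2 A2)).
rewrite /F (tmap_tens r1L (tlift_linear bb)) (tmap_tens r1L lf) (tmap_tens r1L lh).
by rewrite tensM (tlift_tens bb) r1M.
Qed.

(** The elements of [A1 (x) A1] that occur next to a free family of [A2] have to be
    killed by [b (x) c |-> b dc] one by one. *)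
Lemma junkl (s : seq (A12 * A12)) :
  \sum_(p <- s) rho p.1 ** D1 p.2 = 0 ->
  exists n (x : 'I_n -> B1) (b : 'I_n -> A2),
    (forall i, junk_set r1 d1 (x i)) /\
    \sum_(p <- s) D1 p.1 ** D1 p.2 = \sum_i tens (x i) (r2 (b i)).
Proof.
move=> s0.
pose u := \sum_(p <- s) tact (@tens K A1 A1) (@amul K A2) p.1 p.2.
have lm := form_of_linear r1L d1L; have ln := dform_of_linear d1L.
have [|n [x [b [hx hu]]]] := @ker_tmapl K _ _ _ _ (form_of r1 d1) r2 u lm r2L r2I.
  rewrite (linfun_sum (tmap_linear lm r2L)) -[RHS]s0.
  by apply: eq_bigr => p _; exact: pairl.
exists n, (fun i => dform_of d1 (x i)), b; split.
  by move=> i; apply/(junk_setP r1L d1L); exists (x i).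
transitivity (tmap (dform_of d1) r2 u : B12).
  rewrite (linfun_sum (tmap_linear ln r2L)).
  by apply: eq_bigr => p _; rewrite -pairl.
rewrite hu (linfun_sum (tmap_linear ln r2L)).
by apply: eq_bigr => i _; rewrite tmap_tens.
Qed.

Lemma junkr (s : seq (A12 * A12)) :
  \sum_(p <- s) rho p.1 ** D2 p.2 = 0 ->
  exists n (a : 'I_n -> A1) (x : 'I_n -> B2),
    (forall i, junk_set r2 d2 (x i)) /\
    \sum_(p <- s) D2 p.1 ** D2 p.2 = \sum_i tens (r1 (a i)) (x i).
Proof.
move=> s0.
pose u := \sum_(p <- s) tact (@amul K A1) (@tens K A2 A2) p.1 p.2.
have lm := form_of_linear r2L d2L; have ln := dform_of_linear d2L.
have [|n [a [x [hx hu]]]] := @ker_tmapr K _ _ _ _ r1 (form_of r2 d2) u r1L lm r1I.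
  rewrite (linfun_sum (tmap_linear r1L lm)) -[RHS]s0.
  by apply: eq_bigr => p _; exact: pairr.
exists n, a, (fun i => dform_of d2 (x i)); split.
  by move=> i; apply/(junk_setP r2L d2L); exists (x i).
transitivity (tmap r1 (dform_of d2) u : B12).
  rewrite (linfun_sum (tmap_linear r1L ln)).
  by apply: eq_bigr => p _; rewrite -pairr.
rewrite hu (linfun_sum (tmap_linear r1L ln)).
by apply: eq_bigr => i _; rewrite tmap_tens.
Qed.

Let d12 : A12 -> B12 := tmap d1 d2.
Let d12L : linear d12 := tmap_linear d1L d2L.

(** The sum belongs to the image of [A1 (x) B2], where [r1] is injective, so that it
    already vanishes in [A1 (x) B2]; there [d1 (x) id] can be applied. *)
Lemma mixedl (s : seq (A12 * A12)) :
  \sum_(p <- s) rho p.1 ** D2 p.2 = 0 ->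
  \sum_(p <- s) (D1 p.1 ** D2 p.2 + rho p.1 ** d12 p.2) = 0.
Proof.
pose C := tensor_algebra A1 B2.
have idL : linear (@id A1) by [].
have idL' : linear (@id B2) by [].
have l1 := tmap_linear idL r2L; have l2 := tmap_linear idL d2L.
have l3 := tmap_linear r1L idL'; have l4 := tmap_linear d1L idL'.
pose z (x y : tensor A1 A2) : C := (tmap id r2 x : C) ** (tmap id d2 y : C).
have zb : bilin z by exact: (bilin_comp (amul_bilin C) l1 l2).
have zE a b a' b' : z (tens a b) (tens a' b') = tens (a ** a') (r2 b ** d2 b').
  by rewrite /z (tmap_tens idL r2L) (tmap_tens idL d2L) tensM.
have rz x y : tmap r1 id (z x y) = rho x ** D2 y :> B12.
  have b1 := bilin_linear l3 zb; have b2 := bilin_comp (amul_bilin B12) rhoL D2L.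
  apply: (tensor_ext2 b1 b2) => a b a' b'.
  by rewrite zE (tmap_tens r1L idL') (tmap_tens r1L r2L) (tmap_tens r1L d2L) tensM r1M.
have dz x y : tmap d1 id (z x y) = D1 x ** D2 y + rho x ** d12 y :> B12.
  have b1 := bilin_linear l4 zb.
  have b2 := bilin_add (bilin_comp (amul_bilin B12) D1L D2L)
                       (bilin_comp (amul_bilin B12) rhoL d12L).
  apply: (tensor_ext2 b1 b2) => a b a' b'; rewrite /d12.
  rewrite zE (tmap_tens d1L idL') (tmap_tens r1L r2L) (tmap_tens r1L d2L).
  by rewrite (tmap_tens d1L r2L) (tmap_tens d1L d2L) !tensM d1M tensDl.
under eq_bigr do rewrite -rz.
under [X in _ -> X = 0]eq_bigr do rewrite -dz.
rewrite -(linfun_sum l3) -(linfun_sum l4) => e.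
rewrite (_ : \sum_(p <- s) z p.1 p.2 = 0) ?(linear_at0 l4) //.
by apply: (tmap_inj r1L idL' r1I (@inj_id _)); rewrite e (linear_at0 l3).
Qed.

Lemma mixedr (s : seq (A12 * A12)) :
  \sum_(p <- s) rho p.1 ** D1 p.2 = 0 ->
  \sum_(p <- s) (D2 p.1 ** D1 p.2 + rho p.1 ** d12 p.2) = 0.
Proof.
pose C := tensor_algebra B1 A2.
have idL : linear (@id A2) by [].
have idL' : linear (@id B1) by [].
have l1 := tmap_linear r1L idL; have l2 := tmap_linear d1L idL.
have l3 := tmap_linear idL' r2L; have l4 := tmap_linear idL' d2L.
pose z (x y : tensor A1 A2) : C := (tmap r1 id x : C) ** (tmap d1 id y : C).
have zb : bilin z by exact: (bilin_comp (amul_bilin C) l1 l2).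
have zE a b a' b' : z (tens a b) (tens a' b') = tens (r1 a ** d1 a') (b ** b').
  by rewrite /z (tmap_tens r1L idL) (tmap_tens d1L idL) tensM.
have rz x y : tmap id r2 (z x y) = rho x ** D1 y :> B12.
  have b1 := bilin_linear l3 zb; have b2 := bilin_comp (amul_bilin B12) rhoL D1L.
  apply: (tensor_ext2 b1 b2) => a b a' b'.
  by rewrite zE (tmap_tens idL' r2L) (tmap_tens r1L r2L) (tmap_tens d1L r2L) tensM r2M.
have dz x y : tmap id d2 (z x y) = D2 x ** D1 y + rho x ** d12 y :> B12.
  have b1 := bilin_linear l4 zb.
  have b2 := bilin_add (bilin_comp (amul_bilin B12) D2L D1L)
                       (bilin_comp (amul_bilin B12) rhoL d12L).
  apply: (tensor_ext2 b1 b2) => a b a' b'; rewrite /d12.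
  rewrite zE (tmap_tens idL' d2L) (tmap_tens r1L r2L) (tmap_tens r1L d2L).
  by rewrite (tmap_tens d1L r2L) (tmap_tens d1L d2L) !tensM d2M tensDr.
under eq_bigr do rewrite -rz.
under [X in _ -> X = 0]eq_bigr do rewrite -dz.
rewrite -(linfun_sum l3) -(linfun_sum l4) => e.
rewrite (_ : \sum_(p <- s) z p.1 p.2 = 0) ?(linear_at0 l4) //.
by apply: (tmap_inj idL' r2L (@inj_id _) r2I); rewrite e (linear_at0 l3).
Qed.

Let derivation1 (A0 C0 : algebra K) (r0 d0 : A0 -> C0) :
  r0 (aone A0) = aone C0 ->
  (forall a b, d0 (a ** b) = d0 a ** r0 b + r0 a ** d0 b) -> d0 (aone A0) = 0.
Proof.
move=> r01 d0M; have := d0M (aone A0) (aone A0).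
rewrite amul1 r01 amul1 amulr1 => /esym/eqP.
by rewrite -subr_eq0 addrK => /eqP.
Qed.

Variables (B : algebra K) (r d : A12 -> B).
Hypotheses (rL : linear r) (r_1 : r (aone A12) = aone B).
Hypothesis rM : forall a b, r (a ** b) = r a ** r b.
Hypothesis dL : linear d.
Hypothesis dM : forall a b, d (a ** b) = d a ** r b + r a ** d b.
(* [R X t] is meant to say that the operator [X] on the completed tensor product
   acts as [t] does: such a relation is only partially defined on either side, but
   it is one-to-one and respects sums and products. *)
Variable R : B -> B12 -> Prop.
Hypothesis R0 : R 0 0.
Hypothesis R_lin : forall k X Y s t, R X s -> R Y t -> R (k *: X + Y) (k *: s + t).
Hypothesis RM : forall X Y s t, R X s -> R Y t -> R (X ** Y) (s ** t).
Hypothesis R_inj : forall t, R 0 t -> t = 0.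
Hypothesis R_fun : forall X, R X 0 -> X = 0.
Hypothesis Rr : forall x, R (r x) (rho x).
Hypothesis Rd : forall x, R (d x) (D1 x + G ** D2 x).

Let R_add X Y s t : R X s -> R Y t -> R (X + Y) (s + t).
Proof. by move=> Xs Yt; rewrite -[X]scale1r -[s]scale1r; exact: R_lin. Qed.

Let R_sub X Y s t : R X s -> R Y t -> R (X - Y) (s - t).
Proof.
by move=> Xs Yt; rewrite addrC -scaleN1r [s - t]addrC -scaleN1r; exact: R_lin.
Qed.

Let R_sum (I : Type) (l : seq I) (F : I -> B) (f : I -> B12) :
  (forall i, R (F i) (f i)) -> R (\sum_(i <- l) F i) (\sum_(i <- l) f i).
Proof.
by move=> h; elim/big_ind2 : _ => // X s Y t; exact: R_add.
Qed.

Let R_eq X Y t : R X t -> R Y t -> X = Y.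
Proof.
move=> Xt Yt; apply/eqP; rewrite -subr_eq0; apply/eqP/R_fun.
by rewrite -(subrr t); exact: R_sub.
Qed.

Let R_eq' X s t : R X s -> R X t -> s = t.
Proof.
move=> Xs Xt; apply/eqP; rewrite -subr_eq0; apply/eqP/R_inj.
by rewrite -(subrr X); exact: R_sub.
Qed.

Let Rd1 a b : R (d (tens a b)) (tens (d1 a) (r2 b) + G ** tens (r1 a) (d2 b)).
Proof.
by have := Rd (tens a b); rewrite (tmap_tens d1L r2L) (tmap_tens r1L d2L).
Qed.

Let sumD (V : lmodType K) (I : Type) (l : seq I) (F H : I -> V) :
  \sum_(i <- l) (F i + H i) = \sum_(i <- l) F i + \sum_(i <- l) H i.
Proof. exact: big_split. Qed.

Local Notation two1 := (subsp (twoforms d1 r1L)).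
Local Notation two2 := (subsp (twoforms d2 r2L)).
Local Notation one1 := (subsp (oneforms d1 r1L)).
Local Notation one2 := (subsp (oneforms d2 r2L)).
Local Notation two := (subsp (twoforms d rL)).

Let s1L : linear (fun x : two1 => sval x) := @sval_linear _ _ _.
Let s2L : linear (fun x : two2 => sval x) := @sval_linear _ _ _.
Let o1L : linear (fun x : one1 => sval x) := @sval_linear _ _ _.
Let o2L : linear (fun x : one2 => sval x) := @sval_linear _ _ _.

Let i1 : tensor two1 A2 -> B12 := tmap (fun x : two1 => sval x) r2.
Let i2 : tensor A1 two2 -> B12 := tmap r1 (fun x : two2 => sval x).
Let i3 : tensor one1 one2 -> B12 :=
  tmap (fun x : one1 => sval x) (fun x : one2 => sval x).
Let i1L : linear i1 := tmap_linear s1L r2L.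
Let i2L : linear i2 := tmap_linear r1L s2L.
Let i3L : linear i3 := tmap_linear o1L o2L.

Let realized (S : subspace B) : subspace B12.
Proof.
refine (@Subspace K B12 (fun t => exists2 X, S X & R X t) _ _).
  by exists 0 => //; exact: subspace0.
move=> k s t [X SX Xs] [Y SY Yt]; exists (k *: X + Y); first exact: subspaceP.
exact: R_lin.
Defined.

Let Rd_left a : R (d (tens a (aone A2))) (tens (d1 a) (aone B2)).
Proof.
by have := Rd1 a (aone A2); rewrite (derivation1 r21 d2M) tens0r amulr0 addr0 r21.
Qed.

Let Rd_right b : R (d (tens (aone A1) b)) (tens g (d2 b)).
Proof.
have := Rd1 (aone A1) b; rewrite (derivation1 r11 d1M) tens0l add0r r11.
by rewrite tensM amulr1 amul1.
Qed.

Let Rr_tens a b : R (r (tens a b)) (tens (r1 a) (r2 b)).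
Proof. by have := Rr (tens a b); rewrite (tmap_tens r1L r2L). Qed.

Let realized1 t : realized (twoforms d rL) (i1 t).
Proof.
move: t; apply: (@tensor_ind _ _ _ (preim_subspace i1L (realized (twoforms d rL)))).
move=> [w tw] b; rewrite /= /i1 (tmap_tens s1L r2L) /=; have [s ->] := tw.
exists (\sum_(p <- s) r (tens p.1.1 b) ** d (tens p.1.2 (aone A2)) **
          d (tens p.2 (aone A2))).
  by exists [seq (tens p.1.1 b, tens p.1.2 (aone A2), tens p.2 (aone A2)) | p <- s];
    rewrite big_map.
rewrite tens_suml; apply: R_sum => p.
have := RM (RM (Rr_tens p.1.1 b) (Rd_left p.1.2)) (Rd_left p.2).
by rewrite !tensM !amulr1.
Qed.

Let realized2 t : realized (twoforms d rL) (i2 t).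
Proof.
move: t; apply: (@tensor_ind _ _ _ (preim_subspace i2L (realized (twoforms d rL)))).
move=> a [w tw]; rewrite /= /i2 (tmap_tens r1L s2L) /=; have [s ->] := tw.
exists (\sum_(p <- s) r (tens a p.1.1) ** d (tens (aone A1) p.1.2) **
          d (tens (aone A1) p.2)).
  by exists [seq (tens a p.1.1, tens (aone A1) p.1.2, tens (aone A1) p.2) | p <- s];
    rewrite big_map.
rewrite tens_sumr; apply: R_sum => p.
have := RM (RM (Rr_tens a p.1.1) (Rd_right p.1.2)) (Rd_right p.2).
by rewrite !tensM -[r1 a ** g ** g]amulA g2 amulr1.
Qed.

Let G_suml (I : Type) (l : seq I) (F : I -> B1) (y : B2) :
  G ** (tens (\sum_(i <- l) F i) y : B12) = \sum_(i <- l) G ** (tens (F i) y : B12).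
Proof. exact: (linfun_sum (linear_fun_comp (mulL G) ((tens_bilin B1 B2).1 y))). Qed.

Let G_sumr (I : Type) (l : seq I) (F : I -> B2) (x : B1) :
  G ** (tens x (\sum_(i <- l) F i) : B12) = \sum_(i <- l) G ** (tens x (F i) : B12).
Proof. exact: (linfun_sum (linear_fun_comp (mulL G) ((tens_bilin B1 B2).2 x))). Qed.

Let realized3 t : realized (twoforms d rL) (G ** i3 t).
Proof.
have l3 := linear_fun_comp (mulL G) i3L.
move: t; apply: (@tensor_ind _ _ _ (preim_subspace l3 (realized (twoforms d rL)))).
move=> v v'; suff : realized (twoforms d rL) (G ** (tens (sval v) (sval v') : B12)).
  by rewrite -(tmap_tens o1L o2L).
have [s ->] := svalP v; have [s' ->] := svalP v'.
rewrite G_suml; apply: subspace_sum => p.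
rewrite G_sumr; apply: subspace_sum => q.
exists (r (tens p.1 q.1) ** d (tens (aone A1) q.2) ** d (tens p.2 (aone A2))).
  exists [:: (tens p.1 q.1, tens (aone A1) q.2, tens p.2 (aone A2))].
  by rewrite big_seq1.
have := RM (RM (Rr_tens p.1 q.1) (Rd_right q.2)) (Rd_left p.2).
by rewrite !tensM amul1 amulr1 amulA gr.
Qed.

Let realized_forms t1 t2 t3 :
  exists X : two, R (sval X) (i1 t1 + i2 t2 + G ** i3 t3).
Proof.
have [X tX RX] : realized (twoforms d rL) (i1 t1 + i2 t2 + G ** i3 t3).
  apply: subspaceD; last exact: realized3.
  by apply: subspaceD; [exact: realized1|exact: realized2].
by exists (exist _ X tX).
Qed.

Let junk_sub := junk_subspace rL dL.

(** Besides [x (x) r2 b], the product of the commutators has the term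
    [G (w (x) d2 b)], where [w] is the one-form whose vanishing makes [x] junk. *)
Let realized_junk1 x b : junk_set r1 d1 x -> realized junk_sub (tens x (r2 b)).
Proof.
move=> [s [s0 ->]].
exists (\sum_(p <- s) d (tens p.1 b) ** d (tens p.2 (aone A2))).
  exists [seq (tens p.1 b, tens p.2 (aone A2)) | p <- s]; rewrite !big_map.
  split=> //=; apply: R_fun.
  rewrite -[X in R _ X](tens0l B1 (r2 b)) -s0 tens_suml; apply: R_sum => p.
  have := RM (Rr_tens p.1 b) (Rd_left p.2).
  by rewrite !tensM amulr1.
have -> : tens (\sum_(p <- s) d1 p.1 ** d1 p.2) (r2 b)
    = \sum_(p <- s) (tens (d1 p.1 ** d1 p.2) (r2 b)
        + G ** tens (r1 p.1 ** d1 p.2) (d2 b)) :> B12.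
  rewrite sumD -tens_suml.
  by rewrite -(G_suml _ (fun p => r1 p.1 ** d1 p.2)) s0 tens0l amulr0 addr0.
apply: R_sum => p; have := RM (Rd1 p.1 b) (Rd_left p.2).
by rewrite amulDl -amulA !tensM !amulr1.
Qed.

Let realized_junk2 a x : junk_set r2 d2 x -> realized junk_sub (tens (r1 a) x).
Proof.
move=> [s [s0 ->]].
exists (\sum_(p <- s) d (tens a p.1) ** d (tens (aone A1) p.2)).
  exists [seq (tens a p.1, tens (aone A1) p.2) | p <- s]; rewrite !big_map.
  split=> //=; apply: R_fun.
  rewrite -[X in R _ X](tens0r B2 (r1 a ** g)) -s0 tens_sumr; apply: R_sum => p.
  have := RM (Rr_tens a p.1) (Rd_right p.2).
  by rewrite !tensM.
have -> : tens (r1 a) (\sum_(p <- s) d2 p.1 ** d2 p.2)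
    = \sum_(p <- s) (tens (d1 a ** g) (r2 p.1 ** d2 p.2)
        + tens (r1 a) (d2 p.1 ** d2 p.2)) :> B12.
  by rewrite sumD -!tens_sumr s0 tens0r add0r.
apply: R_sum => p; have := RM (Rd1 a p.1) (Rd_right p.2).
by rewrite amulDl !tensM amul1 gr -[r1 a ** g ** g]amulA g2 amulr1.
Qed.

Let tri_ind (U : subspace B12) (f1 f2 f3 : A12 -> B12) :
  linear f1 -> linear f2 -> linear f3 ->
  (forall a a' b b' c c',
     U (f1 (tens a a') ** f2 (tens b b') ** f3 (tens c c'))) ->
  forall x y z, U (f1 x ** f2 y ** f3 z).
Proof.
move=> l1 l2 l3 h.
have hz a a' b b' z : U (f1 (tens a a') ** f2 (tens b b') ** f3 z).
  have lz := linear_fun_comp (mulL (f1 (tens a a') ** f2 (tens b b'))) l3.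
  by apply: (@tensor_ind _ _ _ (preim_subspace lz U)) => c c'; exact: h.
have hy a a' y z : U (f1 (tens a a') ** f2 y ** f3 z).
  have ly := linear_fun_comp (mulR (f3 z)) (linear_fun_comp (mulL (f1 (tens a a'))) l2).
  by apply: (@tensor_ind _ _ _ (preim_subspace ly U)) => b b'; exact: hz.
move=> x y z.
have lx := linear_fun_comp (mulR (f3 z)) (linear_fun_comp (mulR (f2 y)) l1).
by apply: (@tensor_ind _ _ _ (preim_subspace lx U)) => a a'; exact: hy.
Qed.

Let form_part1 x y z : image_subspace i1L (rho x ** D1 y ** D1 z).
Proof.
move: x y z; apply: (tri_ind rhoL D1L D1L) => a a' b b' c c'.
rewrite (tmap_tens r1L r2L) !(tmap_tens d1L r2L) !tensM -!r2M.
have w : twoforms d1 r1L (r1 a ** d1 b ** d1 c).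
  by exists [:: (a, b, c)]; rewrite big_seq1.
exists (tens (exist _ _ w : two1) (a' ** b' ** c')) => //.
by rewrite /i1 (tmap_tens s1L r2L).
Qed.

Let form_part2 x y z : image_subspace i2L (rho x ** D2 y ** D2 z).
Proof.
move: x y z; apply: (tri_ind rhoL D2L D2L) => a a' b b' c c'.
rewrite (tmap_tens r1L r2L) !(tmap_tens r1L d2L) !tensM -!r1M.
have w : twoforms d2 r2L (r2 a' ** d2 b' ** d2 c').
  by exists [:: (a', b', c')]; rewrite big_seq1.
exists (tens (a ** b ** c) (exist _ _ w : two2)) => //.
by rewrite /i2 (tmap_tens r1L s2L).
Qed.

Let form_part3 x y z : image_subspace i3L (rho x ** D1 y ** D2 z).
Proof.
move: x y z; apply: (tri_ind rhoL D1L D2L) => a a' b b' c c'.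
rewrite (tmap_tens r1L r2L) (tmap_tens d1L r2L) (tmap_tens r1L d2L) !tensM -!r2M.
have w : oneforms d1 r1L (r1 a ** d1 b).
  by exists [:: (a, b)]; rewrite big_seq1.
have w' : oneforms d2 r2L (r2 (a' ** b') ** d2 c').
  by exists [:: (a' ** b', c')]; rewrite big_seq1.
pose v : one1 := @ract _ _ (oneform_bimodule r1L r11 r1M d1M) (exist _ _ w) c.
exists (tens v (exist _ _ w' : one2)) => //.
by rewrite /i3 (tmap_tens o1L o2L).
Qed.

Let form_part3' x y z : image_subspace i3L (rho x ** D2 y ** D1 z).
Proof.
move: x y z; apply: (tri_ind rhoL D2L D1L) => a a' b b' c c'.
rewrite (tmap_tens r1L r2L) (tmap_tens d1L r2L) (tmap_tens r1L d2L) !tensM -!r1M.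
have w : oneforms d1 r1L (r1 (a ** b) ** d1 c).
  by exists [:: (a ** b, c)]; rewrite big_seq1.
have w' : oneforms d2 r2L (r2 a' ** d2 b').
  by exists [:: (a', b')]; rewrite big_seq1.
pose v : one2 := @ract _ _ (oneform_bimodule r2L r21 r2M d2M) (exist _ _ w') c'.
exists (tens (exist _ _ w : one1) v) => //.
by rewrite /i3 (tmap_tens o1L o2L).
Qed.

Let form_decomposition X : twoforms d rL X ->
  exists t1 t2 t3, R X (i1 t1 + i2 t2 + G ** i3 t3).
Proof.
move=> [s ->]; elim: s => [|p s [u1 [u2 [u3 IH]]]].
  exists 0, 0, 0; rewrite big_nil (linear_at0 i1L) (linear_at0 i2L).
  by rewrite (linear_at0 i3L) amulr0 !addr0.
have [t1 _ e1] := form_part1 p.1.1 p.1.2 p.2.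
have [t2 _ e2] := form_part2 p.1.1 p.1.2 p.2.
have [t3 _ e3] := form_part3 p.1.1 p.1.2 p.2.
have [t4 _ e4] := form_part3' p.1.1 p.1.2 p.2.
exists (t1 + u1), (t2 + u2), (t4 - t3 + u3); rewrite big_cons.
rewrite (linfunD i1L) (linfunD i2L) (linfunD i3L) (linfunB i3L) amulDr.
rewrite addrACA3; apply: R_add IH.
rewrite e1 e2 e3 e4 -(prod_expand _ _ G2 (G_rho _) (G_D1 _) (G_D2 _)).
exact: RM (RM (Rr _) (Rd _)) (Rd _).
Qed.

Let junk_decomposition X : junk_set r d X ->
  exists n (x : 'I_n -> B1) (b : 'I_n -> A2) m (a : 'I_m -> A1) (y : 'I_m -> B2),
  [/\ forall i, junk_set r1 d1 (x i), forall i, junk_set r2 d2 (y i) &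
    R X (\sum_i tens (x i) (r2 (b i)) + \sum_i tens (r1 (a i)) (y i))].
Proof.
move=> [s [s0 ->]].
have := R_sum s (fun p => RM (Rr p.1) (Rd p.2)); rewrite s0 => /R_inj.
under eq_bigr do rewrite amulDr.
rewrite sumD addrC => e.
have mulg x y : rho x ** (G ** D2 y) = G ** (rho x ** D2 y).
  by rewrite [LHS]amulA -G_rho -[LHS]amulA.
have [||e2 e1] := parity_split K2 G2 _ _ e.
- rewrite amul_sumr amul_suml; apply: eq_bigr => p _.
  apply: (comm_amul (G_rho _)); exact: comm_amul (erefl _) (G_D2 _).
- rewrite amul_sumr amul_suml -sumrN; apply: eq_bigr => p _.
  exact: (anti_amul (G_rho _) (G_D1 _)).
have {e e2} e2 : \sum_(p <- s) rho p.1 ** D2 p.2 = 0.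
  rewrite -[LHS]amul1 -G2 -amulA amul_sumr.
  under eq_bigr do rewrite -mulg.
  by rewrite e2 amulr0.
have [n [x [b [hx ex]]]] := junkl e1; have [m [a [y [hy ey]]]] := junkr e2.
exists n, x, b, m, a, y; split=> //; rewrite -ex -ey.
have e3 : \sum_(p <- s) (D2 p.1 ** D1 p.2 - D1 p.1 ** D2 p.2) = 0.
  exact: (sum_diff_eq0 (mixedr e1) (mixedl e2)).
have -> : \sum_(p <- s) D1 p.1 ** D1 p.2 + \sum_(p <- s) D2 p.1 ** D2 p.2
    = \sum_(p <- s) (D1 p.1 + G ** D2 p.1) ** (D1 p.2 + G ** D2 p.2).
  rewrite (sum_drop3 G _ _ e3); apply: eq_bigr => p _.
  exact/esym/(prod_expand1 _ _ G2 (G_D1 _) (G_D2 _)).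
exact: R_sum (fun p => RM (Rd p.1) (Rd p.2)).
Qed.

Let q1 : two1 -> twoform_quot_bimodule r1L r11 r1M d1L d1M :=
  @form_class _ _ _ _ _ r1L r11 r1M d1L d1M.
Let q2 : two2 -> twoform_quot_bimodule r2L r21 r2M d2L d2M :=
  @form_class _ _ _ _ _ r2L r21 r2M d2L d2M.
Let q : two -> twoform_quot_bimodule rL r_1 rM dL dM :=
  @form_class _ _ _ _ _ rL r_1 rM dL dM.
Let q1L : linear q1 := @form_class_linear _ _ _ _ _ r1L r11 r1M d1L d1M.
Let q2L : linear q2 := @form_class_linear _ _ _ _ _ r2L r21 r2M d2L d2M.
Let qL : linear q := @form_class_linear _ _ _ _ _ rL r_1 rM dL dM.
Let id1L : linear (@id A1) := @linear_id _ A1.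
Let id2L : linear (@id A2) := @linear_id _ A2.

Let target := dsum_bimodule
  (tensor_bimodule (twoform_quot_bimodule r1L r11 r1M d1L d1M) (regular_bimodule A2))
  (dsum_bimodule
    (tensor_bimodule (regular_bimodule A1) (twoform_quot_bimodule r2L r21 r2M d2L d2M))
    (tensor_bimodule (oneform_bimodule r1L r11 r1M d1M)
                     (oneform_bimodule r2L r21 r2M d2M))).

(** Decompositions of two-forms into their three parts are not unique; [rel] relates
    the class of a form to the classes of the parts in any of its decompositions. *)
Let rel (x : twoform_quot_bimodule rL r_1 rM dL dM) (n : target) : Prop :=
  exists (X : two) t1 t2 t3,
    [/\ x = q X, R (sval X) (i1 t1 + i2 t2 + G ** i3 t3) &
        n = (tmap q1 id t1, (tmap id q2 t2, t3))].

Let even : subspace B12 := eq_subspace (mulL G) (mulR G).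

Let even_elementary x y : g ** x = x ** g -> even (tens x y).
Proof.
move=> gx; suff : G ** (tens x y : B12) = (tens x y : B12) ** G by [].
by rewrite !tensM gx amul1 amulr1.
Qed.

Let g_two (w : two1) : g ** sval w = sval w ** g.
Proof.
have [s ->] := svalP w; rewrite amul_sumr amul_suml; apply: eq_bigr => p _.
rewrite -[r1 _ ** _ ** _]amulA.
exact: (comm_amul (gr _) (anti_amul2 (gd _) (gd _))).
Qed.

Let g_junk x : junk_set r1 d1 x -> g ** x = x ** g.
Proof.
move=> [s [_ ->]]; rewrite amul_sumr amul_suml; apply: eq_bigr => p _.
exact: (anti_amul2 (gd _) (gd _)).
Qed.

Let g_one (w : one1) : g ** sval w = - (sval w ** g).
Proof.
have [s ->] := svalP w; rewrite amul_sumr amul_suml -sumrN.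
by apply: eq_bigr => p _; exact: (anti_amul (gr _) (gd _)).
Qed.

Let even1 t : even (i1 t).
Proof.
move: t; apply: (@tensor_ind _ _ _ (preim_subspace i1L even)) => w b.
suff : even (tens (sval w) (r2 b)) by rewrite -(tmap_tens s1L r2L).
exact: even_elementary (g_two w).
Qed.

Let even2 t : even (i2 t).
Proof.
move: t; apply: (@tensor_ind _ _ _ (preim_subspace i2L even)) => a w.
suff : even (tens (r1 a) (sval w)) by rewrite -(tmap_tens r1L s2L).
exact: even_elementary (gr a).
Qed.

Let odd3 t : G ** i3 t = - (i3 t ** G).
Proof.
have lN : linear (fun x : B12 => - (x ** G)).
  by move=> k x y; rewrite amulDl amulZl opprD scalerN.
move: t; apply: (@tensor_ext _ _ _ B12 (fun t => G ** i3 t)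
  (fun t => - (i3 t ** G))) => [||w w'].
- exact: linear_fun_comp (mulL G) i3L.
- exact: linear_fun_comp lN i3L.
rewrite /i3 (tmap_tens o1L o2L) !tensM g_one amul1 amulr1.
by rewrite -scaleN1r tensZl scaleN1r.
Qed.

Let i3I : injective i3.
Proof.
by apply: (tmap_inj o1L o2L) => [x y|x y]; exact: subsp_inj.
Qed.

Let rel_0l n : rel 0 n -> n = 0.
Proof.
move=> [X [t1 [t2 [t3 [/esym/form_class_eq0 jX RX ->]]]]].
have [k [x [b [m [a [y [hx hy RX']]]]]]] := junk_decomposition jX.
set w1 := \sum_i tens (x i) (r2 (b i)) in RX'.
set w2 := \sum_i tens (r1 (a i)) (y i) in RX'.
have ew1 : even w1.
  by apply: subspace_sum => i; apply: even_elementary; exact: g_junk.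
have ew2 : even w2.
  by apply: subspace_sum => i; exact: even_elementary (gr _).
have e : (i1 t1 + i2 t2 - (w1 + w2)) + G ** i3 t3 = 0.
  by rewrite addrAC (R_eq' RX RX') subrr.
have ee : even (i1 t1 + i2 t2 - (w1 + w2)).
  exact: subspaceB (subspaceD (even1 t1) (even2 t2)) (subspaceD ew1 ew2).
have [|e12 e3] := parity_split K2 G2 ee _ e.
  exact: (anti_amul (erefl _) (odd3 t3)).
have t30 : t3 = 0.
  by apply: i3I; rewrite (linear_at0 i3L) -[LHS]amul1 -G2 -amulA e3 amulr0.
have {e12 e} e : i1 t1 + i2 t2 = w1 + w2 by apply/eqP; rewrite -subr_eq0; apply/eqP.
(* As [A1] lies in [J], the quotient by [J] in the first factor kills [i2 t2]. *)
have t10 : tmap q1 id t1 = 0.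
  pose J := junk_subspace r1L d1L; have kL := qclass_linear J.
  have Jr z : J (r1 z) by rewrite -[r1 z]amulr1; exact: junk_mull j1.
  pose T : tensor B1 B2 -> tensor (quotsp J) B2 := tmap (qclass J) id.
  have TL : linear T := tmap_linear kL (@linear_id _ B2).
  have T2 t : T (i2 t) = 0.
    move: t; apply: (@tensor_ind _ _ _
      (preim_subspace (linear_fun_comp TL i2L) (zero_subspace _))) => c w.
    suff : T (tens (r1 c) (sval w)) = 0 by rewrite -(tmap_tens r1L s2L).
    apply: tmap_qclassl; exact: Jr.
  have Tw1 : T w1 = 0.
    by rewrite (linfun_sum TL); apply: big1 => i _; apply: tmap_qclassl; exact: hx.
  have Tw2 : T w2 = 0.
    by rewrite (linfun_sum TL); apply: big1 => i _; apply: tmap_qclassl; exact: Jr.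
  have : T (i1 t1) = 0.
    rewrite -[LHS]addr0 -{1}(T2 t2) -(linfunD TL) e (linfunD TL).
    by rewrite Tw1 Tw2 addr0.
  rewrite /T /i1 (tmap_comp _ kL (@linear_id _ B2) s1L r2L).
  move=> /(ker_tmapl (linear_fun_comp kL s1L) r2L r2I) [l [v [c [hv ->]]]].
  rewrite (linfun_sum (tmap_linear q1L id2L)); apply: big1 => i _.
  have vi : q1 (v i) = 0 by apply/form_class_eq0/(qclass_eq0 J)/hv.
  by rewrite (tmap_tens q1L id2L) vi tens0l.
have t20 : tmap id q2 t2 = 0.
  pose J := junk_subspace r2L d2L; have kL := qclass_linear J.
  have Jr z : J (r2 z) by rewrite -[r2 z]amulr1; exact: junk_mull j2.
  pose T : tensor B1 B2 -> tensor B1 (quotsp J) := tmap id (qclass J).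
  have TL : linear T := tmap_linear (@linear_id _ B1) kL.
  have T1 t : T (i1 t) = 0.
    move: t; apply: (@tensor_ind _ _ _
      (preim_subspace (linear_fun_comp TL i1L) (zero_subspace _))) => w c.
    suff : T (tens (sval w) (r2 c)) = 0 by rewrite -(tmap_tens s1L r2L).
    apply: tmap_qclassr; exact: Jr.
  have Tw1 : T w1 = 0.
    by rewrite (linfun_sum TL); apply: big1 => i _; apply: tmap_qclassr; exact: Jr.
  have Tw2 : T w2 = 0.
    by rewrite (linfun_sum TL); apply: big1 => i _; apply: tmap_qclassr; exact: hy.
  have : T (i2 t2) = 0.
    rewrite -[LHS]add0r -{1}(T1 t1) -(linfunD TL) e (linfunD TL).
    by rewrite Tw1 Tw2 addr0.
  rewrite /T /i2 (tmap_comp _ (@linear_id _ B1) kL r1L s2L).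
  move=> /(ker_tmapr r1L (linear_fun_comp kL s2L) r1I) [l [c [v [hv ->]]]].
  rewrite (linfun_sum (tmap_linear id1L q2L)); apply: big1 => i _.
  have vi : q2 (v i) = 0 by apply/form_class_eq0/(qclass_eq0 J)/hv.
  by rewrite (tmap_tens id1L q2L) vi tens0r.
by rewrite t10 t20 t30.
Qed.

Let rel_0r x : rel x 0 -> x = 0.
Proof.
move=> [X [t1 [t2 [t3 [-> RX [e1 e2 e3]]]]]].
have [Y jY RY] : realized junk_sub (i1 t1 + i2 t2 + G ** i3 t3).
  rewrite -e3 (linear_at0 i3L) amulr0 addr0; apply: subspaceD.
    have [k [v [b [hv ->]]]] := ker_tmapl q1L id2L (@inj_id _) (esym e1).
    rewrite (linfun_sum i1L); apply: subspace_sum => i.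
    rewrite /i1 (tmap_tens s1L r2L); apply: realized_junk1.
    exact: (@form_class_eq0 _ _ _ _ _ r1L r11 r1M d1L d1M (v i)).1 (hv i).
  have [k [a [v [hv ->]]]] := ker_tmapr id1L q2L (@inj_id _) (esym e2).
  rewrite (linfun_sum i2L); apply: subspace_sum => i.
  rewrite /i2 (tmap_tens r1L s2L); apply: realized_junk2.
  exact: (@form_class_eq0 _ _ _ _ _ r2L r21 r2M d2L d2M (v i)).1 (hv i).
by apply/form_class_eq0; rewrite (R_eq RX RY).
Qed.

Let rel_total x : exists n, rel x n.
Proof.
have [X ->] := form_class_surj x.
have [t1 [t2 [t3 RX]]] := form_decomposition (svalP X).
by exists (tmap q1 id t1, (tmap id q2 t2, t3)), X, t1, t2, t3.
Qed.

Let rel_surj n : exists x, rel x n.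
Proof.
have s1 t : exists t1, tmap q1 (@id A2) t1 = t.
  suff : image_subspace (tmap_linear q1L id2L) t by move=> [t1 _ <-]; exists t1.
  move: t; apply: tensor_ind => x b; have [w ->] := form_class_surj x.
  by exists (tens (w : two1) b) => //; rewrite (tmap_tens q1L id2L).
have s2 t : exists t2, tmap (@id A1) q2 t2 = t.
  suff : image_subspace (tmap_linear id1L q2L) t by move=> [t2 _ <-]; exists t2.
  move: t; apply: tensor_ind => a x; have [w ->] := form_class_surj x.
  by exists (tens a (w : two2)) => //; rewrite (tmap_tens id1L q2L).
case: n => n1 [n2 t3]; have [t1 <-] := s1 n1; have [t2 <-] := s2 n2.
have [X RX] := realized_forms t1 t2 t3.
by exists (q X), X, t1, t2, t3.
Qed.

Let rel_linear k x x' n n' : rel x n -> rel x' n' -> rel (k *: x + x') (k *: n + n').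
Proof.
move=> [X [t1 [t2 [t3 [-> RX ->]]]]] [Y [u1 [u2 [u3 [-> RY ->]]]]].
exists (k *: X + Y), (k *: t1 + u1), (k *: t2 + u2), (k *: t3 + u3); split.
- by rewrite qL.
- rewrite i1L i2L (linear_fun_comp (mulL G) i3L) scale_add3.
  exact: R_lin RX RY.
by rewrite (tmap_linear q1L id2L) (tmap_linear id1L q2L).
Qed.

Local Notation M1 := (twoform_bimodule r1L r11 r1M d1M).
Local Notation M2 := (twoform_bimodule r2L r21 r2M d2M).
Local Notation O1 := (twoform_quot_bimodule r1L r11 r1M d1L d1M).
Local Notation O2 := (twoform_quot_bimodule r2L r21 r2M d2L d2M).
Local Notation F1 := (oneform_bimodule r1L r11 r1M d1M).
Local Notation F2 := (oneform_bimodule r2L r21 r2M d2M).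

Let rel_lact a b x n :
  rel x n -> rel (lact (tens a b : A12) x) (lact (tens a b : A12) n).
Proof.
move=> [X [t1 [t2 [t3 [-> RX ->]]]]].
have a1 := (amul_bilin A1).2 a; have a2 := (amul_bilin A2).2 b.
have m1 := (lact_bilin M1).2 a; have m2 := (lact_bilin M2).2 b.
have f1 := (lact_bilin F1).2 a; have f2 := (lact_bilin F2).2 b.
exists (lact (tens a b : A12) (X : twoform_bimodule rL r_1 rM dM)).
pose u1 : tensor two1 A2 := tmap (@lact _ _ M1 a) (amul b) t1.
pose u2 : tensor A1 two2 := tmap (amul a) (@lact _ _ M2 b) t2.
pose u3 : tensor one1 one2 := tmap (@lact _ _ F1 a) (@lact _ _ F2 b) t3.
pose ab : B12 := tens (r1 a) (r2 b).
exists u1, u2, u3; split.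
- exact/esym/form_class_lact.
- have e1 : i1 u1 = ab ** i1 t1.
    exact: (tmap_mull m1 a2 t1 s1L r2L (fun _ => erefl) (r2M b)).
  have e2 : i2 u2 = ab ** i2 t2.
    exact: (tmap_mull a1 m2 t2 r1L s2L (r1M a) (fun _ => erefl)).
  have e3 : i3 u3 = ab ** i3 t3.
    exact: (tmap_mull f1 f2 t3 o1L o2L (fun _ => erefl) (fun _ => erefl)).
  have abG : ab ** G = G ** ab by rewrite !tensM gr amul1 amulr1.
  by rewrite -(mull_parts abG e1 e2 e3); exact: RM (Rr_tens a b) RX.
congr (_, (_, _)).
- exact/esym/(@tmap_lact _ _ _ _ _ m1 a2 _ _ O1 (regular_bimodule A2) q1 id a b t1
    q1L id2L (fun w => form_class_lact d1L a w) (fun=> erefl)).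
- exact/esym/(@tmap_lact _ _ _ _ _ a1 m2 _ _ (regular_bimodule A1) O2 id q2 a b t2
    id1L q2L (fun=> erefl) (fun w => form_class_lact d2L b w)).
exact: (@lact_tens _ _ _ F1 F2).
Qed.

Let rel_ract a b x n :
  rel x n -> rel (ract x (tens a b : A12)) (ract n (tens a b : A12)).
Proof.
move=> [X [t1 [t2 [t3 [-> RX ->]]]]].
have a1 := (amul_bilin A1).1 a; have a2 := (amul_bilin A2).1 b.
have m1 := (ract_bilin M1).1 a; have m2 := (ract_bilin M2).1 b.
have f1 := (ract_bilin F1).1 a; have f2 := (ract_bilin F2).1 b.
exists (ract (X : twoform_bimodule rL r_1 rM dM) (tens a b : A12)).
pose u1 : tensor two1 A2 := tmap (fun w : M1 => ract w a) (fun y => y ** b) t1.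
pose u2 : tensor A1 two2 := tmap (fun y => y ** a) (fun w : M2 => ract w b) t2.
pose u3 : tensor one1 one2 :=
  tmap (fun w : F1 => ract w a) (fun w : F2 => ract w b) t3.
pose ab : B12 := tens (r1 a) (r2 b).
exists u1, u2, u3; split.
- exact/esym/form_class_ract.
- have e1 : i1 u1 = i1 t1 ** ab.
    exact: (tmap_mulr m1 a2 t1 s1L r2L (fun _ => erefl) (r2M^~ b)).
  have e2 : i2 u2 = i2 t2 ** ab.
    exact: (tmap_mulr a1 m2 t2 r1L s2L (r1M^~ a) (fun _ => erefl)).
  have e3 : i3 u3 = i3 t3 ** ab.
    exact: (tmap_mulr f1 f2 t3 o1L o2L (fun _ => erefl) (fun _ => erefl)).
  by rewrite -(mulr_parts G e1 e2 e3); exact: RM RX (Rr_tens a b).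
congr (_, (_, _)).
- exact/esym/(@tmap_ract _ _ _ _ _ m1 a2 _ _ O1 (regular_bimodule A2) q1 id a b t1
    q1L id2L (fun w => form_class_ract d1L a w) (fun=> erefl)).
- exact/esym/(@tmap_ract _ _ _ _ _ a1 m2 _ _ (regular_bimodule A1) O2 id q2 a b t2
    id1L q2L (fun=> erefl) (fun w => form_class_ract d2L b w)).
exact: (@ract_tens _ _ _ F1 F2).
Qed.

Theorem product_forms_iso :
  bimodule_iso (twoform_quot_bimodule rL r_1 rM dL dM)
    (dsum_bimodule
      (tensor_bimodule (twoform_quot_bimodule r1L r11 r1M d1L d1M)
                       (regular_bimodule A2))
      (dsum_bimodule
        (tensor_bimodule (regular_bimodule A1)
                         (twoform_quot_bimodule r2L r21 r2M d2L d2M))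
        (tensor_bimodule (oneform_bimodule r1L r11 r1M d1M)
                         (oneform_bimodule r2L r21 r2M d2M)))).
Proof.
exact: (bimodule_iso_of_relation rel_linear rel_total rel_surj rel_0l rel_0r
  rel_lact rel_ract).
Qed.

End ProductForms.

(** * Operators on a tensor product of Hilbert spaces *)

Section HilbertTensor.
Variables (C : numClosedFieldType).
Implicit Types H : hilbert C.

Lemma ip_linearl H (y : H) : linear (fun x : H => ip H x y : C^o).
Proof. by move=> k x x'; rewrite linearPl. Qed.

Lemma ip_suml H (I : Type) (l : seq I) (P : pred I) (F : I -> H) (y : H) :
  ip H (\sum_(i <- l | P i) F i) y = \sum_(i <- l | P i) ip H (F i) y.
Proof. exact: (linfun_sum (ip_linearl y)). Qed.

Lemma bounded_map_dense (H H' : hilbert C) (f h : H -> H') (V : set H) :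
  bounded_map f -> bounded_map h -> hdense V ->
  (forall x, V x -> f x = h x) -> forall x, f x = h x.
Proof.
move=> bf bh dV fh x.
have [lD [M M0 hM]] := boundedP (-1) bh bf.
have DE z : (-1 *: h + f) z = f z - h z by rewrite !fctE scaleN1r addrC.
apply/eqP; rewrite -subr_eq0 -DE; apply/eqP/ip_eq0/eqP.
rewrite eq_le ip_ge0 andbT.
have M1 : 0 < M + 1 by rewrite ltr_wpDl.
apply/ler_addgt0Pl => e e0; rewrite addr0.
have [y Vy xy] := dV x (e / (M + 1)) (divr_gt0 e0 M1).
have -> : (-1 *: h + f) x = (-1 *: h + f) (x - y).
  by rewrite (linfunB lD) [X in _ - X]DE fh // subrr subr0.
apply: (le_trans (hM _)).
apply: (@le_trans _ _ ((M + 1) * ip H (x - y) (x - y))).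
  by rewrite ler_wpM2r ?ip_ge0 // lerDl.
by rewrite mulrC -ler_pdivlMr // ltW.
Qed.

Lemma bounded_map_add (H H' : hilbert C) (f h : H -> H') :
  bounded_map f -> bounded_map h -> bounded_map (fun x => f x + h x).
Proof.
move=> bf bh; have := boundedP 1 bf bh.
by congr bounded_map; apply/funext => x; rewrite !fctE scale1r.
Qed.

Lemma app_at_linear H (x : H) : linear (fun S : BH H => app S x).
Proof. by []. Qed.

Lemma app_bounded H (S : BH H) : bounded_map (app S).
Proof. exact: (svalP (S : subsp (bounded_ops H))). Qed.

Variables (H1 H2 : hilbert C) (HH : hilbert_tensor H1 H2).
Local Notation B12 := (tensor_algebra (BH H1) (BH H2)).

Lemma hpure_boundedl y : bounded_map (fun x => hpure HH x y).
Proof.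
split; first exact: (hpure_bilin HH).1.
by exists (ip H2 y y); [exact: ip_ge0|move=> x; rewrite hpure_ip mulrC].
Qed.

Lemma hpure_boundedr x : bounded_map (hpure HH x).
Proof.
split; first exact: (hpure_bilin HH).2.
by exists (ip H1 x x); [exact: ip_ge0|move=> y; rewrite hpure_ip].
Qed.

Definition tens_app (x : H1) (y : H2) : tensor (BH H1) (BH H2) -> HH :=
  tlift (fun S T => hpure HH (app S x) (app T y)).

Lemma tens_app_bilin x y :
  bilin (fun (S : BH H1) (T : BH H2) => hpure HH (app S x) (app T y)).
Proof. exact: bilin_comp (hpure_bilin HH) (@app_at_linear _ x) (@app_at_linear _ y). Qed.

Lemma tens_app_linear x y : linear (tens_app x y).
Proof. exact: tlift_linear (tens_app_bilin x y). Qed.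

Lemma tens_app_tens x y S T :
  tens_app x y (tens S T) = hpure HH (app S x) (app T y).
Proof. exact: tlift_tens (tens_app_bilin x y) _ _. Qed.

(** Pairing with [hpure x' y'] turns [t] into a linear combination of the free family
    [T], with coefficients the matrix elements of the [S i]. *)
Lemma tens_app_eq0 t : (forall x y, tens_app x y t = 0) -> t = 0.
Proof.
have [n [S [T [fT ->]]]] := tensor_free t => t0.
suff S0 i : S i = 0 by apply: big1 => i _; rewrite S0 tens0l.
apply: BH_ext => x; rewrite [RHS](_ : _ = 0) //.
suff c0 x' : ip H1 (app (S i) x) x' = 0 by exact: ip_eq0 (c0 _).
move: i; apply: (fT (fun i => ip H1 (app (S i) x) x')).
set U : BH H2 := \sum_i _; apply: BH_ext => y; rewrite [RHS](_ : _ = 0) //.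
apply: ip_eq0; have := congr1 (fun z => ip HH z (hpure HH x' (app U y))) (t0 x y).
rewrite /= linear0l (linfun_sum (tens_app_linear x y)) ip_suml => e.
rewrite -[RHS]e {1}/U (linfun_sum (@app_at_linear _ y)) ip_suml.
apply: eq_bigr => i _; rewrite tens_app_tens hpure_ip.
by rewrite (linfunZ (@app_at_linear _ y)) linearZl_LR.
Qed.

(** Comparing values on elementary vectors dispenses with extending [S (x) T] to a
    bounded operator on the completed tensor product. *)
Definition implements (X : BH HH) (t : B12) :=
  forall x y, app X (hpure HH x y) = tens_app x y t.

Lemma implements0 : implements 0 0.
Proof. by move=> x y; rewrite (linear_at0 (tens_app_linear x y)). Qed.

Lemma implements_linear k X Y s t :
  implements X s -> implements Y t -> implements (k *: X + Y) (k *: s + t).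
Proof.
by move=> Xs Yt x y; rewrite tens_app_linear -Xs -Yt.
Qed.

Lemma implementsM X Y s t :
  implements X s -> implements Y t -> implements (X ** Y) (s ** t).
Proof.
move=> Xs Yt x y; rewrite -[LHS]/(app X (app Y (hpure HH x y))) Yt.
have lX := linear_fun_comp (app_linear X) (tens_app_linear x y).
have ls := linear_fun_comp (tens_app_linear x y) ((amul_bilin B12).2 s).
move: t {Yt}; apply: (tensor_ext lX ls) => S T.
rewrite tens_app_tens Xs.
move: s {Xs ls}; apply: (tensor_ext (tens_app_linear _ _) _) => [|S' T'].
  exact: linear_fun_comp (tens_app_linear x y) ((amul_bilin B12).1 (tens S T)).
by rewrite tensM !tens_app_tens.
Qed.

Lemma implements_inj t : implements 0 t -> t = 0.
Proof. by move=> h; apply: tens_app_eq0 => x y; rewrite -h. Qed.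

Lemma implements_fun X : implements X 0 -> X = 0.
Proof.
move=> h; set V := linspan [set z | exists x y, z = hpure HH x y].
pose Z : subspace HH := eq_subspace (app_linear X) (app_linear (0 : BH HH)).
have VZ : V `<=` (Z : set HH).
  apply: linspan_min => _ [x [y ->]].
  by rewrite /= h (linear_at0 (tens_app_linear x y)).
have e z : V z -> app X z = app (0 : BH HH) z by move=> /VZ.
exact: (BH_dense (@hpure_total _ _ _ HH) e).
Qed.

End HilbertTensor.

Section ProductTriple.
Variables (C : numClosedFieldType) (A B : algebra C) (H1 H2 : hilbert C).
Variables (T1 : dirac_triple A H1) (T2 : dirac_triple B H2) (g : BH H1).
Variables (HH : hilbert_tensor H1 H2).
Variable P : dirac_triple (tensor_algebra A B) HH.
Hypothesis gr : forall a, g ** rep T1 a = rep T1 a ** g.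
Hypothesis prodP : is_product_triple T1 (app g) T2 P.

Lemma rep_implements x :
  implements (rep P x) (tmap (rep T1) (rep T2) x).
Proof.
move=> u v; have lr := tmap_linear (rep_linear T1) (rep_linear T2).
have lP := linear_fun_comp (@app_at_linear _ _ (hpure HH u v)) (rep_linear P).
apply: (tensor_ext lP (linear_fun_comp (tens_app_linear HH u v) lr)) => a b.
rewrite (tmap_tens (rep_linear T1) (rep_linear T2)) tens_app_tens.
by case: prodP => h _ _; exact: h.
Qed.

(** Both sides are bounded in [x] and in [y], so that it suffices to compare them on
    the cores, where the commutator is given by the Dirac operator. *)
Lemma dcomm_tens a b x y :
  app (dcomm P (tens a b)) (hpure HH x y)
    = hpure HH (app (dcomm T1 a) x) (app (rep T2 b) y)
      + hpure HH (app (g ** rep T1 a) x) (app (dcomm T2 b) y).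
Proof.
have [hr hdom hD] := prodP.
pose f x y := app (dcomm P (tens a b)) (hpure HH x y).
pose h x y := hpure HH (app (dcomm T1 a) x) (app (rep T2 b) y)
      + hpure HH (app (g ** rep T1 a) x) (app (dcomm T2 b) y).
have fl y' : bounded_map (f^~ y').
  exact: bounded_comp (app_bounded _) (hpure_boundedl HH y').
have fr x' : bounded_map (f x').
  exact: bounded_comp (app_bounded _) (hpure_boundedr HH x').
have hl y' : bounded_map (h^~ y').
  by apply: bounded_map_add; exact: bounded_comp (hpure_boundedl HH _) (app_bounded _).
have hr' x' : bounded_map (h x').
  by apply: bounded_map_add; exact: bounded_comp (hpure_boundedr HH _) (app_bounded _).
rewrite -/(f x y) -/(h x y).
apply: (bounded_map_dense (fl y) (hl y) (dirac_dense T1)) => x' dx {x}.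
apply: (bounded_map_dense (fr x') (hr' x') (dirac_dense T2)) => y' dy {y}.
have dxy u v : dirac_dom T1 u -> dirac_dom T2 v -> dirac_dom P (hpure HH u v).
  move=> du dv; rewrite -[dirac_dom P _]/((dirac_dom P : set HH) _) hdom.
  by apply: mem_linspan; exists u, v.
rewrite /f dcommP; last exact: dxy.
rewrite hr !hD //; try exact: rep_dom.
have rl := app_linear (rep P (tens a b)).
rewrite (linfunD rl) !hr /h !dcommP //.
have bl := hpure_bilin HH.
rewrite (linfunB (bl.1 _)) (linfunB (bl.2 _)).
rewrite -[app (g ** rep T1 a) x']/(app g (app (rep T1 a) x')).
have -> : app (rep T1 a) (app g x') = app g (app (rep T1 a) x').
  exact: (congr1 (fun S => app S x') (esym (gr a))).
by rewrite opprD addrACA.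
Qed.

Lemma dcomm_implements x :
  implements (dcomm P x) (tmap (dcomm T1) (rep T2) x
    + (tens g (aone (BH H2)) : tensor_algebra (BH H1) (BH H2))
      ** tmap (rep T1) (dcomm T2) x).
Proof.
move=> u v.
have l1 := tmap_linear (dcomm_linear T1) (rep_linear T2).
have l2 := tmap_linear (rep_linear T1) (dcomm_linear T2).
have l3 := linear_fun_comp ((amul_bilin (tensor_algebra (BH H1) (BH H2))).2
  (tens g (aone (BH H2)))) l2.
have lP := linear_fun_comp (@app_at_linear _ _ (hpure HH u v)) (dcomm_linear P).
have lT := linear_fun_comp (tens_app_linear HH u v) (linear_add l1 l3).
apply: (tensor_ext lP lT) => a b.
rewrite (tmap_tens (dcomm_linear T1) (rep_linear T2)).
rewrite (tmap_tens (rep_linear T1) (dcomm_linear T2)) tensM amul1.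
by rewrite (linfunD (tens_app_linear HH u v)) !tens_app_tens dcomm_tens.
Qed.

Theorem product_triple_Omega2 :
  g ** g = aone (BH H1) ->
  (forall a, g ** dcomm T1 a = - (dcomm T1 a ** g)) ->
  injective (rep T1) -> injective (rep T2) ->
  junk_set (rep T1) (dcomm T1) (aone (BH H1)) ->
  junk_set (rep T2) (dcomm T2) (aone (BH H2)) ->
  bimodule_iso (Omega2 P)
    (dsum_bimodule (tensor_bimodule (Omega2 T1) (regular_bimodule B))
      (dsum_bimodule (tensor_bimodule (regular_bimodule A) (Omega2 T2))
                     (tensor_bimodule (Omega1 T1) (Omega1 T2)))).
Proof.
move=> g2 gd i1 i2 j1 j2.
have C2 : 2%:R != 0 :> C by rewrite pnatr_eq0.
exact: (@product_forms_iso C A B (BH H1) (BH H2) (rep T1) (dcomm T1) (rep T2)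
  (dcomm T2) g C2 (rep_linear T1) (rep1 T1) (repM T1) (dcomm_linear T1) (dcommM T1)
  (rep_linear T2) (rep1 T2) (repM T2) (dcomm_linear T2) (dcommM T2) i1 i2 j1 j2 g2
  gr gd (BH HH) (rep P) (dcomm P) (rep_linear P) (rep1 P) (repM P) (dcomm_linear P)
  (dcommM P) (@implements _ _ _ HH) (implements0 HH) (@implements_linear _ _ _ HH)
  (@implementsM _ _ _ HH) (@implements_inj _ _ _ HH) (@implements_fun _ _ _ HH)
  rep_implements dcomm_implements).
Qed.

End ProductTriple.

(** From [d (u v) = 0] and [du = k u s] it follows that [dv = - k v s], because [s]
    commutes with [u] and [v]. Hence [u dv + v du = 0], while the junk
    [du dv + dv du] that this relation gives is the scalar [- 2 k^2]. *)
Lemma junk_one_of_unit (K : fieldType) (A B : algebra K) (r d : A -> B)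
    (k : K) (u v : A) (s : B) :
  linear r -> r (aone A) = aone B -> (forall a b, r (a ** b) = r a ** r b) ->
  linear d -> (forall a b, d (a ** b) = d a ** r b + r a ** d b) ->
  2%:R != 0 :> K -> k != 0 -> u ** v = aone A -> v ** u = aone A ->
  s ** s = aone B -> s ** r u = r u ** s -> s ** r v = r v ** s ->
  d u = k *: (r u ** s) -> junk_set r d (aone B).
Proof.
move=> rL r1 rM dL dM K2 k0 uv vu s2 su sv du.
have d1 : d (aone A) = 0.
  have := dM (aone A) (aone A); rewrite amul1 r1 amul1 amulr1 => /esym/eqP.
  by rewrite -subr_eq0 addrK => /eqP.
have dv : d v = - k *: (r v ** s).
  have : r v ** d (u ** v) = 0 by rewrite uv d1 amulr0.
  rewrite dM amulDr !amulA -!rM vu r1 amul1 => /eqP.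
  rewrite addrC addr_eq0 => /eqP ->.
  rewrite du amulZr amulZl scaleNr; congr (- (_ *: _)).
  by rewrite amulA -rM vu r1 amul1.
have -> : aone B = (- k * k * 2%:R)^-1 *: (d u ** d v + d v ** d u).
  have prod x y : x ** y = aone A -> s ** r y = r y ** s ->
      (r x ** s) ** (r y ** s) = aone B.
    move=> xy sy; have -> : r x ** s ** (r y ** s) = r x ** (s ** r y) ** s.
      by rewrite !amulA.
    by rewrite sy amulA -rM xy r1 amul1.
  rewrite du dv !(amulZl, amulZr) !scalerA (prod u v) // (prod v u) //.
  have e : k * - k + - k * k = - k * k * 2%:R by rewrite mulr_natr mulr2n [k * - k]mulrC.
  rewrite -scalerDl scalerA e.
  by rewrite mulVf ?scale1r // !mulf_neq0 // oppr_eq0.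
apply: (@subspaceZ _ _ (junk_subspace rL dL)).
exists [:: (u, v); (v, u)]; rewrite !big_cons !big_nil !addr0 /=; split=> //.
rewrite du dv !amulZr !amulA -!rM uv vu r1 !amul1.
by rewrite scaleNr addNr.
Qed.

(** * Amplified operators, even triples and Pauli matrices *)

Section Amplified.
Variables (C : numClosedFieldType) (H : hilbert C) (n : nat).

Lemma amp_opM (M N : 'M[C]_n) (S S' : BH H) :
  amp_op M S ** amp_op N S' = amp_op (M *m N) (S ** S').
Proof.
apply: BH_ext => x; apply/funext => k.
rewrite -[LHS]/(\sum_l M k l *: app S (\sum_m N l m *: app S' (x m))).
rewrite -[RHS]/(\sum_m (M *m N) k m *: app S (app S' (x m))).
transitivity (\sum_l \sum_m (M k l * N l m) *: app S (app S' (x m))).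
  apply: eq_bigr => l _; rewrite (linfun_sum (app_linear S)) scaler_sumr.
  by apply: eq_bigr => m _; rewrite (linfunZ (app_linear S)) scalerA.
rewrite exchange_big; apply: eq_bigr => m _; rewrite mxE scaler_suml.
exact: eq_bigr.
Qed.

Lemma amp_opN (M : 'M[C]_n) (S : BH H) : amp_op (- M) S = - amp_op M S.
Proof.
apply: BH_ext => x; apply/funext => k.
rewrite -[LHS]/(\sum_l (- M) k l *: app S (x l)).
rewrite -[RHS]/(- \sum_l M k l *: app S (x l)) -sumrN.
by apply: eq_bigr => l _; rewrite mxE scaleNr.
Qed.

Lemma amp_opZ (M : 'M[C]_n) (c : C) (S : BH H) :
  amp_op M (c *: S) = c *: amp_op M S.
Proof.
apply: BH_ext => x; apply/funext => k.
rewrite -[LHS]/(\sum_l M k l *: (c *: app S (x l))).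
rewrite -[RHS]/(c *: \sum_l M k l *: app S (x l)) scaler_sumr.
by apply: eq_bigr => l _; rewrite !scalerA mulrC.
Qed.

Lemma amp_op1E (S : BH H) (x : amp H n) :
  app (amp_op 1%:M S) x = (fun k => app S (x k)) :> amp H n.
Proof.
apply/funext => k; rewrite -[LHS]/(\sum_l (1%:M : 'M[C]_n) k l *: app S (x l)).
rewrite (bigD1 k) //= mxE eqxx scale1r big1 ?addr0 // => l lk.
by rewrite mxE eq_sym (negbTE lk) scale0r.
Qed.

Lemma amp_op1 : amp_op 1%:M (aone (BH H)) = aone (BH (amp H n)).
Proof. by apply: BH_ext => x; rewrite amp_op1E. Qed.

End Amplified.

Section EvenTriple.
Variables (C : numClosedFieldType) (A : algebra C) (H : hilbert C).
Variables (T : dirac_triple A H) (s : 'M[C]_2).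
Local Notation E := (even_triple T s).

Lemma even_dcomm a : dcomm E a = amp_op s (dcomm T a).
Proof.
apply: (BH_dense (dirac_dense E)) => x dx; rewrite dcommP // [RHS]/(app _ _).
have dx' k : dirac_dom T (x k) := dx k.
rewrite !(amp_op1E (rep T a)).
apply/funext => k.
rewrite -[RHS]/(\sum_l s k l *: app (dcomm T a) (x l)).
rewrite -[LHS]/(\sum_l s k l *: dirac T (app (rep T a) (x l))
  - app (rep T a) (\sum_l s k l *: dirac T (x l))).
rewrite (linfun_sum (app_linear (rep T a))) -sumrB; apply: eq_bigr => l _.
by rewrite (linfunZ (app_linear (rep T a))) dcommP // scalerBr.
Qed.

End EvenTriple.

Section Pauli.
Variable R : realType.
Local Notation C := (R[i]).

Lemma mx2_mul (a b c d a' b' c' d' : C) :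
  mx2 a b c d *m mx2 a' b' c' d'
    = mx2 (a * a' + b * c') (a * b' + b * d') (c * a' + d * c') (c * b' + d * d').
Proof.
apply/matrixP => k l; rewrite !mxE big_ord_recl big_ord1 !mxE.
by case: k => -[|[|//]] ?; case: l => -[|[|//]] ?.
Qed.

Lemma mx2N (a b c d : C) : - mx2 a b c d = mx2 (- a) (- b) (- c) (- d).
Proof.
apply/matrixP => k l; rewrite !mxE.
by case: k => -[|[|//]] ?; case: l => -[|[|//]] ?.
Qed.

Lemma mx2_1 : mx2 1 0 0 1 = 1%:M :> 'M[C]_2.
Proof.
apply/matrixP => k l; rewrite !mxE.
by case: k => -[|[|//]] ?; case: l => -[|[|//]] ?.
Qed.

Lemma mulii : 'i * 'i = -1 :> C.
Proof. by rewrite -expr2 sqrCi. Qed.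

Lemma sigma_sq (j : 'I_3) : sigma R j *m sigma R j = 1%:M.
Proof.
rewrite -mx2_1 /sigma; case: j => -[|[|[|//]]] ? /=; rewrite mx2_mul;
  congr mx2; rewrite ?complexiE ?mulrN ?mulNr ?mulii; ring.
Qed.

Lemma sigma_anti (j k : 'I_3) : j != k ->
  sigma R k *m sigma R j = - (sigma R j *m sigma R k).
Proof.
rewrite /sigma; case: j => -[|[|[|//]]] ?; case: k => -[|[|[|//]]] ? //= _;
  rewrite !mx2_mul mx2N; congr mx2; rewrite ?complexiE; ring.
Qed.

End Pauli.

Section QhmTriple.
Variables (R : realType) (c : nat) (hbar mu nu alpha : R).
Variable A : qhm_algebra c hbar mu nu.
Variable L : gns (@qconj R c hbar mu nu A) (@qtrace R c hbar mu nu A).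
Variable T : dirac_triple A (amp L 2).
Hypothesis qT : is_qhm_triple alpha T.

Lemma qhm_rep a : rep T a = amp_op 1%:M (gns_rep L a).
Proof.
apply: BH_ext => x; rewrite amp_op1E; apply/funext => k.
by case: qT => h _ _; exact: h.
Qed.

Lemma qhm_rep_inj : injective (gns_rep L) -> injective (rep T).
Proof.
move=> iL a b ab; apply: iL; apply: BH_ext => x.
have := congr1 (fun S : BH (amp L 2) => app S (fun=> x) ord0) ab.
by rewrite !qhm_rep !amp_op1E.
Qed.

(** On the core, the commutator retains the terms where [u] is differentiated; this
    happens for [delta_2] only, hence the single matrix [sigma_2]. *)
Lemma qhm_dcomm (u : A) (e : R[i]) :
  (forall m b, qder alpha m (u ** b)
     = u ** qder alpha m b + (if val m == 1%N then e *: (u ** b) else 0)) ->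
  dcomm T u = ('i%C * e) *: (rep T u ** amp_op (sigma R (lift ord0 ord0)) (aone (BH L))).
Proof.
move=> du; have [_ hdom hD] := qT.
rewrite qhm_rep amp_opM mul1mx amulr1.
apply: (BH_dense (dirac_dense T)) => x dx; rewrite dcommP //.
have : (dirac_dom T : set (amp L 2)) x by [].
rewrite hdom => -[v ->].
have lv := gns_linear L.
have repE w : app (rep T u) (fun k => gns_vec L (w k)) = (fun k => gns_vec L (u ** w k)).
  by rewrite qhm_rep amp_op1E; apply/funext => k; rewrite gns_repE.
rewrite repE !hD qhm_rep amp_op1E; apply/funext => k.
have lu := app_linear (gns_rep L u).
rewrite -[RHS]/(('i%C * e) *: \sum_l sigma R (lift ord0 ord0) k l *:
  app (gns_rep L u) (gns_vec L (v l))).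
rewrite -[LHS]/(\sum_m \sum_l ('i%C * sigma R m k l) *: gns_vec L (qder alpha m (u ** v l))
  - app (gns_rep L u) (\sum_m \sum_l ('i%C * sigma R m k l) *: gns_vec L (qder alpha m (v l)))).
rewrite (linfun_sum lu) -sumrB.
transitivity (\sum_(m < 3) \sum_(l < 2) ('i%C * sigma R m k l) *:
    (if val m == 1%N then e *: gns_vec L (u ** v l) else 0)).
  apply: eq_bigr => m _; rewrite (linfun_sum lu) -sumrB; apply: eq_bigr => l _.
  rewrite (linfunZ lu) gns_repE -scalerBr du (linfunD lv) addrAC subrr add0r.
  by case: ifP => _; rewrite ?(linfunZ lv) ?(linear_at0 lv).
rewrite (bigD1 (lift ord0 ord0)) //= [X in _ + X]big1 ?addr0 => [|m m1].
  rewrite scaler_sumr; apply: eq_bigr => l _.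
  by rewrite gns_repE !scalerA mulrAC.
apply: big1 => l _; case: eqP => [m1'|_]; last by rewrite scaler0.
by case/eqP: m1; exact: val_inj.
Qed.

End QhmTriple.

(** * Derivatives of complex functions of a real variable *)

Section ComplexCalculus.
Variable R : realType.
Local Notation C := (R[i]).
Local Open Scope complex_scope.
Implicit Types F G : R -> C.

Definition is_cderive F (t : R) (z : C) :=
  is_derive t 1 (fun s => complex.Re (F s)) (complex.Re z) /\
  is_derive t 1 (fun s => complex.Im (F s)) (complex.Im z).

Lemma is_cderiveP F t :
  derivable (fun s => complex.Re (F s)) t 1 ->
  derivable (fun s => complex.Im (F s)) t 1 ->
  is_cderive F t (derive1 (fun s => complex.Re (F s)) t
                  +i* derive1 (fun s => complex.Im (F s)) t).
Proof. by move=> dr di; split; rewrite /= derive1E; exact: derivableP. Qed.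

Lemma is_cderive_val F t z : is_cderive F t z ->
  derive1 (fun s => complex.Re (F s)) t +i* derive1 (fun s => complex.Im (F s)) t = z.
Proof.
by move=> [dr di]; rewrite !derive1E !derive_val; case: z {dr di}.
Qed.

Lemma is_cderive_cst (a : C) t : is_cderive (fun=> a) t 0.
Proof. by split; exact: is_derive_cst. Qed.

Lemma is_cderiveM F G t z w : is_cderive F t z -> is_cderive G t w ->
  is_cderive (fun s => F s * G s) t (z * G t + F t * w).
Proof.
move=> [Fr Fi] [Gr Gi]; split.
  have -> : (fun s => complex.Re (F s * G s)) =
      (fun s => complex.Re (F s)) * (fun s => complex.Re (G s))
      - (fun s => complex.Im (F s)) * (fun s => complex.Im (G s)).
    by apply/funext => s; rewrite !fctE; case: (F s) => ? ?; case: (G s).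
  apply: (is_derive_eq (is_deriveB (is_deriveM Fr Gr) (is_deriveM Fi Gi))).
  case: (F t) => a b; case: (G t) => a' b'; case: z {Fr Fi} => x y.
  case: w {Gr Gi} => x' y' /=; rewrite /GRing.scale /=; ring.
have -> : (fun s => complex.Im (F s * G s)) =
    (fun s => complex.Re (F s)) * (fun s => complex.Im (G s))
    + (fun s => complex.Im (F s)) * (fun s => complex.Re (G s)).
  by apply/funext => s; rewrite !fctE; case: (F s) => ? ?; case: (G s).
apply: (is_derive_eq (is_deriveD (is_deriveM Fr Gi) (is_deriveM Fi Gr))).
case: (F t) => a b; case: (G t) => a' b'; case: z {Fr Fi} => x y.
case: w {Gr Gi} => x' y' /=; rewrite /GRing.scale /=; ring.
Qed.

Lemma is_cderiveD F G t z w : is_cderive F t z -> is_cderive G t w ->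
  is_cderive (fun s => F s + G s) t (z + w).
Proof.
move=> [Fr Fi] [Gr Gi]; split.
  have -> : (fun s => complex.Re (F s + G s)) =
      (fun s => complex.Re (F s)) + (fun s => complex.Re (G s)).
    by apply/funext => s; rewrite !fctE; case: (F s) => ? ?; case: (G s).
  by apply: (is_derive_eq (is_deriveD Fr Gr)); case: z {Fr Fi}; case: w {Gr Gi}.
have -> : (fun s => complex.Im (F s + G s)) =
    (fun s => complex.Im (F s)) + (fun s => complex.Im (G s)).
  by apply/funext => s; rewrite !fctE; case: (F s) => ? ?; case: (G s).
by apply: (is_derive_eq (is_deriveD Fi Gi)); case: z {Fr Fi}; case: w {Gr Gi}.
Qed.

Lemma is_cderive_id t : is_cderive (fun s => s%:C) t 1.
Proof. by split; [exact: is_derive_id|exact: is_derive_cst]. Qed.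

Lemma expiD (x y : R) : expi (x + y) = expi x * expi y.
Proof.
rewrite /expi mulrDr cosD sinD; simpc; congr (_ +i* _).
by rewrite addrC [sin _ * _]mulrC [X in _ + X]mulrC addrC.
Qed.

Lemma expi0 : expi 0 = 1 :> C.
Proof. by rewrite /expi mulr0 cos0 sin0. Qed.

Lemma is_cderive_expi (a b t : R) :
  is_cderive (fun s => expi (a * s + b)) t
    (2 * pi%:C * 'i%C * a%:C * expi (a * t + b)).
Proof.
have dl : is_derive t 1 (fun s : R => 2 * pi * (a * s + b)) (2 * pi * a).
  have -> : (fun s : R => 2 * pi * (a * s + b)) = (2 * pi * a) *: id + cst (2 * pi * b).
    by apply/funext => s; rewrite !fctE /GRing.scale /= mulrDr mulrA.
  by apply: is_derive_eq; rewrite addr0 /GRing.scale /= mulr1.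
pose l (s : R) := 2 * pi * (a * s + b).
have dc := @is_derive1_comp _ cos l t _ _ (is_derive_cos (l t)) dl.
have ds := @is_derive1_comp _ sin l t _ _ (is_derive_sin (l t)) dl.
have -> : 2 * pi%:C * 'i%C * a%:C * expi (a * t + b) =
    (- sin (2 * pi * (a * t + b)) * (2 * pi * a)) +i*
    (cos (2 * pi * (a * t + b)) * (2 * pi * a)).
  rewrite /expi (_ : 2 = 2%:C) ?rmorph_nat //.
  by simpc; congr (_ +i* _); ring.
by split.
Qed.

End ComplexCalculus.

(** * Smooth functions on R x R x Z *)

Section Smoothness.
Variable R : realType.
Local Notation C := (R[i]).
Local Open Scope complex_scope.
Implicit Types f g h : qfunction R.

Definition regular f := forall x y p,
  [/\ derivable (fun t => complex.Re (f t y p)) x 1,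
      derivable (fun t => complex.Im (f t y p)) x 1,
      derivable (fun t => complex.Re (f x t p)) y 1 &
      derivable (fun t => complex.Im (f x t p)) y 1] /\
  ({for (x, y), continuous (fun z : R * R => complex.Re (f z.1 z.2 p))} /\
   {for (x, y), continuous (fun z : R * R => complex.Im (f z.1 z.2 p))}).

Lemma regular_intro f f1 f2 :
  (forall x y p, is_cderive (fun t => f t y p) x (f1 x y p)) ->
  (forall x y p, is_cderive (fun t => f x t p) y (f2 x y p)) ->
  (forall p, continuous (fun z : R * R => complex.Re (f z.1 z.2 p))) ->
  (forall p, continuous (fun z : R * R => complex.Im (f z.1 z.2 p))) ->
  [/\ regular f, dX f = f1 & dY f = f2].
Proof.
move=> h1 h2 cr ci; split.
- move=> x y p; have [[d1 _] [d2 _]] := h1 x y p; have [[d3 _] [d4 _]] := h2 x y p.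
  exact: (conj (And4 d1 d2 d3 d4) (conj (cr p (x, y)) (ci p (x, y)))).
- by apply/funext => x; apply/funext => y; apply/funext => p; exact: is_cderive_val.
- by apply/funext => x; apply/funext => y; apply/funext => p; exact: is_cderive_val.
Qed.

Lemma is_cderive_dX f x y p : regular f ->
  is_cderive (fun t => f t y p) x (dX f x y p).
Proof. by move=> /(_ x y p)[[dr di _ _] _]; exact: is_cderiveP. Qed.

Lemma is_cderive_dY f x y p : regular f ->
  is_cderive (fun t => f x t p) y (dY f x y p).
Proof. by move=> /(_ x y p)[[_ _ dr di] _]; exact: is_cderiveP. Qed.

Lemma regular_re f p : regular f ->
  continuous (fun z : R * R => complex.Re (f z.1 z.2 p)).
Proof. by move=> rf [x y]; have [_ []] := rf x y p. Qed.

Lemma regular_im f p : regular f ->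
  continuous (fun z : R * R => complex.Im (f z.1 z.2 p)).
Proof. by move=> rf [x y]; have [_ []] := rf x y p. Qed.

Definition qmul f g : qfunction R := fun x y p => f x y p * g x y p.
Definition qadd f g : qfunction R := fun x y p => f x y p + g x y p.

Lemma regularM f g : regular f -> regular g ->
  [/\ regular (qmul f g), dX (qmul f g) = qadd (qmul (dX f) g) (qmul f (dX g)) &
      dY (qmul f g) = qadd (qmul (dY f) g) (qmul f (dY g))].
Proof.
move=> rf rg; apply: regular_intro => [x y p|x y p|p|p].
- exact: is_cderiveM (is_cderive_dX _ _ _ rf) (is_cderive_dX _ _ _ rg).
- exact: is_cderiveM (is_cderive_dY _ _ _ rf) (is_cderive_dY _ _ _ rg).
- have -> : (fun z : R * R => complex.Re (qmul f g z.1 z.2 p)) =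
      (fun z => complex.Re (f z.1 z.2 p) * complex.Re (g z.1 z.2 p)
        - complex.Im (f z.1 z.2 p) * complex.Im (g z.1 z.2 p)).
    apply/funext => z; rewrite /qmul.
    by case: (f _ _ _) => ? ?; case: (g _ _ _).
  by move=> z; apply: cvgB; apply: cvgM;
    (exact: regular_re || exact: regular_im).
have -> : (fun z : R * R => complex.Im (qmul f g z.1 z.2 p)) =
    (fun z => complex.Re (f z.1 z.2 p) * complex.Im (g z.1 z.2 p)
      + complex.Im (f z.1 z.2 p) * complex.Re (g z.1 z.2 p)).
  apply/funext => z; rewrite /qmul.
  by case: (f _ _ _) => ? ?; case: (g _ _ _).
by move=> z; apply: cvgD; apply: cvgM;
  (exact: regular_re || exact: regular_im).
Qed.

Lemma regularD f g : regular f -> regular g ->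
  [/\ regular (qadd f g), dX (qadd f g) = qadd (dX f) (dX g) &
      dY (qadd f g) = qadd (dY f) (dY g)].
Proof.
move=> rf rg; apply: regular_intro => [x y p|x y p|p|p].
- exact: is_cderiveD (is_cderive_dX _ _ _ rf) (is_cderive_dX _ _ _ rg).
- exact: is_cderiveD (is_cderive_dY _ _ _ rf) (is_cderive_dY _ _ _ rg).
- have -> : (fun z : R * R => complex.Re (qadd f g z.1 z.2 p)) =
      (fun z => complex.Re (f z.1 z.2 p) + complex.Re (g z.1 z.2 p)).
    apply/funext => z; rewrite /qadd.
    by case: (f _ _ _) => ? ?; case: (g _ _ _).
  by move=> z; apply: cvgD; exact: regular_re.
have -> : (fun z : R * R => complex.Im (qadd f g z.1 z.2 p)) =
    (fun z => complex.Im (f z.1 z.2 p) + complex.Im (g z.1 z.2 p)).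
  apply/funext => z; rewrite /qadd.
  by case: (f _ _ _) => ? ?; case: (g _ _ _).
by move=> z; apply: cvgD; exact: regular_im.
Qed.

(** Smoothness quantifies over all words in the two derivatives; a class of functions
    that is stable under both of them spares the induction on words. *)
Lemma smooth_coind (S : set (qfunction R)) :
  (forall f, S f -> [/\ regular f, S (dX f) & S (dY f)]) ->
  forall f, S f -> smooth_fun f.
Proof.
move=> Sd f Sf w; suff : S (foldr (fun b : bool => if b then dX (R := R) else dY (R := R)) f w).
  by move=> /Sd[].
by elim: w => //= b w /Sd[_ SX SY]; case: b.
Qed.

Lemma smooth_regular f : smooth_fun f -> regular f.
Proof. by move=> sf; exact: (sf [::]). Qed.

Lemma smooth_dX f : smooth_fun f -> smooth_fun (dX f).
Proof. by move=> sf w; have := sf (rcons w true); rewrite foldr_rcons. Qed.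

Lemma smooth_dY f : smooth_fun f -> smooth_fun (dY f).
Proof. by move=> sf w; have := sf (rcons w false); rewrite foldr_rcons. Qed.

Lemma smooth_iter f m n : smooth_fun f -> smooth_fun (iter m (@dX R) (iter n (@dY R) f)).
Proof.
move=> sf; have : smooth_fun (iter n (@dY R) f).
  by elim: n => //= n; exact: smooth_dY.
by elim: m => //= m IH /IH; exact: smooth_dX.
Qed.

(** The least class that contains the products of smooth functions and is closed
    under addition is stable under both derivatives by the Leibniz rule. *)
Inductive sum_of_products : set (qfunction R) :=
| sop_mul f g : smooth_fun f -> smooth_fun g -> sum_of_products (qmul f g)
| sop_add f g : sum_of_products f -> sum_of_products g ->
    sum_of_products (qadd f g).

Lemma sum_of_products_smooth f : sum_of_products f -> smooth_fun f.
Proof.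
move: f; apply: smooth_coind => f; elim=> {f} [f g sf sg|f g _ [rf fX fY] _ [rg gX gY]].
  have [r -> ->] := regularM (smooth_regular sf) (smooth_regular sg).
  split; first exact: r.
    exact: (sop_add (sop_mul (smooth_dX sf) sg) (sop_mul sf (smooth_dX sg))).
  exact: (sop_add (sop_mul (smooth_dY sf) sg) (sop_mul sf (smooth_dY sg))).
have [r -> ->] := regularD rf rg.
exact: (And3 r (sop_add fX gX) (sop_add fY gY)).
Qed.

Lemma smoothM f g : smooth_fun f -> smooth_fun g -> smooth_fun (qmul f g).
Proof. by move=> sf sg; apply: sum_of_products_smooth; exact: sop_mul. Qed.

Definition qcst (a : int -> C) : qfunction R := fun _ _ p => a p.

Lemma regular_cst a : [/\ regular (qcst a), dX (qcst a) = qcst (fun=> 0) &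
  dY (qcst a) = qcst (fun=> 0)].
Proof.
by apply: regular_intro => [x y p|x y p|p|p]; [exact: is_cderive_cst|exact: is_cderive_cst| |];
  move=> z; exact: cvg_cst.
Qed.

Lemma smooth_cst a : smooth_fun (qcst a).
Proof.
apply: (@smooth_coind [set f | exists a, f = qcst a]); last by exists a.
move=> _ [b ->]; have [r -> ->] := regular_cst b.
by split; [exact: r|exists (fun=> 0)|exists (fun=> 0)].
Qed.

Lemma smoothD f g : smooth_fun f -> smooth_fun g -> smooth_fun (qadd f g).
Proof.
move=> sf sg; have one h : h = qmul h (qcst (fun=> 1)).
  by apply/funext => x; apply/funext => y; apply/funext => p; rewrite /qmul mulr1.
rewrite (one f) (one g); apply: sum_of_products_smooth.
by apply: sop_add; apply: sop_mul => //; exact: smooth_cst.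
Qed.

Definition qx : qfunction R := fun x _ _ => x%:C.

Lemma regular_x : [/\ regular qx, dX qx = qcst (fun=> 1) & dY qx = qcst (fun=> 0)].
Proof.
apply: regular_intro => [x y p|x y p|p|p].
- exact: is_cderive_id.
- exact: is_cderive_cst.
- by move=> z; exact: cvg_fst.
- by move=> z; exact: cvg_cst.
Qed.

Lemma smooth_x : smooth_fun qx.
Proof.
apply: (@smooth_coind [set f | f = qx \/ exists a, f = qcst a]); last by left.
move=> _ [->|[a ->]].
  have [r -> ->] := regular_x.
  by split; [exact: r|right; exists (fun=> 1)|right; exists (fun=> 0)].
have [r -> ->] := regular_cst a.
by split; [exact: r|right; exists (fun=> 0)|right; exists (fun=> 0)].
Qed.

(** A Fourier mode in [y]; it is the form taken both by the unit and by the phase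
    that multiplication by the unit amounts to. *)
Definition qmode (s : R) (a : int -> C) : qfunction R :=
  fun _ y p => a p * expi (s * y).

Lemma is_cderive_mode (a : C) (s t : R) :
  is_cderive (fun y => a * expi (s * y)) t (2 * pi%:C * 'i%C * s%:C * a * expi (s * t)).
Proof.
have de : is_cderive (fun t => expi (s * t)) t
    (2 * pi%:C * 'i%C * s%:C * expi (s * t)).
  have := is_cderive_expi s 0 t; rewrite addr0.
  by congr is_cderive; apply/funext => u; rewrite addr0.
have := is_cderiveM (is_cderive_cst a t) de.
by congr is_cderive; rewrite mul0r add0r; ring.
Qed.

Lemma regular_mode s a : [/\ regular (qmode s a), dX (qmode s a) = qcst (fun=> 0) &
  dY (qmode s a) = qmode s (fun p => 2 * pi%:C * 'i%C * s%:C * a p)].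
Proof.
have cont (F : R -> R) (dF : R -> R) : (forall t : R, is_derive t (1 : R) F (dF t)) ->
    continuous (fun z : R * R => F z.2).
  move=> hF z; apply: (@continuous_comp _ _ _ snd F z); first exact: cvg_snd.
  by apply: differentiable_continuous; apply/derivable1_diffP; case: (hF z.2).
apply: regular_intro => [x y p|x y p|p|p].
- exact: is_cderive_cst.
- exact: is_cderive_mode.
- exact: cont (fun t => (is_cderive_mode (a p) s t).1).
exact: cont (fun t => (is_cderive_mode (a p) s t).2).
Qed.

Lemma smooth_mode s a : smooth_fun (qmode s a).
Proof.
apply: (@smooth_coind [set f | exists s a, f = qmode s a]); last by exists s, a.
have zero : qcst (fun=> 0) = qmode 0 (fun=> 0).
  by apply/funext => x; apply/funext => y; apply/funext => p; rewrite /qmode mul0r.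
move=> _ [t [b ->]]; have [r -> ->] := regular_mode t b; split; first exact: r.
  by exists 0, (fun=> 0).
by eexists; eexists.
Qed.

Lemma is_cderive_shift (F : R -> C) (a t : R) z :
  is_cderive F (t + a) z -> is_cderive (fun s => F (s + a)) t z.
Proof.
have ds : is_derive t 1 (fun s : R => s + a) 1.
  by apply: is_derive_eq (is_deriveD (is_derive_id t 1) (is_derive_cst a t 1)) _; rewrite addr0.
move=> [dr di]; split.
  by have := is_derive1_comp (g := fun s => s + a) dr ds; rewrite mulr1.
by have := is_derive1_comp (g := fun s => s + a) di ds; rewrite mulr1.
Qed.

Lemma is_cderive_uniq (F : R -> C) t z w :
  is_cderive F t z -> is_cderive F t w -> z = w.
Proof. by move=> /is_cderive_val <- /is_cderive_val <-. Qed.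

Lemma normc_real (z : C) : exists M : R, `|z| = M%:C.
Proof. by rewrite normc_def; eexists. Qed.

Lemma norm_expi (x : R) : `|expi x| = 1 :> C.
Proof. by rewrite normc_def /expi /= cos2Dsin2 sqrtr1. Qed.

Definition bounded_over (K : set (R * R)) g :=
  exists M : R, forall z p, K z -> `|g z.1 z.2 p| <= M%:C.

Lemma bounded_overD K f g : bounded_over K f -> bounded_over K g ->
  bounded_over K (qadd f g).
Proof.
move=> [M hM] [N hN]; exists (M + N) => z p Kz; rewrite rmorphD.
by apply: (le_trans (ler_normD _ _)); apply: lerD; [exact: hM|exact: hN].
Qed.

Lemma bounded_overM K f g : bounded_over K f -> bounded_over K g ->
  bounded_over K (qmul f g).
Proof.
move=> [M hM] [N hN]; exists (M * N) => z p Kz; rewrite rmorphM normrM.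
by apply: ler_pM => //; [exact: hM|exact: hN].
Qed.

Lemma bounded_over_cst K (a : C) : bounded_over K (qcst (fun=> a)).
Proof. by have [M hM] := normc_real a; exists M => z p _; rewrite /qcst hM. Qed.

Lemma bounded_over_x K : compact K -> bounded_over K qx.
Proof.
move=> cK; have := @compact_bounded _ _ (fst @` K) _.
have cf : compact (fst @` K).
  apply: continuous_compact => //.
  by apply: continuous_subspaceT => z; exact: cvg_fst.
move=> /(_ cf) [M [_ hM]]; exists (M + 1) => z p Kz.
rewrite normc_def /= expr0n addr0 sqrtr_sqr lecR.
by apply: hM; [rewrite ltrDl|exists z].
Qed.

End Smoothness.

(** * Sums over Z, and membership in S^c *)

Section SumZ.
Variable R : realType.
Local Notation C := (R[i]).
Local Open Scope complex_scope.

Lemma limn_single (a : int -> R) (q0 : int) : (forall q, q != q0 -> a q = 0) ->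
  limn (fun n : nat => \sum_(0 <= j < n.*2.+1) a (j%:Z - n%:Z)) = a q0.
Proof.
move=> a0; apply: lim_near_cst => //; exists `|q0|%N => // n /= q0n.
have nq : 0 <= q0 + n%:Z by lia.
pose j0 := absz (q0 + n%:Z).
have j0E : j0%:Z = q0 + n%:Z by rewrite /j0; lia.
have j0n : (j0 < n.*2.+1)%N by rewrite -addnn /j0; lia.
rewrite big_mkord (bigD1 (Ordinal j0n)) //= j0E addrK big1 ?addr0 // => j jj0.
apply: a0; apply: contra jj0 => /eqP e; apply/eqP/val_inj => /=.
by apply/eqP; rewrite -eqz_nat j0E -e subrK.
Qed.

Lemma sumZ_single (a : int -> C) (q0 : int) : (forall q, q != q0 -> a q = 0) ->
  sumZ a = a q0.
Proof.
move=> a0; rewrite /sumZ.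
rewrite (@limn_single (fun q => complex.Re (a q)) q0) => [|q qq]; last by rewrite a0.
rewrite (@limn_single (fun q => complex.Im (a q)) q0) => [|q qq]; last by rewrite a0.
by case: (a q0).
Qed.

End SumZ.

Section SchwartzSections.
Variables (R : realType) (c : nat).
Local Notation C := (R[i]).
Local Open Scope complex_scope.
Implicit Types f g : qfunction R.

Lemma qmul_cst0 g : qmul (qcst (fun=> 0)) g = qcst (fun=> 0).
Proof.
by apply/funext => x; apply/funext => y; apply/funext => p; rewrite /qmul /qcst mul0r.
Qed.

Lemma qadd0f g : qadd (qcst (fun=> 0)) g = g.
Proof.
by apply/funext => x; apply/funext => y; apply/funext => p; rewrite /qadd /qcst add0r.
Qed.

Lemma qaddf0 g : qadd g (qcst (fun=> 0)) = g.
Proof.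
by apply/funext => x; apply/funext => y; apply/funext => p; rewrite /qadd /qcst addr0.
Qed.

Lemma dX_mul g f : regular g -> dX g = qcst (fun=> 0) -> smooth_fun f ->
  dX (qmul g f) = qmul g (dX f).
Proof.
move=> rg g0 sf; have [_ -> _] := regularM rg (smooth_regular sf).
by rewrite g0 qmul_cst0 qadd0f.
Qed.

Lemma dY_mul g f : regular g -> dY g = qcst (fun=> 0) -> smooth_fun f ->
  dY (qmul g f) = qmul g (dY f).
Proof.
move=> rg g0 sf; have [_ _ ->] := regularM rg (smooth_regular sf).
by rewrite g0 qmul_cst0 qadd0f.
Qed.

Lemma iter_dX_mul m g f : regular g -> dX g = qcst (fun=> 0) -> smooth_fun f ->
  iter m (@dX R) (qmul g f) = qmul g (iter m (@dX R) f).
Proof.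
move=> rg g0 sf; elim: m => //= m ->; apply: dX_mul => //.
exact: (smooth_iter m 0 sf).
Qed.

Lemma iter_dY_mul m g f : regular g -> dY g = qcst (fun=> 0) -> smooth_fun f ->
  iter m (@dY R) (qmul g f) = qmul g (iter m (@dY R) f).
Proof.
move=> rg g0 sf; elim: m => //= m ->; apply: dY_mul => //.
exact: (smooth_iter 0 m sf).
Qed.

Lemma iter_dX_add m f g : smooth_fun f -> smooth_fun g ->
  iter m (@dX R) (qadd f g) = qadd (iter m (@dX R) f) (iter m (@dX R) g).
Proof.
move=> sf sg; elim: m => //= m ->.
have rf := smooth_regular (smooth_iter m 0 sf).
have rg := smooth_regular (smooth_iter m 0 sg).
by have [_ -> _] := regularD rf rg.
Qed.

Lemma iter_dY_add m f g : smooth_fun f -> smooth_fun g ->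
  iter m (@dY R) (qadd f g) = qadd (iter m (@dY R) f) (iter m (@dY R) g).
Proof.
move=> sf sg; elim: m => //= m ->.
have rf := smooth_regular (smooth_iter 0 m sf).
have rg := smooth_regular (smooth_iter 0 m sg).
by have [_ _ ->] := regularD rf rg.
Qed.

Lemma iter_cst a m n f : smooth_fun f ->
  iter m (@dX R) (iter n (@dY R) (qmul (qcst a) f))
    = qmul (qcst a) (iter m (@dX R) (iter n (@dY R) f)).
Proof.
move=> sf; have [r rX rY] := regular_cst a.
by rewrite iter_dY_mul // iter_dX_mul //; exact: (smooth_iter 0 n sf).
Qed.

Lemma iter_dX_xmul m g : smooth_fun g ->
  iter m (@dX R) (qmul (@qx R) g) =
    qadd (qmul (@qx R) (iter m (@dX R) g))
         (qmul (qcst (fun=> m%:R)) (iter m.-1 (@dX R) g)).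
Proof.
move=> sg; elim: m => [|m IH] /=.
  by rewrite qmul_cst0 qaddf0.
rewrite IH.
have sm k : smooth_fun (iter k (@dX R) g) := smooth_iter k 0 sg.
have [rx xX _] := regular_x R; have [rc cX _] := regular_cst (fun=> m%:R : C).
have [r1 e1 _] := regularM rx (smooth_regular (sm m)).
have [r2 e2 _] := regularM rc (smooth_regular (sm m.-1)).
have [_ -> _] := regularD r1 r2.
rewrite e1 e2 xX cX qmul_cst0 qadd0f.
apply/funext => x; apply/funext => y; apply/funext => p.
rewrite /qadd /qmul /qcst mul1r -natr1 mulrDl mul1r.
case: m {IH sm rc cX r1 e1 r2 e2} => [|m] /=; first by rewrite !mul0r add0r addr0 addrC.
by rewrite [X in X + _]addrC -addrA; congr (_ + _); rewrite addrC.
Qed.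

Lemma Sc_smooth f : Sc c f -> smooth_fun f.
Proof. by case. Qed.

Lemma Sc_mode (s : R) : expi s = 1 -> Sc c (qmode s (fun p => (p == 0)%:R)).
Proof.
move=> s1; split.
- by move=> x y p; rewrite /qmode mulrDr mulr1 expiD s1 mulr1.
- exact: smooth_mode.
- move=> k x y p; rewrite /qmode; have [->|_] := eqVneq p 0; last by rewrite !mul0r mulr0.
  by rewrite mulr0 mul0r expi0 mul1r.
move=> P m n K _; pose k := 2 * pi%:C * 'i%C * s%:C : C.
have -> : iter n (@dY R) (qmode s (fun p => (p == 0)%:R))
    = qmode s (fun p => k ^+ n * (p == 0)%:R).
  elim: n => [|n IH] /=; first by congr qmode; apply/funext => p; rewrite mul1r.
  rewrite IH; have [_ _ ->] := regular_mode s (fun p => k ^+ n * (p == 0)%:R).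
  by congr qmode; apply/funext => p; rewrite -/k mulrA exprS.
have [a ->] : exists a : C, iter m (@dX R) (qmode s (fun p => k ^+ n * (p == 0)%:R))
    = qmode s (fun p => a * (p == 0)%:R).
  case: m => [|m]; first by exists (k ^+ n).
  exists 0; rewrite iterSr.
  have [_ -> _] := regular_mode s (fun p => k ^+ n * (p == 0)%:R).
  have -> : iter m (@dX R) (qcst (fun=> 0)) = qcst (fun=> 0).
    by elim: m => //= m ->; have [_ -> _] := regular_cst (fun=> 0 : C).
  by apply/funext => x; apply/funext => y; apply/funext => p; rewrite /qmode !mul0r.
have [M hM] := normc_real (P.[0] * a); exists M => z p _.
rewrite -hM /qmode; have [->|_] := eqVneq p 0; last by rewrite mulr0 mul0r mulr0 normr0.
by rewrite mulr1 mulrA normrM norm_expi mulr1.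
Qed.

Lemma Sc_cut f (p0 : int) : Sc c f -> Sc c (qmul (qcst (fun p => (p == p0)%:R)) f).
Proof.
move=> [f1 sf fk fb]; split.
- by move=> x y p; rewrite /qmul f1.
- exact: smoothM (smooth_cst _) sf.
- by move=> k x y p; rewrite /qmul /qcst fk mulrCA.
move=> P m n K cK; have [M hM] := fb P m n K cK; exists M => z p Kz.
rewrite iter_cst // /qmul /qcst.
case: (p == p0); first by rewrite mul1r; exact: hM.
by rewrite mul0r mulr0 normr0; apply: (le_trans _ (hM z p Kz)).
Qed.

(** The derivative in [y] of the factor of quasi-periodicity is compensated by the
    shift of [x] in the first term of [delta_2]. The factor [p] of that term is
    absorbed by the polynomials in the condition of decay. *)
Lemma Sc_delta2 (alpha : R) f : Sc c f ->
  Sc c (qdelta c alpha (lift ord0 ord0) f).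
Proof.
move=> [f1 sf fk fb]; pose k : C := 2 * pi%:C * 'i * c%:R.
have -> : qdelta c alpha (lift ord0 ord0) f =
    qadd (qmul (qcst (fun p => k * p%:~R)) (qmul (@qx R) f))
         (qmul (qcst (fun=> -1)) (dY f)).
  apply/funext => x; apply/funext => y; apply/funext => p.
  by rewrite /qdelta /qadd /qmul /qcst /qx /= mulN1r !mulrA.
have rf := smooth_regular sf.
have sxf : smooth_fun (qmul (@qx R) f) := smoothM (smooth_x (R := R)) sf.
have sY := smooth_dY sf.
split.
- move=> x y p; rewrite /qadd /qmul f1; congr (_ + _ * _).
  apply: (is_cderive_uniq (F := fun t => f x t p) _ (is_cderive_dY x y p rf)).
  have := is_cderive_shift (is_cderive_dY x (y + 1) p rf).
  by congr is_cderive; apply/funext => t; rewrite f1.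
- by apply: smoothD; apply: smoothM => //; exact: smooth_cst.
- move=> l x y p; pose a : R := c%:R * l%:~R * p%:~R.
  have e : dY f (x + l%:~R) y p =
      2 * pi%:C * 'i%C * a%:C * expi (a * y) * f x y p + expi (a * y) * dY f x y p.
    apply: (is_cderive_uniq (is_cderive_dY (x + l%:~R) y p rf)).
    have h := is_cderiveM (is_cderive_mode 1 a y) (is_cderive_dY x y p rf).
    have -> : (fun t => f (x + l%:~R) t p) = (fun t => 1 * expi (a * t) * f x t p).
      by apply/funext => t; rewrite fk mul1r.
    by move: h; congr is_cderive; rewrite mul1r mulr1.
  rewrite /qadd /qmul /qcst /qx e fk complexiE /k -/a.
  have -> : a%:C = c%:R * l%:~R * p%:~R :> C by rewrite !rmorphM rmorph_nat !rmorph_int.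
  have -> : (x + l%:~R)%:C = x%:C + l%:~R :> C by rewrite rmorphD rmorph_int.
  by ring.
move=> P m n K cK.
have [rx _ xY] := regular_x R.
set F := iter n (@dY R) f; have sF : smooth_fun F := smooth_iter 0 n sf.
have -> : iter m (@dX R) (iter n (@dY R) (qadd
    (qmul (qcst (fun p => k * p%:~R)) (qmul (@qx R) f))
    (qmul (qcst (fun=> -1)) (dY f)))) =
  qadd (qmul (qcst (fun p => k * p%:~R)) (qadd (qmul (@qx R) (iter m (@dX R) F))
         (qmul (qcst (fun=> m%:R)) (iter m.-1 (@dX R) F))))
       (qmul (qcst (fun=> -1)) (iter m (@dX R) (dY F))).
  rewrite iter_dY_add; [|exact: smoothM (smooth_cst _) sxf|exact: smoothM (smooth_cst _) sY].
  rewrite iter_dX_add; last 2 first.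
  - exact: (smooth_iter 0 n (smoothM (smooth_cst _) sxf)).
  - exact: (smooth_iter 0 n (smoothM (smooth_cst _) sY)).
  rewrite !iter_cst // iter_dY_mul // iter_dX_xmul // -/F.
  by rewrite -iterSr.
have B q i l : bounded_over K (qmul (qcst (fun p => q.[p%:~R]))
    (iter i (@dX R) (iter l (@dY R) f))) := fb q i l K cK.
have [M hM] := bounded_overD (bounded_overM (bounded_over_cst K k)
    (bounded_overD (bounded_overM (bounded_over_x cK) (B (P * 'X) m n))
      (bounded_overM (bounded_over_cst K m%:R) (B (P * 'X) m.-1 n))))
  (bounded_overM (bounded_over_cst K (-1)) (B P m n.+1)).
exists M => z p Kz; apply: le_trans (hM z p Kz); rewrite le_eqVlt; apply/orP; left.
apply/eqP; congr (`| _ |); rewrite /qadd /qmul /qcst /qx hornerM hornerX /=.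
by ring.
Qed.

End SchwartzSections.

(** * The unit e(y) *)

Section PlaneWaves.
Variables (R : realType) (c : nat) (hbar mu nu alpha : R).
Variable A : qhm_algebra c hbar mu nu.
Local Notation C := (R[i]).
Local Open Scope complex_scope.

Lemma qfun_surj f : Sc c f -> exists a : A, qfun a = f.
Proof. by rewrite -(qfun_range A) => -[a _ <-]; exists a. Qed.

Lemma qfun_Sc (a : A) : Sc c (qfun a).
Proof. by rewrite -(qfun_range A); exists a. Qed.

Definition plane_wave s : qfunction R := qmode s (fun p => (p == 0)%:R).

(** Only the summand at 0 of the product with a plane wave is not zero: the
    product multiplies by [e(s(y + hbar p nu))]. *)
Lemma plane_waveM s (u b : A) : qfun u = plane_wave s ->
  qfun (u ** b) = qmul (qmode s (fun p => expi (s * (hbar * p%:~R * nu)))) (qfun b).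
Proof.
move=> eu; rewrite qfunM eu; apply/funext => x; apply/funext => y; apply/funext => p.
rewrite /qstar (@sumZ_single _ _ 0) => [|q q0]; last first.
  by rewrite /plane_wave /qmode (negbTE q0) !mul0r.
rewrite /plane_wave /qmode eqxx mul1r /qmul !mulr0z mulr0 !mul0r !subr0 -expiD.
by rewrite sub0r mulrNz mulrN mulNr opprK mulrDr addrC.
Qed.

Lemma qdelta_mode s w m f : smooth_fun f ->
  qdelta c alpha m (qmul (qmode s w) f) =
    qadd (qmul (qmode s w) (qdelta c alpha m f))
      (qmul (qcst (fun=> if val m == 1%N then - (2 * pi%:C * 'i * s%:C) else 0))
        (qmul (qmode s w) f)).
Proof.
move=> sf; have [rE eX eY] := regular_mode s w.
have [_ hX hY] := regularM rE (smooth_regular sf).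
apply/funext => x; apply/funext => y; apply/funext => p.
rewrite /qdelta hX hY eX eY; case: m => -[|[|[|//]]] lm /=;
  by rewrite /qadd /qmul /qcst /qmode ?complexiE; ring.
Qed.

Lemma qderP (m : 'I_3) (a b : A) : qfun b = qdelta c alpha m (qfun a) ->
  qder alpha m a = b.
Proof.
move=> e; apply: (@qfun_inj _ _ _ _ _ A); rewrite e.
exact: (xgetPex 0 (ex_intro (fun b : A => qfun b = qdelta c alpha m (qfun a)) b e)).
Qed.

Lemma plane_waveK s (u v b : A) : qfun u = plane_wave s ->
  qfun v = plane_wave (- s) -> u ** (v ** b) = b.
Proof.
move=> eu ev; apply: (@qfun_inj _ _ _ _ _ A).
rewrite (plane_waveM _ eu) (plane_waveM _ ev).
apply/funext => x; apply/funext => y; apply/funext => p.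
rewrite /qmul /qmode mulrA -[RHS]mul1r; congr (_ * _).
rewrite -!expiD -expi0; congr expi; ring.
Qed.

(** The value of [qder] is meaningful only if [delta_m b] belongs to [S^c]. This holds
    for [delta_2]. As the other two derivations commute with the multiplication by
    the unit [u], they map [b] into [S^c] if and only if they map [u ** b] there, and
    otherwise both values of [qder] are 0 by default. *)
Lemma qder_plane_wave s (u v : A) (m : 'I_3) (b : A) :
  qfun u = plane_wave s -> qfun v = plane_wave (- s) ->
  qder alpha m (u ** b) = u ** qder alpha m b
    + (if val m == 1%N then - (2 * pi%:C * 'i * s%:C) *: (u ** b) else 0).
Proof.
move=> eu ev; set e := - _.
have sm a : smooth_fun (qfun (a : A)) by exact: Sc_smooth (qfun_Sc a).
have main s' (u' : A) b' d : qfun u' = plane_wave s' ->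
    qfun d = qdelta c alpha m (qfun b') ->
    qfun (u' ** d + (if val m == 1%N then - (2 * pi%:C * 'i * s'%:C) *: (u' ** b') else 0))
      = qdelta c alpha m (qfun (u' ** b')).
  move=> eu' ed; rewrite (plane_waveM b' eu') qdelta_mode // -ed.
  rewrite addrC; case: ifP => _.
    rewrite (@qfun_linear _ _ _ _ _ A) !(plane_waveM _ eu').
    by apply/funext => x; apply/funext => y; apply/funext => p; rewrite !fctE addrC.
  rewrite add0r (plane_waveM _ eu').
  apply/funext => x; apply/funext => y; apply/funext => p.
  by rewrite /qadd [X in _ = _ + X]mul0r addr0.
have [[d ed]|nd] := pselect (exists d : A, qfun d = qdelta c alpha m (qfun b)).
  by rewrite (qderP ed); apply: qderP; exact: main.
have m1 : val m == 1%N = false.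
  apply/negP => /eqP m1; apply: nd; apply: qfun_surj.
  have -> : m = lift ord0 ord0 by exact: val_inj.
  exact: Sc_delta2 (qfun_Sc b).
have nd' : ~ exists d : A, qfun d = qdelta c alpha m (qfun (u ** b)).
  move=> [d ed]; apply: nd; exists (v ** d).
  by have := main _ v _ d ev ed; rewrite m1 addr0 (plane_waveK (s := - s)) ?opprK.
rewrite m1 addr0 /qder !xgetPN ?amulr0 //.
  by move=> d /= ed; apply: nd; exists d.
by move=> d /= ed; apply: nd'; exists d.
Qed.

Lemma expi_int1 : expi 1 = 1 :> C.
Proof. by rewrite /expi mulr1 mulr_natl cos2pi sin2pi. Qed.

Lemma expi_intN1 : expi (-1) = 1 :> C.
Proof. by rewrite /expi mulrN1 cosN sinN mulr_natl cos2pi sin2pi oppr0. Qed.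

Lemma ex_plane_waves : exists u v : A, qfun u = plane_wave 1 /\ qfun v = plane_wave (-1).
Proof.
have [u eu] := qfun_surj (Sc_mode c expi_int1).
by have [v ev] := qfun_surj (Sc_mode c expi_intN1); exists u, v.
Qed.

End PlaneWaves.

(** * Integrals over the unit square *)

Section Integrals.
Variable R : realType.
Local Open Scope classical_set_scope.
Local Notation mu := (@lebesgue_measure R).

Lemma continuous_integrable01 (h : R -> R) : continuous h ->
  mu.-integrable `[0, 1] (EFin \o h).
Proof.
move=> ch; apply: continuous_compact_integrable; first exact: segment_compact.
exact: continuous_subspaceT.
Qed.

(** If [h x0 > 0], then [h > h x0 / 2] on a subinterval of [0, 1] around [x0]; the ends
    [l] and [r] are cut off in case [x0] is at the boundary. *)
Lemma Rintegral_eq0_continuous (h : R -> R) : continuous h -> (forall x, 0 <= h x) ->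
  \int[mu]_(x in `[0, 1]) h x = 0 -> forall x, 0 <= x <= 1 -> h x = 0.
Proof.
move=> ch h0 I0 x0 x01; apply/eqP; apply: contrapT => /negP hx0.
have hx : 0 < h x0 by rewrite lt_neqAle eq_sym hx0 h0.
have : \forall x \near x0, h x0 / 2 < h x.
  by apply: (cvgr_gt _ (ch x0)); rewrite gtr_pMr // invf_lt1 // ltr1n.
move=> /nbhs_ballP[e /= e0 he].
have {x01} [x00 x01] : 0 <= x0 /\ x0 <= 1 by apply/andP.
pose l := Num.max 0 (x0 - e / 2); pose r := Num.min 1 (x0 + e / 2).
have e2 : 0 < e / 2 by rewrite divr_gt0.
have lr : l < r by rewrite lt_min !gt_max; apply/andP; split; apply/andP; split; lra.
have ll x : l <= x -> 0 <= x /\ x0 - e / 2 <= x by rewrite ge_max => /andP[].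
have rr x : x <= r -> x <= 1 /\ x <= x0 + e / 2 by rewrite le_min => /andP[].
have /integrableP[mh _] := continuous_integrable01 ch.
have lr01 : `[l, r]%classic `<=` `[0, 1]%classic.
  by move=> x /=; rewrite !in_itv /= => /andP[/ll[-> _] /rr[-> _]].
have I0' : (\int[mu]_(x in `[0%R, 1%R]) (h x)%:E = 0)%E.
  have fI : (\int[mu]_(x in `[0%R, 1%R]) (h x)%:E)%E \is a fin_num.
    exact: integrable_fin_num (continuous_integrable01 ch).
  by rewrite -(fineK fI) -[X in (X%:E)%E]/(\int[mu]_(x in `[0, 1]) h x) I0.
have : (\int[mu]_(x in `[l, r]) (h x)%:E <= 0)%E.
  rewrite -I0'; apply: ge0_subset_integral => //.
  by move=> x _; rewrite lee_fin.
apply/negP; rewrite -ltNge.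
apply: (@lt_le_trans _ _ (\int[mu]_(x in `[l, r]) (cst (h x0 / 2)%:E) x)%E).
  have mlr : mu `[l, r]%classic = (r - l)%:E.
    by rewrite lebesgue_measure_itv /= lte_fin lr EFinB.
  rewrite integral_cst // [X in (_ * X)%E]mlr -EFinM lte_fin.
  by rewrite mulr_gt0 ?subr_gt0 // divr_gt0.
apply: ge0_le_integral => //.
- by move=> x _; rewrite lee_fin divr_ge0 // ltW.
- by apply: (measurable_funS _ lr01 mh).
move=> x /=; rewrite in_itv /= => /andP[/ll[_ lx] /rr[_ rx]].
rewrite lee_fin ltW //; apply: he; rewrite /ball /= ltr_norml.
by apply/andP; split; lra.
Qed.

(** The inner integral is a continuous function of the parameter, by dominated
    convergence with the maximum of [G] on a compact neighbourhood as bound. *)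
Lemma iterated_Rintegral_eq0 (G : R -> R -> R) :
  continuous (fun z : R * R => G z.1 z.2) -> (forall x y, 0 <= G x y) ->
  \int[mu]_(x in `[0, 1]) (\int[mu]_(y in `[0, 1]) G x y) = 0 ->
  forall x y, 0 <= x <= 1 -> 0 <= y <= 1 -> G x y = 0.
Proof.
move=> cG G0 I0 x y x01 y01.
have c2 u : continuous (G u).
  move=> v; apply: (@continuous_comp _ _ _ (fun v => (u, v)) (fun z : R * R => G z.1 z.2)).
    have := @cvg_pair _ _ _ (nbhs v) (nbhs u) (nbhs v) _ _ _ (fun=> u) id.
    by apply; [exact: cvg_cst|exact: cvg_id].
  exact: (cG (u, v)).
have c1 v : continuous (G^~ v).
  move=> u; apply: (@continuous_comp _ _ _ (fun u => (u, v)) (fun z : R * R => G z.1 z.2)).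
    have := @cvg_pair _ _ _ (nbhs u) (nbhs u) (nbhs v) _ _ _ id (fun=> v).
    by apply; [exact: cvg_id|exact: cvg_cst].
  exact: (cG (u, v)).
pose F x := \int[mu]_(y in `[0, 1]) G x y.
have F0 u : 0 <= F u by apply: Rintegral_ge0.
have cF : continuous F.
  move=> u.
  have [M hM] : exists M, forall x y, `[u - 1, u + 1]%classic x -> `[0, 1]%classic y ->
      `|G x y| <= M.
    have cK : compact (`[u - 1, u + 1]%classic `*` `[0, 1]%classic : set (R * R)).
      by apply: compact_setX; exact: segment_compact.
    have cGK : {within `[u - 1, u + 1]%classic `*` `[0, 1]%classic,
        continuous (fun z : R * R => G z.1 z.2)} by exact: continuous_subspaceT.
    have [M [_ hM]] := compact_bounded (continuous_compact cGK cK).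
    exists (M + 1) => a b ha hb; apply: hM; first by rewrite ltrDl.
    by exists (a, b).
  have := @continuity_under_integral R _ _ mu G `[0, 1]%classic _ (u - 1) (u + 1) _ _ (cst M) _ _ u.
  apply => //.
  - by move=> a _; exact: continuous_integrable01.
  - by apply: aeW => b _ a _; exact: c1.
  - by apply: continuous_integrable01 => z; exact: cvg_cst.
  - move=> a /=; rewrite in_itv /= => /andP[/ltW ha /ltW hb]; apply: aeW => b hb'.
    by apply: hM => //=; rewrite in_itv /= ha hb.
  - by rewrite inE /= in_itv /=; apply/andP; split; lra.
have Fx : F x = 0 by exact: (Rintegral_eq0_continuous cF F0 I0).
exact: (Rintegral_eq0_continuous (c2 x) (G0 x) Fx).
Qed.

End Integrals.

(** * Faithfulness of the representation *)

Section Faithfulness.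
Variables (R : realType) (c : nat) (hbar mu nu : R).
Variable A : qhm_algebra c hbar mu nu.
Local Notation C := (R[i]).
Local Open Scope complex_scope.

Lemma periodic_int (f : R -> C) : (forall y, f (y + 1) = f y) ->
  forall (l : int) y, f (y + l%:~R) = f y.
Proof.
move=> f1; have nat n : forall y, f (y + n%:R) = f y.
  elim: n => [|n IH] y; first by rewrite addr0.
  by rewrite -natr1 addrA f1 IH.
move=> [n|n] y; first exact: nat.
by rewrite NegzE mulrNz -[LHS](nat n.+1) pmulrn subrK.
Qed.

Lemma Re_conj_mul (z : C) :
  complex.Re (Num.conj z * z) = complex.Re z ^+ 2 + complex.Im z ^+ 2.
Proof.
by rewrite mulrC -normCK normc_def -rmorphXn sqr_sqrtr // addr_ge0 ?sqr_ge0.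
Qed.

(** [w] is the component of [a] in degree [p0], so that the product of the adjoint
    of [w] with [a] has the single summand [|a(., ., p0)|^2] in degree 0. *)
Lemma qtrace_component (a w : A) (p0 : int) :
  qfun w = qmul (qcst (fun p => (p == p0)%:R)) (qfun a) ->
  exists s t, complex.Re (qtrace (qconj w ** a)) =
    \int[lebesgue_measure]_(x in `[0, 1]) \int[lebesgue_measure]_(y in `[0, 1])
      (complex.Re (qfun a (x + s) (y + t) p0) ^+ 2
       + complex.Im (qfun a (x + s) (y + t) p0) ^+ 2).
Proof.
move=> ew; exists (- (hbar * (- p0)%:~R * mu)), (- (hbar * (- p0)%:~R * nu)).
rewrite /qtrace /qtau /=; apply: eq_Rintegral => x _; apply: eq_Rintegral => y _.
rewrite qfunM qfun_conj ew /qstar (@sumZ_single _ _ (- p0)) => [|q qp].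
  by rewrite /qadj /qmul /qcst !subr0 sub0r opprK eqxx mul1r Re_conj_mul.
rewrite /qadj /qmul /qcst (_ : (- q == p0) = false) ?mul0r ?rmorph0 ?mul0r //.
by apply/negbTE; apply: contra qp => /eqP <-; rewrite opprK.
Qed.

Variable L : gns (@qconj R c hbar mu nu A) (@qtrace R c hbar mu nu A).

(** The component of [a] in degree [p0] is tested against [a] itself. The vanishing on
    a unit square extends to the plane by quasi-periodicity. *)
Lemma gns_vec_eq0 (a : A) : gns_vec L a = 0 -> a = 0.
Proof.
move=> a0; apply: (@qfun_inj _ _ _ _ _ A); rewrite (linear_at0 (@qfun_linear _ _ _ _ _ A)).
apply/funext => x; apply/funext => y; apply/funext => p0; rewrite [RHS](_ : _ = 0) //.
have Sa := qfun_Sc a; have [f1 _ fk _] := Sa.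
have [w ew] := qfun_surj A (Sc_cut p0 Sa).
have [s [t e]] := qtrace_component ew.
have := gns_ip L a w; rewrite a0 linear0l => /esym h.
rewrite {}h /= in e.
pose G x y := complex.Re (qfun a (x + s) (y + t) p0) ^+ 2
       + complex.Im (qfun a (x + s) (y + t) p0) ^+ 2.
have G0 u v : 0 <= G u v by rewrite addr_ge0 ?sqr_ge0.
have cG : continuous (fun z : R * R => G z.1 z.2).
  have ct : continuous (fun z : R * R => (z.1 + s, z.2 + t)).
    move=> z; have := @cvg_pair _ _ _ (nbhs z) (nbhs (z.1 + s)) (nbhs (z.2 + t)) _ _ _
      (fun z => z.1 + s) (fun z => z.2 + t).
    by apply; apply: cvgD; (exact: cvg_cst || exact: cvg_fst || exact: cvg_snd).
  have ra := smooth_regular (Sc_smooth Sa).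
  have cr : continuous (fun z : R * R => complex.Re (qfun a (z.1 + s) (z.2 + t) p0)).
    move=> z; apply: (@continuous_comp _ _ _ (fun z : R * R => (z.1 + s, z.2 + t))
      (fun z => complex.Re (qfun a z.1 z.2 p0)) z); [exact: ct|exact: regular_re].
  have ci : continuous (fun z : R * R => complex.Im (qfun a (z.1 + s) (z.2 + t) p0)).
    move=> z; apply: (@continuous_comp _ _ _ (fun z : R * R => (z.1 + s, z.2 + t))
      (fun z => complex.Im (qfun a z.1 z.2 p0)) z); [exact: ct|exact: regular_im].
  by move=> z; apply: cvgD; apply: cvgM; (exact: cr || exact: ci).
have G1 := iterated_Rintegral_eq0 cG G0 (esym e).
pose k := Num.floor (x - s); pose l := Num.floor (y - t).
have itv (u : R) : 0 <= u - (Num.floor u)%:~R <= 1.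
  have /andP[lo hi] := floor_itv u; rewrite subr_ge0 lo /= lerBlDr ltW //.
  by move: hi; rewrite intrD addrC.
have := G1 _ _ (itv (x - s)) (itv (y - t)).
rewrite /G -/k -/l.
have -> : x - s - k%:~R + s = x - k%:~R by ring.
have -> : y - t - l%:~R + t = y - l%:~R by ring.
move=> /eqP; rewrite paddr_eq0 ?sqr_ge0 // !sqrf_eq0 => /andP[/eqP r0 /eqP i0].
have z0 : qfun a (x - k%:~R) (y - l%:~R) p0 = 0.
  by move: r0 i0; case: (qfun a _ _ _) => ? ? /= -> ->.
have -> : x = x - k%:~R + k%:~R by rewrite subrK.
rewrite fk; have -> : qfun a (x - k%:~R) y p0 = qfun a (x - k%:~R) (y - l%:~R) p0.
  rewrite -[in LHS](subrK l%:~R y).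
  exact: (periodic_int (fun y => f1 (x - k%:~R) y p0)).
by rewrite z0 mulr0.
Qed.

Lemma gns_rep_inj : injective (gns_rep L).
Proof.
move=> a b ab; apply/eqP; rewrite -subr_eq0; apply/eqP/gns_vec_eq0.
rewrite (linfunB (@gns_linear _ _ _ _ L)).
have := congr1 (fun S : BH L => app S (gns_vec L (aone A))) ab.
by rewrite !gns_repE !amulr1 => ->; rewrite subrr.
Qed.

End Faithfulness.

(** * The even spectral triple *)

Section QhmEvenTriple.
Variables (R : realType) (c : nat) (hbar mu nu alpha : R).
Variable A : qhm_algebra c hbar mu nu.
Variable L : gns (@qconj R c hbar mu nu A) (@qtrace R c hbar mu nu A).
Variables (T : dirac_triple A (amp L 2)) (j : 'I_3).
Hypothesis qT : is_qhm_triple alpha T.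
Local Notation E := (even_triple T (sigma R j)).

Lemma even_repE a : rep E a = amp_op 1%:M (rep T a).
Proof. by []. Qed.

Lemma even_rep_inj : injective (rep E).
Proof.
move=> a b; rewrite !even_repE => ab; apply: (qhm_rep_inj qT (@gns_rep_inj _ _ _ _ _ _ L)).
apply: BH_ext => x.
have := congr1 (fun S : BH (amp (amp L 2) 2) => app S (fun=> x) ord0) ab.
by rewrite !amp_op1E.
Qed.

Lemma even_junk_one : junk_set (rep E) (dcomm E) (aone (BH (amp (amp L 2) 2))).
Proof.
have [u [v [eu ev]]] := ex_plane_waves A.
pose s0 : BH (amp L 2) := amp_op (sigma R (lift ord0 ord0)) (aone (BH L)).
pose e : R[i] := - (2 * pi%:C%C * 'i * (1 : R)%:C%C).
have du : dcomm T u = ('i%C * e) *: (rep T u ** s0).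
  by apply: (qhm_dcomm qT) => m b; exact: (qder_plane_wave alpha m b eu ev).
have s0C a : s0 ** rep T a = rep T a ** s0.
  by rewrite (qhm_rep qT) !amp_opM mulmx1 mul1mx amul1 amulr1.
have sC a : amp_op (sigma R j) s0 ** rep E a = rep E a ** amp_op (sigma R j) s0.
  by rewrite even_repE !amp_opM mulmx1 mul1mx s0C.
apply: (@junk_one_of_unit _ _ _ _ _ ('i%C * e) u v (amp_op (sigma R j) s0)).
- exact: rep_linear.
- exact: rep1.
- exact: repM.
- exact: dcomm_linear.
- exact: dcommM.
- by rewrite pnatr_eq0.
- rewrite mulf_neq0 //; first by rewrite complexiE neq0Ci.
  rewrite oppr_eq0 !mulf_neq0 ?neq0Ci ?pnatr_eq0 ?oner_eq0 //.
  by rewrite fmorph_eq0 gt_eqF // pi_gt0.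
- by rewrite -[v]amulr1 (plane_waveK _ eu ev).
- by rewrite -[u]amulr1; apply: (plane_waveK _ ev); rewrite opprK.
- by rewrite amp_opM sigma_sq /s0 amp_opM sigma_sq amul1 !amp_op1.
- exact: sC.
- exact: sC.
by rewrite even_dcomm du amp_opZ even_repE amp_opM mul1mx.
Qed.

End QhmEvenTriple.

Theorem proposition6p2 (R : realType) (c : nat) (hbar mu nu alpha : R)
    (A : qhm_algebra c hbar mu nu)
    (L : gns (@qconj R c hbar mu nu A) (@qtrace R c hbar mu nu A))
    (T : dirac_triple A (amp L 2))
    (j k : 'I_3)
    (HH : hilbert_tensor (amp (amp L 2) 2) (amp (amp L 2) 2))
    (P : dirac_triple (tensor_algebra A A) HH) :
  (0 < c)%N ->
  mu ^+ 2 + nu ^+ 2 != 0 ->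
  rat_independent3 1 (hbar * mu) (hbar * nu) ->
  1 < alpha ->
  is_qhm_triple alpha T ->
  j != k ->
  let E := even_triple T (sigma R j) in
  let gamma := @amp_map _ (amp L 2) 2 (sigma R k) id in
  is_product_triple E gamma E P ->
  bimodule_iso (Omega2 P)
    (dsum_bimodule (tensor_bimodule (Omega2 E) (regular_bimodule A))
      (dsum_bimodule (tensor_bimodule (regular_bimodule A) (Omega2 E))
                     (tensor_bimodule (Omega1 E) (Omega1 E)))).
Proof.
move=> _ _ _ _ qT jk E gamma prodP.
pose g : BH (amp (amp L 2) 2) := amp_op (sigma R k) (aone (BH (amp L 2))).
have gr a : g ** rep E a = rep E a ** g.
  by rewrite even_repE !amp_opM mulmx1 mul1mx amul1 amulr1.
have gd a : g ** dcomm E a = - (dcomm E a ** g).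
  by rewrite even_dcomm !amp_opM amul1 amulr1 sigma_anti // amp_opN.
have g2 : g ** g = aone (BH (amp (amp L 2) 2)).
  by rewrite amp_opM sigma_sq amul1 amp_op1.
have iE := @even_rep_inj _ _ _ _ _ _ _ _ _ j qT.
have jE := even_junk_one j qT.
exact: (@product_triple_Omega2 _ _ _ _ _ E E g HH P gr prodP g2 gd iE iE jE jE).
Qed.
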